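(* Let $\mathsf E\to M$ be a Courant algebroid. In the correspondence (of Li-Bland) between (wide) linear Dirac structures in $T\mathsf E$ and pseudo-Dirac structures $(U,\nabla^p)$ in $\mathsf E$, LA-Dirac structures in $T\mathsf E$ correspond to the pseudo-Dirac structures $(U,\nabla^p)$ such that 1. $U\subseteq\mathsf E$ satisfies $U^\perp\subseteq U$; 2. $\nabla^p$ sends $\Gamma(U^\perp)$ to zero and so, by the condition $\mathbf d\langle u_1,u_2\rangle=\langle\nabla^pu_1,u_2\rangle+\langle u_1,\nabla^pu_2\rangle$, has image in $U/U^\perp\subseteq\mathsf E/U^\perp\simeq U^*$; 3. the induced ordinary connection $\overline{\nabla^p}:\Gamma(U/U^\perp)\to\Omega^1(M,U/U^\perp)$ is flat.
   Context: **Courant algebroid** $(\mathsf E\to M,\rho,\langle\cdot,\cdot\rangle,[\![\cdot,\cdot]\!])$: nondegenerate symmetric pairing, anchor $\rho$, $\mathbb R$-bilinear bracket with $[\![e_1,[\![e_2,e_3]\!]]\!]=[\![[\![e_1,e_2]\!],e_3]\!]+[\![e_2,[\![e_1,e_3]\!]]\!]$, $\rho(e_1)\langle e_2,e_3\rangle=\langle[\![e_1,e_2]\!],e_3\rangle+\langle e_2,[\![e_1,e_3]\!]\rangle$, $[\![e_1,e_2]\!]+[\![e_2,e_1]\!]=\mathcal D\langle e_1,e_2\rangle$, $\langle\mathcal Df,e\rangle=\rho(e)f$. $\mathsf E$ is identified with $\mathsf E^*$ by the pairing, and $\rho^*:T^*M\to\mathsf E$ uses this identification. $U^\perp$ is the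 orthogonal of a subbundle $U\subseteq\mathsf E$, and $\mathsf E/U^\perp\simeq U^*$. **Tangent double.** $T\mathsf E$ is a double vector bundle with sides $\mathsf E$ (projection $T\mathsf E\to\mathsf E$) and $TM$ (projection $Tq_{\mathsf E}:T\mathsf E\to TM$) and core $\mathsf E$. For $e\in\Gamma(\mathsf E)$ there are the sections $Te$ and $e^\dagger$ of $T\mathsf E\to TM$, $e^\dagger(v_m)=T_m0^{\mathsf E}(v_m)+\frac{d}{dt}|_{t=0}te(m)$ (sum in $T\mathsf E\to\mathsf E$). $T\mathsf E\to TM$ has the tangent Courant algebroid structure: $\langle Te_1,Te_2\rangle=\ell_{\mathbf d\langle e_1,e_2\rangle}$, $\langle Te_1,e_2^\dagger\rangle=p_M^*\langle e_1,e_2\rangle$, $\langle e_1^\dagger,e_2^\dagger\rangle=0$, $[\![Te_1,Te_2]\!]=T[\![e_1,e_2]\!]$, $[\![Te_1,e_2^\dagger]\!]=[\![e_1,e_2]\!]^\dagger=[\![e_1^\dagger,Te_2]\!]$, $[\![e_1^\dagger,e_2^\dagger]\!]=0$, with anchors the complete lift (for $Te$) and vertical lift (for $e^\dagger$) of $\rho(e)$. $T\mathsf E\to\mathsf E$ has the standard Lie algebroid structure of a tangent bundle. **Linear and LA-Dirac structures in $T\mathsf E$.** A (wide) linear Dirac structure in $T\mathsf E$ is a double vector subbundle $D$ of $T\mathsf E$ with sides $TM$ and a subbundle $U\subseteq\mathsf E$ that is a Dirac structure in $T\mathsf E\to TM$ (maximal isotropic and closed under the bracket); its core is then $U^\perp$.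 It is an LA-Dirac structure if moreover $D\to U$ is a Lie subalgebroid of $T\mathsf E\to\mathsf E$. **Pseudo-Dirac structures.** A pseudo-Dirac structure in $\mathsf E$ is a subbundle $U\subseteq\mathsf E$ with a map $\nabla^p:\Gamma(U)\to\Omega^1(M,U^* )$ such that for all $u,u_i\in\Gamma(U)$, $f\in C^\infty(M)$: $\nabla^p(fu)=f\nabla^pu+\mathbf df\otimes\langle u,\cdot\rangle$; $\mathbf d\langle u_1,u_2\rangle=\langle\nabla^pu_1,u_2\rangle+\langle u_1,\nabla^pu_2\rangle$; $[\![u_1,u_2]\!]_p:=[\![u_1,u_2]\!]-\rho^*\langle\nabla^pu_1,u_2\rangle$ defines a bracket $\Gamma(U)\times\Gamma(U)\to\Gamma(U)$; and $$\bigl(\langle[\![u_1,u_2]\!]_p,\nabla^pu_3\rangle+\mathbf i_{\rho(u_1)}\mathbf d\langle\nabla^pu_2,u_3\rangle\bigr)+\text{c.p.}+\mathbf d\bigl(\langle\nabla^p_{\rho(u_1)}u_2-\nabla^p_{\rho(u_2)}u_1,u_3\rangle-\langle[\![u_1,u_2]\!]_p,u_3\rangle\bigr)=0.$$ **Correspondence.** Given a wide linear Dirac structure $D$ with side $U$, the total quotient $\mathsf q:T\mathsf E|_U\to\mathsf E/U^\perp\simeq U^*$ sends $x$ in the fibre over $v_m\in TM$ to $\overline{e(m)}$ if and only if $x-e^\dagger(v_m)\in D$ (difference in $T\mathsf E\to TM$... taken in the fibre over the point of $\mathsf{E}$, i.e. $x$ minus the core element $e(m)$ lies in $D$). The associated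 pseudo-Dirac structure is $(U,\nabla^p)$ with $\nabla^pu=\mathsf q\circ Tu$, i.e. $\nabla^p_{v_m}u=\mathsf q(T_mu(v_m))$. Equivalently, for any linear connection $\nabla$ on $\mathsf E$ preserving the pairing whose horizontal lifts of sections of $U$ lie in $D$, $\nabla^p_Xu$ is the class of $\nabla_Xu$ in $\mathsf E/U^\perp\simeq U^*$. Li-Bland's theorem states that $D\mapsto(U,\nabla^p)$ is a bijection between wide linear Dirac structures in $T\mathsf E$ and pseudo-Dirac structures in $\mathsf E$. *)

(* Defs.v *)
(* Manifolds are presented by their algebra of smooth functions (Sikorski
   differential spaces) and tangent vectors are derivations of it.  Structures
   are split into raw data (Records in Type) and axioms (Records in Prop). *)
From HB Require Import structures.
From mathcomp Require Import all_boot all_order all_algebra.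
From mathcomp Require Import boolp classical_sets functions reals topology.
From mathcomp Require Import normedtype derive.

Set Implicit Arguments.
Unset Strict Implicit.
Unset Printing Implicit Defensive.

Import Order.TTheory GRing.Theory Num.Theory numFieldNormedType.Exports.

Local Open Scope classical_set_scope.
Local Open Scope ring_scope.

Definition epsilon_or (T : Type) (x0 : T) (P : T -> Prop) : T :=
  match pselect (exists x, P x) with
  | left h => projT1 (cid h)
  | right _ => x0
  end.

Section SmoothSpaces.
Variable R : realType.

Fixpoint Ck (n k : nat) (f : 'rV[R]_n -> R) : Prop :=
  continuous f /\
  (if k is k'.+1 then
     forall v, (forall x, derivable f x v) /\ Ck k' ('D_v f)
   else True).

Definition Cinfty (n : nat) (f : 'rV[R]_n -> R) : Prop := forall k, Ck k f.

Definition tuple_map (X : Type) (n : nat) (g : 'I_n -> X -> R) (x : X) :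
  'rV[R]_n := \row_i g i x.

(* Functions that are locally C^oo functions of finitely many elements of G;
   "locally" refers to the initial topology of G, whose opens are unions of
   the sets {chi(g_1,...,g_k) <> 0}. *)
Definition smooth_closure (X : Type) (G : set (X -> R)) : set (X -> R) :=
  [set f | forall p, exists (k : nat) (g : 'I_k -> X -> R)
             (chi omega : 'rV[R]_k -> R),
     [/\ forall i, G (g i), Cinfty chi, Cinfty omega,
         chi (tuple_map g p) != 0 &
         forall x, chi (tuple_map g x) != 0 -> f x = omega (tuple_map g x)]].

Record dspace := DSpace {
  carrier :> Type;
  smooth : set (carrier -> R) }.

Definition dopen (X : dspace) (W : set X) : Prop :=
  forall p, W p -> exists2 g, smooth g &
    g p != 0 /\ forall x, g x != 0 -> W x.

(* (V, phi) is a chart: phi identifies V with an open subset of R^n, and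
   smooth functions are smooth in the coordinates phi. *)
Definition is_chart (X : dspace) (n : nat) (V : set X)
    (phi : 'I_n -> X -> R) : Prop :=
  [/\ dopen V, forall i, smooth (phi i),
      forall x y, V x -> V y -> tuple_map phi x = tuple_map phi y -> x = y,
      open (tuple_map phi @` V) &
      forall f y, smooth f -> V y -> exists2 F : 'rV[R]_n -> R, Cinfty F &
        \forall z \near tuple_map phi y,
          forall x, V x -> tuple_map phi x = z -> f x = F z].

Record is_manifold (X : dspace) : Prop := IsManifold {
  mfd_closed : smooth_closure (smooth (d := X)) `<=` smooth (d := X);
  mfd_hausdorff : forall x y : X, x <> y -> exists V W : set X,
    [/\ dopen V, dopen W, V x, W y & V `&` W = set0];
  mfd_second_countable : exists B : nat -> set X,
    (forall n, dopen (B n)) /\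
    forall W x, dopen W -> W x -> exists n, B n x /\ B n `<=` W;
  mfd_charts : exists n : nat, forall p : X, exists (V : set X)
    (phi : 'I_n -> X -> R), V p /\ is_chart V phi }.

Definition smooth_map (X Y : dspace) (phi : X -> Y) : Prop :=
  forall f, smooth f -> smooth (f \o phi).

Definition derivation_at (X : dspace) (p : X) (d : (X -> R) -> R) : Prop :=
  [/\ forall (c : R) f g, smooth f -> smooth g ->
        d (fun x => c * f x + g x) = c * d f + d g,
      forall f g, smooth f -> smooth g ->
        d (fun x => f x * g x) = f p * d g + g p * d f &
      forall f, ~ smooth f -> d f = 0].

(* A derivation is normalised to vanish on the non-smooth functions, so that
   it is determined by its values on the smooth ones. *)
Record tvec (X : dspace) := TVec {
  base : X;
  der : (X -> R) -> R;
  der_derivation : derivation_at base der }.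

Lemma derivation_at0 (X : dspace) (p : X) : derivation_at p (fun _ => 0).
Proof. by split=> *; rewrite ?mulr0 ?addr0. Qed.

(* The tangent vector at p acting as d on smooth functions; the default is
   only reached when d is not a derivation at p. *)
Definition mk_tvec (X : dspace) (p : X) (d : (X -> R) -> R) : tvec X :=
  match pselect (derivation_at p (fun f => if `[< smooth f >] then d f else 0))
  with
  | left h => TVec h
  | right _ => TVec (derivation_at0 p)
  end.

Definition tangent (X : dspace) : dspace :=
  @DSpace (tvec X) (smooth_closure
    [set h | exists2 f, smooth f &
       h = (fun v => f (base v)) \/ h = (fun v => der v f)]).

Definition push (X Y : dspace) (phi : X -> Y) (v : tangent X) : tangent Y :=
  mk_tvec (phi (base v)) (fun f => der v (f \o phi)).

Definition lie (X : dspace) (A B : X -> tangent X) (p : X) : tangent X :=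
  mk_tvec p (fun f =>
    der (A p) (fun x => der (B x) f) - der (B p) (fun x => der (A x) f)).

Definition dform (X : dspace) (theta : tangent X -> R) (A B : X -> tangent X)
    (p : X) : R :=
  der (A p) (fun x => theta (B x)) - der (B p) (fun x => theta (A x))
  - theta (lie A B p).

End SmoothSpaces.

Section VectorBundles.
Variable R : realType.

(* vadd x y is meaningful only when x and y lie in the same fibre. *)
Record vbundle (M E : dspace R) := VBundle {
  proj : E -> M;
  vzero : M -> E;
  vadd : E -> E -> E;
  vscale : R -> E -> E }.

Section Bundle.
Variables (M E : dspace R) (B : vbundle M E).

Definition is_section (s : M -> E) : Prop :=
  smooth_map s /\ forall m, proj B (s m) = m.

Definition section_in (L : set E) (s : M -> E) : Prop :=
  is_section s /\ forall m, L (s m).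

Definition fibre_linear (xi : E -> R) : Prop :=
  forall c x y, proj B x = proj B y ->
    xi (vadd B (vscale B c x) y) = c * xi x + xi y.

Definition lincomb (m : M) (r : nat) (c : 'rV[R]_r) (e : 'I_r -> E) : E :=
  \big[vadd B/vzero B m]_(i < r) vscale B (c 0 i) (e i).

Record is_vbundle : Prop := IsVBundle {
  vb_zero : forall m, proj B (vzero B m) = m;
  vb_add : forall x y, proj B x = proj B y -> proj B (vadd B x y) = proj B x;
  vb_scale : forall c x, proj B (vscale B c x) = proj B x;
  vb_addC : forall x y, proj B x = proj B y -> vadd B x y = vadd B y x;
  vb_addA : forall x y z, proj B x = proj B y -> proj B y = proj B z ->
    vadd B x (vadd B y z) = vadd B (vadd B x y) z;
  vb_add0 : forall x, vadd B (vzero B (proj B x)) x = x;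
  vb_addN : forall x, vadd B (vscale B (-1) x) x = vzero B (proj B x);
  vb_scale1 : forall x, vscale B 1 x = x;
  vb_scaleA : forall a b x, vscale B a (vscale B b x) = vscale B (a * b) x;
  vb_scaleDr : forall a x y, proj B x = proj B y ->
    vscale B a (vadd B x y) = vadd B (vscale B a x) (vscale B a y);
  vb_scaleDl : forall a b x,
    vscale B (a + b) x = vadd B (vscale B a x) (vscale B b x);
  (* smooth functions on E are those generated by basic and fibrewise linear
     ones; with the dual frames below this is local triviality *)
  vb_smooth : smooth (d := E) = smooth_closure
    ([set f \o proj B | f in smooth (d := M)] `|`
     [set xi | smooth xi /\ fibre_linear xi]);
  vb_frame : forall m, exists (V : set M) (r : nat) (e : 'I_r -> M -> E)
    (xi : 'I_r -> E -> R),
    [/\ dopen V /\ V m,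
        forall i, is_section (e i),
        forall i, smooth (xi i) /\ fibre_linear (xi i),
        forall n, V n -> forall i j, xi i (e j n) = (i == j)%:R &
        forall x, V (proj B x) ->
          x = lincomb (proj B x) (\row_i xi i x) (fun i => e i (proj B x))] }.

(* L is a smooth vector subbundle of the restriction of E to the closed
   embedded submanifold N of M; local frames of L are taken to be restrictions
   of sections of E. *)
Record is_subbundle (N : set M) (L : set E) : Prop := IsSubbundle {
  sb_base : forall x, L x -> N (proj B x);
  sb_zero : forall n, N n -> L (vzero B n);
  sb_add : forall x y, L x -> L y -> proj B x = proj B y -> L (vadd B x y);
  sb_scale : forall c x, L x -> L (vscale B c x);
  sb_frame : forall n, N n -> exists (V : set M) (r : nat)
    (s : 'I_r -> M -> E),
    [/\ dopen V /\ V n,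
        forall i, is_section (s i),
        forall p i, N p -> V p -> L (s i p) &
        forall x, L x -> V (proj B x) ->
          exists! c : 'rV[R]_r,
            x = lincomb (proj B x) c (fun i => s i (proj B x))] }.

End Bundle.

Definition tbundle (X : dspace R) : vbundle X (tangent X) :=
  @VBundle X (tangent X)
    (@base R X)
    (fun p => mk_tvec p (fun _ => 0))
    (fun v w => mk_tvec (base v) (fun f => der v f + der w f))
    (fun c v => mk_tvec (base v) (fun f => c * der v f)).

Definition vfield (X : dspace R) (A : X -> tangent X) : Prop :=
  is_section (tbundle X) A.

(* D -> S is a Lie subalgebroid of TX -> X, for a subbundle D of TX over the
   closed embedded submanifold S: the anchor maps D into TS (the vectors at
   points of S killing the functions that vanish on S), and brackets of
   sections of TX restricting to sections of D restrict to sections of D. *)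
Record lie_subalgebroid (X : dspace R) (S : set X) (D : set (tangent X)) :
    Prop := LieSubalgebroid {
  lsa_subbundle : is_subbundle (tbundle X) S D;
  lsa_anchor : forall x, D x -> forall f, smooth f ->
    (forall s, S s -> f s = 0) -> der x f = 0;
  lsa_bracket : forall A A', vfield A -> vfield A' ->
    (forall s, S s -> D (A s)) -> (forall s, S s -> D (A' s)) ->
    forall s, S s -> D (lie A A' s) }.

Section Prolongation.
Variables (M E : dspace R) (B : vbundle M E).

(* fibre product of E with itself over M *)
Definition whitney : dspace R :=
  @DSpace R {p : E * E | proj B p.1 = proj B p.2} (smooth_closure
    [set h | exists2 f : E -> R, smooth f &
       h = (fun p => f (sval p).1) \/ h = (fun p => f (sval p).2)]).

Definition whitney_fst (p : whitney) : E := (sval p).1.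
Definition whitney_snd (p : whitney) : E := (sval p).2.
Definition whitney_add (p : whitney) : E := vadd B (sval p).1 (sval p).2.

(* The vector bundle TE -> TM, all of whose structure maps are the tangent
   maps of those of E -> M; T(whitney) is the fibre product of TE with itself
   over TM, so T(whitney_add) is the addition. *)
Definition tprol : vbundle (tangent M) (tangent E) :=
  @VBundle (tangent M) (tangent E)
    (push (proj B))
    (push (vzero B))
    (fun x y => epsilon_or x (fun z => exists w : tangent whitney,
       [/\ push whitney_fst w = x, push whitney_snd w = y &
           push whitney_add w = z]))
    (fun c => push (vscale B c)).

(* the velocity at t = 0 of the curve t |-> t a in the fibre through a *)
Definition vertical0 (a : E) : tangent E :=
  mk_tvec (vzero B (proj B a))
    (fun F => derive1 (fun t : R => F (vscale B t a)) 0).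

Definition core_lift (v : tangent M) (a : E) : tangent E :=
  vadd (tbundle E) (push (vzero B) v) (vertical0 a).

Definition dagger (e : M -> E) (v : tangent M) : tangent E :=
  core_lift v (e (base v)).

End Prolongation.

End VectorBundles.

Section Courant.
Variable R : realType.

(* The bracket is meaningful on sections, the pairing on pairs of elements of
   the same fibre, cD on smooth functions. *)
Record courant (M E : dspace R) (B : vbundle M E) := Courant {
  pairing : E -> E -> R;
  anchor : E -> tangent M;
  cbracket : (M -> E) -> (M -> E) -> (M -> E);
  cD : (M -> R) -> (M -> E) }.

Section CourantAlgebroid.
Variables (M E : dspace R) (B : vbundle M E) (C : courant B).

Local Notation "<| x , y |>" := (pairing C x y).
Local Notation "[| s , t |]" := (cbracket C s t).
Local Notation rho := (anchor C).
Local Notation Gam := (is_section B).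
Local Notation "s +s t" := (fun m => vadd B (s m) (t m)) (at level 50).
Local Notation "c *s s" := (fun m => vscale B c (s m)) (at level 40).

Record is_courant : Prop := IsCourant {
  ca_bundle : is_vbundle B;
  ca_pair_sym : forall x y, proj B x = proj B y -> <|x, y|> = <|y, x|>;
  ca_pair_lin : forall c x y z, proj B x = proj B y -> proj B y = proj B z ->
    <|vadd B (vscale B c x) y, z|> = c * <|x, z|> + <|y, z|>;
  ca_pair_nondeg : forall x,
    (forall y, proj B y = proj B x -> <|x, y|> = 0) -> x = vzero B (proj B x);
  ca_pair_smooth : forall s t, Gam s -> Gam t ->
    smooth (fun m => <|s m, t m|>);
  ca_anchor_smooth : smooth_map rho;
  ca_anchor_base : forall x, base (rho x) = proj B x;
  ca_anchor_lin : forall c x y, proj B x = proj B y ->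
    rho (vadd B (vscale B c x) y)
    = vadd (tbundle M) (vscale (tbundle M) c (rho x)) (rho y);
  ca_bracket : forall s t, Gam s -> Gam t -> Gam [|s, t|];
  ca_bracket_linl : forall c s s' t, Gam s -> Gam s' -> Gam t ->
    [|c *s s +s s', t|] = c *s [|s, t|] +s [|s', t|];
  ca_bracket_linr : forall c s t t', Gam s -> Gam t -> Gam t' ->
    [|s, c *s t +s t'|] = c *s [|s, t|] +s [|s, t'|];
  ca_jacobi : forall e1 e2 e3, Gam e1 -> Gam e2 -> Gam e3 ->
    [|e1, [|e2, e3|]|] = [|[|e1, e2|], e3|] +s [|e2, [|e1, e3|]|];
  ca_metric : forall e1 e2 e3, Gam e1 -> Gam e2 -> Gam e3 -> forall m,
    der (rho (e1 m)) (fun x => <|e2 x, e3 x|>)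
    = <|[|e1, e2|] m, e3 m|> + <|e2 m, [|e1, e3|] m|>;
  ca_D : forall f, smooth f -> Gam (cD C f) /\
    forall x, <|cD C f (proj B x), x|> = der (rho x) f;
  ca_sym : forall e1 e2, Gam e1 -> Gam e2 ->
    [|e1, e2|] +s [|e2, e1|] = cD C (fun m => <|e1 m, e2 m|>) }.

Definition isotropic_subspace (m : M) (K : set E) : Prop :=
  [/\ forall x, K x -> proj B x = m, K (vzero B m),
      forall c x y, K x -> K y -> K (vadd B (vscale B c x) y) &
      forall x y, K x -> K y -> <|x, y|> = 0].

Record is_dirac (L : set E) : Prop := IsDirac {
  dirac_subbundle : is_subbundle B setT L;
  dirac_isotropic : forall m,
    isotropic_subspace m (L `&` [set x | proj B x = m]);
  dirac_maximal : forall m K, isotropic_subspace m K ->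
    L `&` [set x | proj B x = m] `<=` K -> K `<=` L;
  dirac_bracket : forall s t, section_in B L s -> section_in B L t ->
    section_in B L [|s, t|] }.

(* rho^* : T_m^*M -> E_m, with E_m identified with its dual *)
Definition rho_star (m : M) (theta : tangent M -> R) : E :=
  epsilon_or (vzero B m) (fun e => proj B e = m /\
    forall e', proj B e' = m -> <|e, e'|> = theta (rho e')).

Definition orth (U : set E) : set E :=
  [set x | forall w, U w -> proj B w = proj B x -> <|x, w|> = 0].

(* nab : Gamma(U) -> Omega^1(M, U^* ) is represented by
   nab u v w = <nab_v u, w>, for u in Gamma(U), v in T_mM and w in U_m. *)
Definition conn : Type := (M -> E) -> tangent M -> E -> R.

Definition eq_conn (U : set E) (nab nab' : conn) : Prop :=
  forall u v w, section_in B U u -> U w -> proj B w = base v ->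
    nab u v w = nab' u v w.

Section PseudoDirac.
Variables (U : set E) (nab : conn).

Definition pd_bracket (u1 u2 : M -> E) : M -> E :=
  [|u1, u2|] +s -1 *s (fun m => rho_star m (fun v => nab u1 v (u2 m))).

(* (<[u1,u2]_p, nab u3> + i_{rho u1} d<nab u2, u3>)(Y) *)
Definition pd_term (u1 u2 u3 : M -> E) (Y : M -> tangent M) (m : M) : R :=
  nab u3 (Y m) (pd_bracket u1 u2 m)
  + dform (fun v => nab u2 v (u3 (base v))) (rho \o u1) Y m.

Record is_pseudo_dirac : Prop := IsPseudoDirac {
  pd_subbundle : is_subbundle B setT U;
  pd_lin_vec : forall u c v v' w, section_in B U u -> U w ->
    base v = proj B w -> base v' = proj B w ->
    nab u (vadd (tbundle M) (vscale (tbundle M) c v) v') w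
    = c * nab u v w + nab u v' w;
  pd_lin_arg : forall u c v w w', section_in B U u -> U w -> U w' ->
    proj B w = base v -> proj B w' = base v ->
    nab u v (vadd B (vscale B c w) w') = c * nab u v w + nab u v w';
  pd_smooth : forall u X w, section_in B U u -> vfield X ->
    section_in B U w -> smooth (fun m => nab u (X m) (w m));
  pd_leibniz : forall f u v w, smooth f -> section_in B U u -> U w ->
    proj B w = base v ->
    nab (fun m => vscale B (f m) (u m)) v w
    = f (base v) * nab u v w + der v f * <|u (base v), w|>;
  pd_metric : forall u1 u2 v, section_in B U u1 -> section_in B U u2 ->
    der v (fun m => <|u1 m, u2 m|>)
    = nab u1 v (u2 (base v)) + nab u2 v (u1 (base v));
  pd_closed : forall u1 u2, section_in B U u1 -> section_in B U u2 ->
    section_in B U (pd_bracket u1 u2);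
  pd_jacobi : forall u1 u2 u3 Y m, section_in B U u1 -> section_in B U u2 ->
    section_in B U u3 -> vfield Y ->
    pd_term u1 u2 u3 Y m + pd_term u2 u3 u1 Y m + pd_term u3 u1 u2 Y m
    + der (Y m) (fun x => nab u2 (rho (u1 x)) (u3 x)
                          - nab u1 (rho (u2 x)) (u3 x)
                          - <|pd_bracket u1 u2 x, u3 x|>)
    = 0 }.

(* The section s of U represents the derivative along X of the class of u in
   Gamma(U/U^perp); U/U^perp embeds in E/U^perp = U^* by the pairing.  If
   orth U <= U and nab vanishes on Gamma(orth U), pd_metric shows that such an
   s exists and that its class depends only on the class of u. *)
Definition induced_conn (X : M -> tangent M) (u s : M -> E) : Prop :=
  section_in B U s /\
  forall w, U w -> nab u (X (proj B w)) w = <|s (proj B w), w|>.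

(* Curvature is zero as an element of U/U^perp, i.e. in U^*. *)
Definition induced_flat : Prop :=
  forall X Y u sX sY, vfield X -> vfield Y -> section_in B U u ->
    induced_conn X u sX -> induced_conn Y u sY ->
    forall w, U w ->
      nab sY (X (proj B w)) w - nab sX (Y (proj B w)) w
      - nab u (lie X Y (proj B w)) w = 0.

Definition flat_pseudo_dirac : Prop :=
  [/\ orth U `<=` U,
      forall u v w, section_in B (orth U) u -> U w -> proj B w = base v ->
        nab u v w = 0 &
      induced_flat].

End PseudoDirac.

End CourantAlgebroid.

Section TangentCourant.
Variables (M E : dspace R) (B : vbundle M E) (C : courant B).
Variable (CT : courant (tprol B)).

(* CT is the tangent Courant algebroid structure on TE -> TM.  The sections
   Te, e^dagger generate the sections over C^oo(TM), so CT is determined.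
   A tangent vector of TM is determined by its values on the functions f o p_M
   and v |-> v(f), which is how complete and vertical lifts are specified. *)
Record is_tangent_courant : Prop := IsTangentCourant {
  tc_courant : is_courant CT;
  tc_pair_TT : forall e1 e2 v, is_section B e1 -> is_section B e2 ->
    pairing CT (push e1 v) (push e2 v)
    = der v (fun m => pairing C (e1 m) (e2 m));
  tc_pair_Td : forall e1 e2 v, is_section B e1 -> is_section B e2 ->
    pairing CT (push e1 v) (dagger B e2 v)
    = pairing C (e1 (base v)) (e2 (base v));
  tc_pair_dd : forall e1 e2 v, is_section B e1 -> is_section B e2 ->
    pairing CT (dagger B e1 v) (dagger B e2 v) = 0;
  tc_br_TT : forall e1 e2, is_section B e1 -> is_section B e2 ->
    cbracket CT (push e1) (push e2) = push (cbracket C e1 e2);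
  tc_br_Td : forall e1 e2, is_section B e1 -> is_section B e2 ->
    cbracket CT (push e1) (dagger B e2) = dagger B (cbracket C e1 e2);
  tc_br_dT : forall e1 e2, is_section B e1 -> is_section B e2 ->
    cbracket CT (dagger B e1) (push e2) = dagger B (cbracket C e1 e2);
  tc_br_dd : forall e1 e2, is_section B e1 -> is_section B e2 ->
    cbracket CT (dagger B e1) (dagger B e2) = vzero (tprol B);
  tc_anchor_T : forall e v f, is_section B e -> smooth f ->
    der (anchor CT (push e v)) (fun w => f (base w))
      = der (anchor C (e (base v))) f /\
    der (anchor CT (push e v)) (fun w => der w f)
      = der v (fun m => der (anchor C (e m)) f);
  tc_anchor_d : forall e v f, is_section B e -> smooth f ->
    der (anchor CT (dagger B e v)) (fun w => f (base w)) = 0 /\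
    der (anchor CT (dagger B e v)) (fun w => der w f)
      = der (anchor C (e (base v))) f }.

(* D is a double vector subbundle of TE with sides TM and U. *)
Record linear_dirac (U : set E) (D : set (tangent E)) : Prop := LinearDirac {
  ld_side : is_subbundle B setT U;
  ld_over_E : is_subbundle (tbundle E) U D;
  ld_over_TM : is_subbundle (tprol B) setT D;
  ld_dirac : is_dirac CT D }.

Definition la_dirac (U : set E) (D : set (tangent E)) : Prop :=
  linear_dirac U D /\ lie_subalgebroid U D.

(* q(x) is the class of a in E/U^perp, for x in TE over U *)
Definition total_quotient (U : set E) (D : set (tangent E)) (x : tangent E)
    (a : E) : Prop :=
  [/\ U (base x), proj B a = proj B (base x) &
      D (vadd (tprol B) x
           (vscale (tprol B) (-1) (core_lift B (push (proj B) x) a)))].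

(* nab u = q o Tu, the class of a in E/U^perp being identified with the
   functional <a, .> on U *)
Definition associated (U : set E) (D : set (tangent E)) (nab : conn M E) :
    Prop :=
  forall u v a, section_in B U u -> proj B a = base v ->
    (total_quotient U D (push u v) a <->
     forall w, U w -> proj B w = base v -> nab u v w = pairing C a w).

(* The assignment D |-> (U, nab) is a bijection from the class L of linear
   Dirac structures onto the class P of pseudo-Dirac structures. *)
Definition corresponds_bijectively (L : set E -> set (tangent E) -> Prop)
    (P : set E -> conn M E -> Prop) : Prop :=
  (forall U D, L U D ->
     (exists nab, P U nab /\ associated U D nab) /\
     (forall nab nab', associated U D nab -> associated U D nab' ->
        P U nab -> P U nab' -> eq_conn B U nab nab')) /\
  (forall U nab, P U nab -> exists! D, L U D /\ associated U D nab).

End TangentCourant.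

End Courant.

(* Main.v *)
(* Let l_w be the fibrewise linear function <., w> of a section w of U.  The
   metric property of the pseudo-Dirac structure shows that D is the annihilator,
   over U, of the 1-forms d l_w - <nab w, .>, w in Gamma(U).  Hence an element of
   D over u in U is tangent to U iff it kills the functions l_tau with tau in
   Gamma(U^perp), which gives conditions 1 and 2.  If A and A' are vector fields
   on E with values in D along U, then A(l_w) = <nab w, .> along U, and
   evaluating [A, A'] on l_w leaves exactly the curvature of the induced
   connection, contracted with the projections of A and A' to M.

   Two facts about the differential space setting carry the argument.  Hadamard's
   lemma shows that derivations of a smooth closure are determined by their values
   on generators, and flat functions provide enough vector fields on M.  All
   sections needed on E and M are global: instead of dividing by functions that
   vanish away from a neighbourhood, identities are multiplied by them. *)
Require Import Defs.
From mathcomp Require Import all_boot all_order all_algebra.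
From mathcomp Require Import boolp classical_sets functions reals topology.
From mathcomp Require Import normedtype derive.
From HB Require Import structures.
From mathcomp Require Import landau constructive_ereal.
From mathcomp Require Import sequences realfun exp measure lebesgue_measure.
From mathcomp Require Import lebesgue_integral ftc ring lra.

Set Implicit Arguments.
Unset Strict Implicit.
Unset Printing Implicit Defensive.

Import Order.TTheory GRing.Theory Num.Theory numFieldNormedType.Exports.

Local Open Scope classical_set_scope.
Local Open Scope ring_scope.

(** * Functions of class C^k on R^n *)

Section Differentiability.
Variable R : realType.

(** The obstacle to the curvature computation is that a vector field [A] on [E] with values in [D]
    along [U] need not project to a vector field on [M]. Its projection is therefore expanded in
    fields [X j] on [M] with coefficients that are functions on [E]. The expansion holds over [U]
    only, and it may be differentiated along [D] precisely because elements of [D] are tangent to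
    [U]; this is why tangency precedes the bracket in both directions. In the commutator, the
    derivatives of the coefficients cancel by the first-order relation between [A(l_w)] and [nab w],
    which leaves an expression bilinear in the coefficients. One identity thus serves both
    implications: for flatness, [X] and [Y] themselves join the spanning fields, with lifts to [D]
    prescribed at one point; for closure of the bracket, a coordinate frame is enough.

    A second obstacle is that addition in [TE -> TM] is a choice among tangent vectors of the fibre
    product. It is used only through its effect on basic and fibrewise linear functions, which, with
    the base point, determines a tangent vector of [E]. *)

Lemma is_derive_line (V W : normedModType R) (f : V -> W) (x v : V) (t : R) :
  derivable f (t *: v + x) v ->
  is_derive t 1 (fun s => f (s *: v + x)) ('D_v f (t *: v + x)).
Proof.
have E : (fun h : R => h^-1 *: (((fun s => f (s *: v + x)) \o shift t) (h *: (1 : R)) - f (t *: v + x)))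
   = (fun h => h^-1 *: ((f \o shift (t *: v + x)) (h *: v) - f (t *: v + x))).
  apply/funext => h /=; congr (_ *: (f _ - _)).
  by rewrite addrA -scalerDl /GRing.scale /= mulr1.
by move=> df; apply: DeriveDef; rewrite /derivable /derive E.
Qed.

Lemma is_derive_line0 (V W : normedModType R) (f : V -> W) (x v : V) :
  derivable f x v -> is_derive (0 : R) 1 (fun s => f (s *: v + x)) ('D_v f x).
Proof.
have E : x = (0 : R) *: v + x by rewrite scale0r add0r.
by rewrite {1 3}E; exact: is_derive_line.
Qed.

Lemma MVT_line n (f : 'rV[R]_n -> R) (v x : 'rV[R]_n) (h : R) :
  (forall y, derivable f y v) ->
  exists2 c, `|c| <= `|h| & f (h *: v + x) - f x = h * 'D_v f (c *: v + x).
Proof.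
move=> df; pose g s := f (s *: v + x).
have dg s : is_derive s (1 : R) g ('D_v f (s *: v + x)) by exact: is_derive_line.
have cg : continuous g.
  by move=> s; apply/differentiable_continuous/derivable1_diffP; exact: ex_derive.
have g0 : g 0 = f x by rewrite /g scale0r add0r.
have [h0|h0] := leP 0 h.
- have [c + E] := @MVT_segment R g _ 0 h h0 (fun s _ => dg s) (continuous_subspaceT cg).
  rewrite in_itv /= => /andP[c0 ch]; exists c; first by rewrite !ger0_norm.
  by rewrite -g0 -/(g h) E subr0 mulrC.
- have [c + E] := @MVT_segment R g _ h 0 (ltW h0) (fun s _ => dg s) (continuous_subspaceT cg).
  rewrite in_itv /= => /andP[hc c0]; exists c.
    by rewrite !ler0_norm ?lerN2 // ltW.
  by rewrite -g0 -/(g h) -[LHS]opprB E sub0r mulrN opprK mulrC.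
Qed.

Lemma le_rV_norm n (x : 'rV[R]_n) (e : R) :
  0 <= e -> (forall i, `|x 0 i| <= e) -> `|x| <= e.
Proof.
move=> e0 xe; rewrite /Num.Def.normr /= mx_normrE bigmax_le //= => -[i j] _ /=.
by rewrite ord1.
Qed.

Lemma rV_norm_le n (x : 'rV[R]_n) i : `|x 0 i| <= `|x|.
Proof.
rewrite [leRHS]/Num.Def.normr /= mx_normrE.
by apply: (le_bigmax _ (fun ij => `|x ij.1 ij.2|) (0, i)).
Qed.

Lemma continuous_funD (T : topologicalType) (f g : T -> R) :
  continuous f -> continuous g -> continuous (fun x => f x + g x).
Proof. by move=> cf cg x; apply: cvgD; [exact: cf|exact: cg]. Qed.

Lemma continuous_funM (T : topologicalType) (f g : T -> R) :
  continuous f -> continuous g -> continuous (fun x => f x * g x).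
Proof. by move=> cf cg x; apply: cvgM; [exact: cf|exact: cg]. Qed.

Lemma continuous_bigsum (T : topologicalType) (I : Type) (r : seq I) (P : pred I)
    (F : I -> T -> R) :
  (forall i, continuous (F i)) -> continuous (fun x => \sum_(i <- r | P i) F i x).
Proof.
move=> cF; elim: r => [|i r IH] x.
  by under eq_fun do rewrite big_nil; exact: cvg_cst.
under eq_fun do rewrite big_cons; case: (P i); last exact: IH.
by apply: cvgD; [exact: cF|exact: IH].
Qed.

(** The increment is telescoped one coordinate at a time: [P k h] keeps the first [k] coordinates of
    [h], and the mean value theorem rewrites each step as a partial derivative at a nearby point.
    The induction is over all [e], so that each step can spend half of the error on the new
    coordinate. *)
Lemma C1_differentiable n (f : 'rV[R]_n -> R) (x : 'rV[R]_n) :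
  (forall v y, derivable f y v) -> (forall v, continuous ('D_v f)) ->
  differentiable f x.
Proof.
move=> df cdf.
pose P (k : nat) (h : 'rV[R]_n) : 'rV[R]_n := \row_i (if (i < k)%N then h 0 i else 0).
pose L (h : 'rV[R]_n) : R := \sum_i h 0 i * 'D_(delta_mx 0 i) f x.
have claim k : (k <= n)%N -> forall e : R, 0 < e -> \forall h \near (0 : 'rV[R]_n),
   `|f (P k h + x) - f x - \sum_(i < n | (i < k)%N) h 0 i * 'D_(delta_mx 0 i) f x| <= e * `|h|.
  elim: k => [_ e e0|k IH kn e e0].
    near=> h; rewrite big_pred0 // subr0.
    have -> : P 0 h = 0 by apply/rowP => i; rewrite !mxE.
    by rewrite add0r subrr normr0 mulr_ge0 // ltW.
  have e2 : 0 < e / 2 by rewrite divr_gt0.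
  have := IH (ltnW kn) _ e2.
  pose K := Ordinal kn.
  have /cvgrPdist_le /(_ _ e2) /nbhs_ballP[d /= d0 dP] := cdf (delta_mx 0 K) x.
  have nd : \forall h \near (0 : 'rV[R]_n), `|h| < d.
    by apply/nbhs_ballP; exists d => //= y; rewrite -ball_normE /= sub0r normrN.
  move=> IHk; near=> h.
  have hd : `|h| < d by near: h; exact: nd.
  have PS : P k.+1 h = h 0 K *: delta_mx 0 K + P k h.
    apply/rowP => i; rewrite !mxE eqxx /= ltnS leq_eqVlt -val_eqE /=.
    have [/val_inj ->|] := altP (nat_of_ord i =P nat_of_ord K).
      by rewrite ltnn mulr1 addr0.
    by rewrite mulr0 add0r.
  have [c ch E] := MVT_line (P k h + x) (h 0 K) (fun y => df (delta_mx 0 K) y).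
  rewrite (bigD1 K) //= (eq_bigl (fun i : 'I_n => (i < k)%N)); last first.
    move=> i; rewrite ltnS -val_eqE /= [RHS]ltn_neqAle andbC; congr (_ && _).
  rewrite PS -(addrA (h 0 K *: delta_mx 0 K)).
  have -> : f (h 0 K *: delta_mx 0 K + (P k h + x)) - f x -
     (h 0 K * 'D_(delta_mx 0 K) f x + \sum_(i < n | (i < k)%N) h 0 i * 'D_(delta_mx 0 i) f x) =
     h 0 K * ('D_(delta_mx 0 K) f (c *: delta_mx 0 K + (P k h + x)) - 'D_(delta_mx 0 K) f x) +
     (f (P k h + x) - f x - \sum_(i < n | (i < k)%N) h 0 i * 'D_(delta_mx 0 i) f x).
    by rewrite mulrBr -E; ring.
  apply: le_trans (ler_normD _ _) _.
  rewrite [e]splitr mulrDl; apply: lerD; last by near: h.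
  rewrite normrM mulrC; apply: ler_pM => //; last exact: rV_norm_le.
  rewrite distrC; apply: dP; rewrite -ball_normE /= addrA opprD addrCA subrr addr0.
  rewrite normrN; apply: le_lt_trans hd; apply: le_rV_norm => // i; rewrite !mxE eqxx /=.
  have [->|iK] := eqVneq i K.
    by rewrite ltnn addr0 mulr1 (le_trans ch) // rV_norm_le.
  by rewrite mulr0 add0r; case: ifP => _; rewrite ?normr0 // rV_norm_le.
have linL : linear L.
  move=> a u v; rewrite /L scaler_sumr -big_split /=; apply: eq_bigr => i _.
  by rewrite !mxE mulrDl /GRing.scale /= mulrA.
pose Lm := GRing.isLinear.Build R 'rV[R]_n R _ L linL.
pose LL : {linear 'rV[R]_n -> R} := HB.pack L Lm.
have cL : continuous LL.
  apply: continuous_bigsum => i h.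
  exact: (cvgM (@coord_continuous _ _ _ 0 i h) (cvg_cst _)).
have {}claim (e : R) : 0 < e -> \forall h \near (0 : 'rV[R]_n), `|f (h + x) - (f x + LL h)| <= e * `|h|.
  move=> e0; have := claim n (leqnn n) e e0.
  apply: filterS => h; rewrite opprD addrA.
  have -> : P n h = h by apply/rowP => i; rewrite mxE ltn_ord.
  by rewrite (eq_bigl xpredT) // => i; rewrite ltn_ord.
pose V : normedModType R := 'rV[R]_n.
have dL : 'd f x = LL :> (V -> R).
  by apply: diff_unique => //; apply/eqaddoP => e e0; exact: claim.
apply/diff_locallyP; split; rewrite dL //.
by apply/eqaddoP => e e0; exact: claim.
Unshelve. all: by end_near. Qed.

(** Only the restriction of [h] to the line through [x] along [v] matters, so directional
    derivability of [h] suffices: the usual chain rule is applied to the curve [g]. *)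
Lemma derive_comp (V : normedModType R) m (h : V -> 'rV[R]_m) (f : 'rV[R]_m -> R) x v :
  differentiable f (h x) -> derivable h x v ->
  is_derive x v (f \o h) ('d f (h x) ('D_v h x)).
Proof.
move=> df dh; pose g (s : R) := h (s *: v + x).
have g0 : g 0 = h x by rewrite /g scale0r add0r.
have dg : is_derive (0 : R) 1 g ('D_v h x) by exact: is_derive_line0.
have dg0 : differentiable g 0 by apply/derivable1_diffP; exact: ex_derive.
have df0 : differentiable f (g 0) by rewrite g0.
have dfg : differentiable (f \o g) 0 by exact: differentiable_comp.
have dfh : derivable (f \o h) x v by apply/derivable1P/derivable1_diffP.
have E := is_derive_line0 dfh; apply: DeriveDef => //.
rewrite -(@derive_val _ _ _ _ _ _ _ E) -[LHS]/('D_1 (f \o g) 0).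
rewrite deriveE // diff_comp //= g0; congr ('d f _ _).
by rewrite -(@derive_val _ _ _ _ _ _ _ dg) deriveE.
Qed.

Lemma diff_sum_partial m (f : 'rV[R]_m -> R) x w :
  differentiable f x -> 'd f x w = \sum_i w 0 i * 'D_(delta_mx 0 i) f x.
Proof.
move=> df; rewrite [in LHS](row_sum_delta w) linear_sum; apply: eq_bigr => i _.
by rewrite linearZ /= -deriveE.
Qed.

Lemma derive_linE (V : normedModType R) (f g : V -> R) c x v :
  derivable f x v -> derivable g x v ->
  'D_v (fun y => c * f y + g y) x = c * 'D_v f x + 'D_v g x.
Proof.
move=> df dg; rewrite -[c * _](deriveZ c df).
exact: (deriveD (derivableZ (k := c) df) dg).
Qed.

Lemma derive_mulE (V : normedModType R) (f g : V -> R) x v :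
  derivable f x v -> derivable g x v ->
  'D_v (fun y => f y * g y) x = f x * 'D_v g x + g x * 'D_v f x.
Proof. by move=> df dg; exact: (deriveM df dg). Qed.

Section CkTheory.
Variable n : nat.
Implicit Types (f g : 'rV[R]_n -> R) (x v : 'rV[R]_n).

Lemma Ck_continuous k f : Ck k f -> continuous f.
Proof. by case: k => [|k] []. Qed.

Lemma Ck_derivable k f v x : Ck k.+1 f -> derivable f x v.
Proof. by case=> _ /(_ v) []. Qed.

Lemma Ck_derive k f v : Ck k.+1 f -> Ck k ('D_v f).
Proof. by case=> _ /(_ v) []. Qed.

Lemma Ck_differentiable k f x : Ck k.+1 f -> differentiable f x.
Proof.
move=> Cf; apply: C1_differentiable => [v y|v]; first exact: Ck_derivable Cf.
exact: Ck_continuous (Ck_derive v Cf).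
Qed.

Lemma CkW k f : Ck k.+1 f -> Ck k f.
Proof.
elim: k f => [|k IH] f [cf df]; split => // v; have [dv Cv] := df v.
by split => //; exact: IH.
Qed.

Lemma Ck_cst k c : Ck k (fun _ : 'rV[R]_n => c).
Proof.
have cc (d : R) : continuous (fun _ : 'rV[R]_n => d) by exact: cst_continuous.
elim: k c => [|k IH] c; split; [exact: cc|by []|exact: cc|].
move=> v; split; first by move=> x; exact: (derivable_cst c x v).
by have -> : 'D_v (fun _ : 'rV[R]_n => c) = fun=> 0 by apply/funext => x; rewrite derive_cst.
Qed.

Lemma is_derive_coord i v x : is_derive x v (fun y : 'rV[R]_n => y 0 i) (v 0 i).
Proof.
have dx := @derivable_id _ _ x v.
have dc : derivable (fun y : 'rV[R]_n => y 0 i) x v.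
  exact: (derivable_mxP (fun y : 'rV[R]_n => y) x v).1.
apply: DeriveDef => //.
have E := derive_mx dx; rewrite derive_id in E.
by have := congr1 (fun M : 'rV[R]_n => M 0 i) E; rewrite mxE.
Qed.

Lemma Ck_coord k i : Ck k (fun x => x 0 i).
Proof.
have cc : continuous (fun x : 'rV[R]_n => x 0 i) by move=> x; exact: coord_continuous.
case: k => [|k]; split => // v; split; first by move=> x; exact: (@ex_derive _ _ _ _ _ _ _ (is_derive_coord i v x)).
have -> : 'D_v (fun y : 'rV[R]_n => y 0 i) = fun=> v 0 i.
  by apply/funext => x; exact: (@derive_val _ _ _ _ _ _ _ (is_derive_coord i v x)).
exact: Ck_cst.
Qed.

Lemma CkD k f g : Ck k f -> Ck k g -> Ck k (fun x => f x + g x).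
Proof.
elim: k f g => [|k IH] f g Cf Cg; split => //.
- by apply: continuous_funD; [exact: Ck_continuous Cf|exact: Ck_continuous Cg].
- by apply: continuous_funD; [exact: Ck_continuous Cf|exact: Ck_continuous Cg].
move=> v; have df x : derivable f x v := Ck_derivable Cf.
have dg x : derivable g x v := Ck_derivable Cg.
split; first by move=> x; exact: derivableD.
have -> : 'D_v (fun x => f x + g x) = fun x => 'D_v f x + 'D_v g x.
  by apply/funext => x; exact: deriveD.
by apply: IH; exact: Ck_derive.
Qed.

Lemma CkM k f g : Ck k f -> Ck k g -> Ck k (fun x => f x * g x).
Proof.
elim: k f g => [|k IH] f g Cf Cg; split => //.
- by apply: continuous_funM; [exact: Ck_continuous Cf|exact: Ck_continuous Cg].
- by apply: continuous_funM; [exact: Ck_continuous Cf|exact: Ck_continuous Cg].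
move=> v; have df x : derivable f x v := Ck_derivable Cf.
have dg x : derivable g x v := Ck_derivable Cg.
split; first by move=> x; exact: derivableM.
have -> : 'D_v (fun x => f x * g x) = fun x => f x * 'D_v g x + g x * 'D_v f x.
  by apply/funext => x; exact: deriveM.
exact: CkD (IH _ _ (CkW Cf) (Ck_derive v Cg)) (IH _ _ (CkW Cg) (Ck_derive v Cf)).
Qed.

Lemma Ck_sum k (I : Type) (r : seq I) (F : I -> 'rV[R]_n -> R) :
  (forall i, Ck k (F i)) -> Ck k (fun x => \sum_(i <- r) F i x).
Proof.
move=> CF; elim: r => [|i r IH]; first by under eq_fun do rewrite big_nil; exact: Ck_cst.
by under eq_fun do rewrite big_cons; exact: CkD.
Qed.

End CkTheory.

Lemma continuous_row (T : topologicalType) m (G : 'I_m -> T -> R) :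
  (forall i, continuous (G i)) -> continuous (fun x => \row_i G i x).
Proof.
move=> cG x; apply/cvgrPdist_le => e e0.
have : \forall y \near x, forall i, `|G i x - G i y| <= e.
  by apply: filter_forall => i; move/cvgrPdist_le : (cG i x); exact.
apply: filterS => y yP; apply: le_rV_norm; first exact: ltW.
by move=> i; rewrite !mxE.
Qed.

Lemma Ck_comp k m n (f : 'rV[R]_m -> R) (G : 'I_m -> 'rV[R]_n -> R) :
  Ck k f -> (forall i, Ck k (G i)) -> Ck k (fun x => f (\row_i G i x)).
Proof.
have cc j (f' : 'rV[R]_m -> R) (G' : 'I_m -> 'rV[R]_n -> R) :
   Ck j f' -> (forall i, Ck j (G' i)) -> continuous (fun x => f' (\row_i G' i x)).
  move=> Cf CG; have cG : continuous (fun x => \row_i G' i x).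
    by apply: continuous_row => i; exact: Ck_continuous (CG i).
  have cf := Ck_continuous Cf.
  by move=> x; apply: (@continuous_comp _ _ _ (fun x => \row_i G' i x) f'); [exact: cG|exact: cf].
elim: k f G => [|k IH] f G Cf CG; split => //; try exact: cc Cf CG.
move=> v; pose h x : 'rV[R]_m := \row_i G i x.
have dh x : derivable h x v.
  apply/derivable_mxP => i j; rewrite /h; under eq_fun do rewrite mxE.
  exact: Ck_derivable (CG j).
have D x := derive_comp (Ck_differentiable (h x) Cf) (dh x).
split; first by move=> x; exact: (@ex_derive _ _ _ _ _ _ _ (D x)).
have -> : 'D_v (fun x => f (\row_i G i x)) =
    fun x => \sum_i 'D_v (G i) x * 'D_(delta_mx 0 i) f (\row_i G i x).
  apply/funext => x; rewrite -[LHS]/('D_v (f \o h) x) (@derive_val _ _ _ _ _ _ _ (D x)).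
  rewrite diff_sum_partial; last exact: Ck_differentiable Cf.
  apply: eq_bigr => i _; congr (_ * _).
  rewrite derive_mx // mxE; congr ('D_v _ x).
  by apply/funext => y; rewrite /h mxE.
apply: Ck_sum => i; apply: CkM; first exact: Ck_derive (CG i).
exact: (IH _ G (Ck_derive _ Cf) (fun j => CkW (CG j))).
Qed.

End Differentiability.

(** * Hadamard's lemma *)

Section Hadamard.
Variable R : realType.

Definition int01 (f : R -> R) : R := (\int[@lebesgue_measure R]_(t in `[0%R, 1%R]) f t)%R.

Lemma integrable01 (f : R -> R) : continuous f ->
  (@lebesgue_measure R).-integrable `[0%R, 1%R] (EFin \o f).
Proof.
move=> cf; apply: continuous_compact_integrable; first exact: segment_compact.
exact: continuous_subspaceT.
Qed.

Lemma int01B (f g : R -> R) : continuous f -> continuous g ->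
  int01 f - int01 g = int01 (fun t => f t - g t).
Proof. by move=> cf cg; rewrite /int01 RintegralB //; exact: integrable01. Qed.

Lemma int01_sum (I : Type) (r : seq I) (F : I -> R -> R) : (forall i, continuous (F i)) ->
  int01 (fun t => \sum_(i <- r) F i t) = \sum_(i <- r) int01 (F i).
Proof.
move=> cF; elim: r => [|i r IH].
  rewrite big_nil; under [X in int01 X]eq_fun do rewrite big_nil.
  by rewrite /int01 Rintegral_cst // mul0r.
rewrite big_cons -IH; under [X in int01 X]eq_fun do rewrite big_cons.
rewrite /int01 RintegralD //; apply: integrable01 => //.
exact: continuous_bigsum.
Qed.

Lemma int01Z c (f : R -> R) : continuous f ->
  c * int01 f = int01 (fun t => c * f t).
Proof. by move=> cf; rewrite /int01 RintegralZl //; exact: integrable01. Qed.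

Lemma int01_derive (g dg : R -> R) : (forall t, is_derive t (1 : R) g (dg t)) ->
  continuous dg -> int01 dg = g 1 - g 0.
Proof.
move=> gd cdg; have cg : continuous g.
  by move=> t; apply/differentiable_continuous/derivable1_diffP; exact: ex_derive.
rewrite /int01 /Rintegral (@continuous_FTC2 _ dg g) //.
- exact: continuous_subspaceT.
- split.
  + by move=> x _; exact: ex_derive.
  + by apply: cvg_at_right_filter; exact: cg.
  + by apply: cvg_at_left_filter; exact: cg.
- by move=> x _; rewrite derive1E (@derive_val _ _ _ _ _ _ _ (gd x)).
Qed.

Lemma int01_cst e : int01 (fun=> e) = e.
Proof.
have de t : is_derive t (1 : R) (fun t => e *: t) e.
  have : is_derive t (1 : R) (e \*: id) (e *: 1) by exact: is_deriveZ.
  by rewrite [_ *: 1]mulr1.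
by rewrite (int01_derive de) /GRing.scale /= ?mulr1 ?mulr0 ?subr0 //; exact: cst_continuous.
Qed.

Lemma int01_le (f : R -> R) e : continuous f ->
  (forall t, 0 <= t <= 1 -> `|f t| <= e) -> `|int01 f| <= e.
Proof.
move=> cf fe; have cn : continuous (fun t => `|f t|).
  by move=> t; apply: cvg_norm; exact: cf.
apply: (le_trans (le_normr_Rintegral _ (integrable01 cf))) => //.
rewrite -(int01_cst e).
apply: le_Rintegral => //.
- exact: integrable01.
- by apply: integrable01; exact: cst_continuous.
Qed.

(** Compactness of [[0, 1]] makes the estimate uniform in [t]. This uniformity is what lets limits
    pass under [int01]. *)
Lemma tube (T : topologicalType) (K : T -> R -> R) (z : T) (e : R) :
  0 < e -> continuous (fun p : T * R => K p.1 p.2) ->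
  \forall z' \near z, forall t, 0 <= t <= 1 -> `|K z' t - K z t| <= e.
Proof.
move=> e0 cK.
have /compact_near_coveringP/(_ T (nbhs z) (fun z' t => `|K z' t - K z t| <= e)) H
  : compact `[0 : R, 1] by exact: segment_compact.
suff HH : forall t : R, [set` `[0 : R, 1]] t -> \forall t' \near t & z' \near z, `|K z' t' - K z t'| <= e.
  apply: (filterS _ (H _ HH)) => z' zP t t01; apply: zP.
  by rewrite /= in_itv.
move=> t _; have e2 : 0 < e / 2 by rewrite divr_gt0.
have /cvgrPdist_le /(_ _ e2) [[A B] [/= nA nB] AB] := cK (z, t).
exists (B, A) => //= -[t' z'] [/= Bt' Az'].
have h1 : `|K z t - K z' t'| <= e / 2 by apply: (AB (z', t')).
have h2 : `|K z t - K z t'| <= e / 2.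
  by apply: (AB (z, t')); split => //=; exact: nbhs_singleton.
have -> : K z' t' - K z t' = (K z t - K z t') - (K z t - K z' t') by ring.
by apply: le_trans (ler_normB _ _) _; rewrite [e]splitr lerD.
Qed.

Lemma continuous_slice (T : topologicalType) (K : T -> R -> R) z :
  continuous (fun p : T * R => K p.1 p.2) -> continuous (K z).
Proof.
move=> cK t; have cp : {for t, continuous (fun s : R => (z, s))}.
  by apply: (@cvg_pair _ _ _ _ (nbhs z) (nbhs t)) => //; exact: cvg_cst.
exact: (continuous_comp cp (cK (z, t))).
Qed.

Lemma continuous_int01 (T : topologicalType) (K : T -> R -> R) :
  continuous (fun p : T * R => K p.1 p.2) -> continuous (fun z => int01 (K z)).
Proof.
move=> cK z; apply/cvgrPdist_le => e e0.
apply: filterS (tube z e0 cK) => z' zP.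
have c t := continuous_slice (z := t) cK.
rewrite int01B //; apply: int01_le => [|t t01]; last by rewrite distrC zP.
by move=> t; apply: cvgB; exact: c.
Qed.

(** For each [t] the mean value theorem turns the difference quotient into [K'] at a point of the
    line whose position depends on [t]; [tube], applied to [K'] along that line, bounds the error
    uniformly. *)
Lemma is_derive_int01 n (K K' : 'rV[R]_n -> R -> R) (v z : 'rV[R]_n) :
  continuous (fun p : 'rV[R]_n * R => K p.1 p.2) ->
  continuous (fun p : 'rV[R]_n * R => K' p.1 p.2) ->
  (forall y t, is_derive y v (K ^~ t) (K' y t)) ->
  is_derive z v (fun y => int01 (K y)) (int01 (K' z)).
Proof.
move=> cK cK' dK.
have c t := continuous_slice (z := t) cK; have c' t := continuous_slice (z := t) cK'.
suff H : (fun h : R => h^-1 *: (((fun y => int01 (K y)) \o shift z) (h *: v) - int01 (K z))) @ 0^'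
   --> int01 (K' z).
  by apply: DeriveDef; [apply/cvg_ex; exists (int01 (K' z))|exact: cvg_lim H].
apply/cvgrPdist_le => e e0.
have cl : continuous (fun p : R * R => K' (p.1 *: v + z) p.2).
  have ca : continuous (fun p : R * R => (p.1 *: v + z, p.2)).
    have c1 : continuous (fun p : R * R => p.1 *: v + z).
      move=> p; apply: cvgD; last exact: cvg_cst.
      by apply: cvgZr_tmp; exact: cvg_fst.
    move=> p; apply: (@cvg_pair _ _ _ _ (nbhs (p.1 *: v + z)) (nbhs p.2)); first exact: c1.
    exact: cvg_snd.
  by move=> p; exact: (@continuous_comp _ _ _ (fun p : R * R => (p.1 *: v + z, p.2))
    (fun q : 'rV[R]_n * R => K' q.1 q.2) p (ca p) (cK' _)).
have := @tube R (fun s t => K' (s *: v + z) t) 0 e e0 cl => /nbhs_ballP [d /= d0 dP].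
rewrite near_withinE; apply/nbhs_ballP; exists d => //= h hd h0.
have cB (f g : R -> R) : continuous f -> continuous g -> continuous (fun t => f t - g t).
  by move=> cf cg t; apply: cvgB; [exact: cf|exact: cg].
have cZ (a : R) (f : R -> R) : continuous f -> continuous (fun t => a * f t).
  by move=> cf; apply: continuous_funM => //; exact: cst_continuous.
have cd := cB _ _ (c (h *: v + z)) (c z).
rewrite -[_ *: _]/(_ * _) /= int01B // int01Z // int01B //; last exact: cZ.
apply: int01_le => [|t t01]; first by apply: cB => //; exact: cZ.
have [b bh ->] := @MVT_line R n (K ^~ t) v z h (fun y => @ex_derive _ _ _ _ _ _ _ (dK y t)).
rewrite (@derive_val _ _ _ _ _ _ _ (dK _ t)) mulKf // distrC.
have := dP b; rewrite scale0r add0r; apply => //.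
rewrite /ball /= sub0r normrN; apply: le_lt_trans bh _.
by move: hd; rewrite /ball /= sub0r normrN.
Qed.

Section HadamardLemma.
Variables (n : nat) (z0 : 'rV[R]_n).
Implicit Types F : 'rV[R]_n -> R.

(** Hadamard's lemma only uses [m = 0]. The power of [t] is there because differentiating along [v]
    sends [ray_mean m F] to [ray_mean m.+1] of the derivative of [F], which closes the family under
    derivatives. *)
Definition ray_mean (m : nat) F (z : 'rV[R]_n) : R :=
  int01 (fun t => t ^+ m * F (t *: (z - z0) + z0)).

Let ray_continuous : continuous (fun p : 'rV[R]_n * R => p.2 *: (p.1 - z0) + z0).
Proof.
move=> p; apply: cvgD; last exact: cvg_cst.
apply: (@cvgZ _ _ _ _ _ (fun q : 'rV[R]_n * R => q.2) (fun q => q.1 - z0)).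
  exact: cvg_snd.
by apply: cvgB; [exact: cvg_fst|exact: cvg_cst].
Qed.

Let mean_continuous m F : continuous F ->
  continuous (fun p : 'rV[R]_n * R => p.2 ^+ m * F (p.2 *: (p.1 - z0) + z0)).
Proof.
move=> cF; apply: continuous_funM; last first.
  by move=> p; exact: (@continuous_comp _ _ _ (fun p : 'rV[R]_n * R => p.2 *: (p.1 - z0) + z0)
    F p (@ray_continuous p) (cF _)).
elim: m => [|m IH]; first by under eq_fun do rewrite expr0; exact: cst_continuous.
under eq_fun do rewrite exprS; apply: continuous_funM => //.
by move=> p; exact: cvg_snd.
Qed.

Lemma Ck_ray_mean k m F : Ck k F -> Ck k (ray_mean m F).
Proof.
have cc j f : continuous f -> continuous (ray_mean j f).
  move=> cf; apply: (@continuous_int01 'rV[R]_n (fun z t => t ^+ j * f (t *: (z - z0) + z0))).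
  exact: mean_continuous.
elim: k m F => [|k IH] m F CF; split => //; try by apply: cc; exact: Ck_continuous CF.
move=> v.
have D z : is_derive z v (ray_mean m F) (ray_mean m.+1 ('D_v F) z).
  apply: (@is_derive_int01 n (fun z t => t ^+ m * F (t *: (z - z0) + z0))
    (fun z t => t ^+ m.+1 * 'D_v F (t *: (z - z0) + z0))).
  - exact: mean_continuous (Ck_continuous CF).
  - exact: mean_continuous (Ck_continuous (Ck_derive v CF)).
  move=> y t.
  have dA : is_derive y v (fun x => t *: (x - z0) + z0) (t *: v).
    have : is_derive y v (t \*: (id - cst z0) + cst z0) (t *: (v - 0) + 0).
      by apply: is_deriveD; apply: is_deriveZ; apply: is_deriveB.
    by rewrite subr0 addr0.
  have dFy : differentiable F (t *: (y - z0) + z0) by exact: Ck_differentiable CF.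
  have dy := @ex_derive _ _ _ _ _ _ _ dA.
  have := @derive_comp R _ n (fun x => t *: (x - z0) + z0) F y v dFy dy.
  rewrite (@derive_val _ _ _ _ _ _ _ dA) linearZ /= -(deriveE _ dFy).
  move=> dF; have := is_deriveZ (t ^+ m) dF.
  by rewrite /GRing.scale /= mulrA -exprSr.
split; first by move=> z; exact: (@ex_derive _ _ _ _ _ _ _ (D z)).
have -> : 'D_v (ray_mean m F) = ray_mean m.+1 ('D_v F).
  by apply/funext => z; exact: (@derive_val _ _ _ _ _ _ _ (D z)).
exact: IH (Ck_derive v CF).
Qed.

(** [h i] is the mean of the [i]-th partial derivative over the segment from [z0] to [z]; the
    expansion is the fundamental theorem of calculus on that segment. *)
Lemma hadamard F : Cinfty F -> exists h : 'I_n -> 'rV[R]_n -> R,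
  [/\ forall i, Cinfty (h i), forall i, h i z0 = 'D_(delta_mx 0 i) F z0 &
      forall z, F z = F z0 + \sum_i (z - z0) 0 i * h i z].
Proof.
move=> CF; exists (fun i => ray_mean 0 ('D_(delta_mx 0 i) F)); split.
- by move=> i k; apply: Ck_ray_mean; exact: Ck_derive (CF k.+1).
- move=> i; rewrite /ray_mean; set c := 'D_(delta_mx 0 i) F z0.
  have -> : (fun t => t ^+ 0 * 'D_(delta_mx 0 i) F (t *: (z0 - z0) + z0)) = fun=> c.
    by apply/funext => t; rewrite expr0 mul1r subrr scaler0 add0r.
  exact: int01_cst.
move=> z; pose w := z - z0; pose G i t := w 0 i * 'D_(delta_mx 0 i) F (t *: w + z0).
have cD i : continuous (fun t : R => 'D_(delta_mx 0 i) F (t *: w + z0)).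
  have cd := Ck_continuous (Ck_derive (delta_mx 0 i) (CF 1%N)).
  have cl : continuous (fun t : R => t *: w + z0).
    by move=> t; apply: cvgD; [exact: scalel_continuous|exact: cvg_cst].
  by move=> t; exact: (@continuous_comp _ _ _ (fun t : R => t *: w + z0) _ t (cl t) (cd _)).
have cG i : continuous (G i).
  by apply: continuous_funM => //; exact: cst_continuous.
have dF t : is_derive t (1 : R) (fun t => F (t *: w + z0)) (\sum_i G i t).
  have dd := Ck_differentiable (t *: w + z0) (CF 1%N).
  by rewrite /G -diff_sum_partial // -deriveE //; apply: is_derive_line; exact: Ck_derivable (CF 1%N).
have := int01_derive dF (continuous_bigsum cG).
rewrite scale1r scale0r add0r subrK => E; rewrite -[LHS](subrK (F z0)) -E addrC; congr (_ + _).
rewrite int01_sum //; apply: eq_bigr => i _; rewrite /G -int01Z //; congr (_ * _).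
by congr int01; apply/funext => t; rewrite expr0 mul1r.
Qed.

End HadamardLemma.

End Hadamard.

(** * Flat functions and cut-offs *)

Section Flat.
Variable R : realType.
Implicit Types (p q : {poly R}) (t : R).

(** With all polynomials [p] allowed, the functions [p(1/t) exp(-1/t)] extended by 0 are closed
    under differentiation, so their smoothness at 0 reduces to the single limit [flat_cvg0]. *)
Definition flat p t : R := if 0 < t then p.[t^-1] * expR (- t^-1) else 0.

Lemma flat_le0 p t : t <= 0 -> flat p t = 0.
Proof. by rewrite /flat leNgt => /negPf ->. Qed.

Lemma expr_le_expR (y : R) i : 0 <= y -> y ^+ i <= i`!%:R * expR y.
Proof.
move=> y0; case: i => [|i].
  by rewrite expr0 mul1r -expR0 ler_expR.
rewrite mulrC -ler_pdivrMr ?ltr0n ?fact_gt0 //.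
by apply: le_trans (expR_ge1Dxn i y0); rewrite lerDr.
Qed.

Lemma flat_bounded p : exists2 C : R, 0 <= C & forall t, `|flat p t| <= C.
Proof.
exists (\sum_(i < size p) `|p`_i| * i`!%:R).
  by apply: sumr_ge0 => i _; rewrite mulr_ge0.
move=> t; rewrite /flat; case: ifPn => [t0|_]; last first.
  by rewrite normr0; apply: sumr_ge0 => i _; rewrite mulr_ge0.
have y0 : 0 <= t^-1 by rewrite invr_ge0 ltW.
rewrite normrM expRN (ger0_norm (_ : 0 <= (expR t^-1)^-1)) ?invr_ge0 ?expR_ge0 //.
rewrite ler_pdivrMr ?expR_gt0 // horner_coef; apply: le_trans (ler_norm_sum _ _ _) _.
rewrite mulr_suml; apply: ler_sum => i _.
rewrite normrM -mulrA ler_wpM2l // ger0_norm ?exprn_ge0 //.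
exact: expr_le_expR.
Qed.

Lemma flat_mulX p t : flat ('X * p) t = t^-1 * flat p t.
Proof. by rewrite /flat; case: ifP => _; rewrite ?mulr0 // hornerM hornerX mulrA. Qed.

(** One more factor [1/t] still leaves a bounded function, so [flat p t] is [t] times something
    bounded. *)
Lemma flat_cvg0 p : flat p t @[t --> 0^'] --> (0 : R).
Proof.
have [C C0 CP] := flat_bounded ('X * p).
have E t : t != 0 -> flat p t = t * flat ('X * p) t.
  by move=> t0; rewrite flat_mulX mulrA divff // mul1r.
apply/cvgrPdist_le => e e0; rewrite near_withinE; apply/nbhs_ballP.
have C1 : 0 < C + 1 by rewrite ltr_wpDl.
exists (e / (C + 1)) => /=; first by rewrite divr_gt0.
move=> t; rewrite /ball /= sub0r normrN => te t0; rewrite sub0r normrN E // normrM.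
apply: (@le_trans _ _ (`|t| * (C + 1))).
  by rewrite ler_wpM2l // (le_trans (CP t)) // lerDl.
by rewrite -ler_pdivlMr // ltW.
Qed.

(** The polynomial of the derivative: [p(1/t)] and [exp(-1/t)] each contribute a factor [t ^- 2],
    with opposite signs. *)
Definition dflat p := 'X ^+ 2 * (p - p^`()).

Lemma is_derive_flat p t : is_derive t (1 : R) (flat p) (flat (dflat p) t).
Proof.
have [t0|t0|->] := ltgtP t 0.
- rewrite [flat (dflat p) t]flat_le0 ?ltW //.
  have H : \forall s \near t, cst 0 s = flat p s.
    by near=> s; rewrite flat_le0 // ltW //; near: s; exact: lt_nbhsl.
  exact: (near_eq_is_derive H (is_derive_cst (0 : R) t 1)).
- have H : \forall s \near t, p.[s^-1] * expR (- s^-1) = flat p s.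
    by near=> s; rewrite /flat ifT //; near: s; exact: lt_nbhsr.
  have dV : is_derive t (1 : R) (fun s : R => s^-1) (- t ^- 2).
    have t0' : id t != 0 by rewrite gt_eqF.
    have := is_deriveV t0' (is_derive_id t (1 : R)).
    by rewrite /GRing.scale /= mulr1.
  have dp : is_derive t (1 : R) (fun s => p.[s^-1]) (p^`().[t^-1] * - t ^- 2).
    have dh : is_derive (t^-1) (1 : R) (horner p) p^`().[t^-1].
      by apply: DeriveDef; [exact: derivable_horner|rewrite -derive1E -derivE].
    exact: (is_derive1_comp dh dV).
  have dE : is_derive t (1 : R) (fun s => expR (- s^-1)) (expR (- t^-1) * t ^- 2).
    have dN : is_derive t (1 : R) (fun s : R => - s^-1) (t ^- 2).
      by rewrite -[t ^- 2]opprK; exact: is_deriveN.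
    exact: (@is_derive1_comp R expR (fun s : R => - s^-1) t _ _ (is_derive_expR _) dN).
  apply: (near_eq_is_derive H).
  have := is_deriveM dp dE.
  rewrite /flat t0 /dflat hornerM hornerXn hornerD hornerN /GRing.scale /=.
  move=> D; apply: is_derive_eq D _.
  by rewrite exprVn; ring.
- rewrite [flat (dflat p) 0]flat_le0 //.
  suff H : (fun h : R => h^-1 *: ((flat p \o shift 0) (h *: 1) - flat p 0)) @ 0^' --> (0 : R).
    by apply: DeriveDef; [apply/cvg_ex; exists 0|exact: cvg_lim H].
  (* The difference quotient at 0 is itself a flat function. *)
  have -> : (fun h : R => h^-1 *: ((flat p \o shift 0) (h *: 1) - flat p 0)) = flat ('X * p).
    apply/funext => h; rewrite flat_mulX (flat_le0 _ (lexx 0)) subr0 /= addr0.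
    by rewrite [_ *: 1]mulr1.
  exact: flat_cvg0.
Unshelve. all: by end_near. Qed.

Lemma Ck_flat k p : Ck k (fun z : 'rV[R]_1 => flat p (z 0 0)).
Proof.
have df q t : differentiable (flat q) t by apply/derivable1_diffP; exact: (@ex_derive _ _ _ _ _ _ _ (is_derive_flat q t)).
have dc q (z : 'rV[R]_1) : differentiable (fun z : 'rV[R]_1 => flat q (z 0 0)) z.
  apply: (@differentiable_comp _ _ _ _ (fun z : 'rV[R]_1 => z 0 0) (flat q)) => //.
  exact: differentiable_coord.
have cc q : continuous (fun z : 'rV[R]_1 => flat q (z 0 0)).
  by move=> z; exact: differentiable_continuous.
elim: k p => [|k IH] p; split; [exact: cc|by []|exact: cc|].
move=> v; split; first by move=> z; exact: diff_derivable.
have -> : 'D_v (fun z : 'rV[R]_1 => flat p (z 0 0)) = fun z => v 0 0 * flat (dflat p) (z 0 0).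
  apply/funext => z; have dz : differentiable (fun z : 'rV[R]_1 => z 0 0) z by exact: differentiable_coord.
  rewrite deriveE // (@diff_comp _ _ _ _ (fun z : 'rV[R]_1 => z 0 0) (flat p)) //= -(deriveE _ dz).
  rewrite (@derive_val _ _ _ _ _ _ _ (is_derive_coord 0 v z)).
  rewrite -[v 0 0 in LHS]mulr1 -[_ * 1]/(_ *: _) linearZ /= -deriveE //.
  by rewrite (@derive_val _ _ _ _ _ _ _ (is_derive_flat p _)).
by apply: CkM; [exact: Ck_cst|exact: IH].
Qed.

Definition bumpf : R -> R := flat 1.

Lemma bump_gt0 t : 0 < t -> bumpf t != 0.
Proof. by move=> t0; rewrite /bumpf /flat t0 hornerC mul1r gt_eqF ?expR_gt0. Qed.

Lemma bump_neq0 t : bumpf t != 0 -> 0 < t.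
Proof. by rewrite /bumpf /flat; case: ifP => // _; rewrite eqxx. Qed.

Lemma Cinfty_bump n (f : 'rV[R]_n -> R) : Cinfty f -> Cinfty (fun z => bumpf (f z)).
Proof.
move=> Cf k; have := @Ck_comp R k 1 n _ (fun=> f) (Ck_flat k 1) (fun=> Cf k).
by under eq_fun do rewrite mxE.
Qed.

Lemma Cinfty_cst n c : Cinfty (fun _ : 'rV[R]_n => c).
Proof. by move=> k; exact: Ck_cst. Qed.

Lemma Cinfty_coord n i : Cinfty (fun z : 'rV[R]_n => z 0 i).
Proof. by move=> k; exact: Ck_coord. Qed.

Lemma CinftyD n (f g : 'rV[R]_n -> R) : Cinfty f -> Cinfty g -> Cinfty (fun z => f z + g z).
Proof. by move=> Cf Cg k; exact: CkD. Qed.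

Lemma CinftyM n (f g : 'rV[R]_n -> R) : Cinfty f -> Cinfty g -> Cinfty (fun z => f z * g z).
Proof. by move=> Cf Cg k; exact: CkM. Qed.

Lemma Cinfty_sum n (I : Type) (r : seq I) (F : I -> 'rV[R]_n -> R) :
  (forall i, Cinfty (F i)) -> Cinfty (fun z => \sum_(i <- r) F i z).
Proof. by move=> CF k; apply: Ck_sum => i; exact: CF. Qed.

Lemma Cinfty_comp m n (f : 'rV[R]_m -> R) (G : 'I_m -> 'rV[R]_n -> R) :
  Cinfty f -> (forall i, Cinfty (G i)) -> Cinfty (fun x => f (\row_i G i x)).
Proof. by move=> Cf CG k; apply: Ck_comp => // i; exact: CG. Qed.

Lemma Cinfty_derive n (f : 'rV[R]_n -> R) v : Cinfty f -> Cinfty ('D_v f).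
Proof. by move=> Cf k; exact: Ck_derive (Cf k.+1). Qed.

(** The norm on row vectors is the maximum norm, in general not smooth. The bump is therefore built
    on the square [S] of the Euclidean distance, which dominates it. *)
Lemma Cinfty_cutoff n (z0 : 'rV[R]_n) (O : set 'rV[R]_n) : nbhs z0 O ->
  exists chi : 'rV[R]_n -> R, [/\ Cinfty chi, chi z0 != 0 & forall z, chi z != 0 -> O z].
Proof.
move=> /nbhs_ballP[e /= e0 eO].
pose S (z : 'rV[R]_n) : R := \sum_i (z 0 i + - z0 0 i) * (z 0 i + - z0 0 i).
have CS : Cinfty S.
  apply: Cinfty_sum => i; apply: CinftyM; apply: CinftyD; try exact: Cinfty_coord; exact: Cinfty_cst.
exists (fun z => bumpf (e ^+ 2 + -1 * S z)); split.
- apply: Cinfty_bump; apply: CinftyD; first exact: Cinfty_cst.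
  by apply: CinftyM => //; exact: Cinfty_cst.
- apply: bump_gt0; rewrite /S big1 ?mulr0 ?addr0 ?exprn_gt0 // => i _.
  by rewrite subrr mulr0.
- move=> z /bump_neq0; rewrite mulN1r subr_gt0 => Sz; apply: eO.
  rewrite -ball_normE /=.
  have [d d0 de] : exists2 d : R, 0 <= d & S z = d ^+ 2.
    exists (Num.sqrt (S z)); first exact: sqrtr_ge0.
    by rewrite sqr_sqrtr //; apply: sumr_ge0 => i _; exact: sqr_ge0.
  apply: (@le_lt_trans _ _ d); last first.
    by rewrite -(ltr_pXn2r (n := 2)) ?nnegrE ?(ltW e0) // -de.
  apply: le_rV_norm => // i; rewrite -(ler_pXn2r (n := 2)) ?nnegrE // -de.
  rewrite !mxE /S real_normK ?num_real // (bigD1 i) //= -expr2 -sqrrN opprB lerDl.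
  by apply: sumr_ge0 => j _; exact: sqr_ge0.
Qed.

End Flat.

(** * Differential spaces and derivations *)

Section SmoothClosure.
Variables (R : realType) (X : Type).
Implicit Types (G : set (X -> R)) (f : X -> R) (p : X).

Lemma sub_smooth_closure G : G `<=` smooth_closure G.
Proof.
move=> f Gf p; exists 1%N, (fun=> f), (fun=> 1), (fun z => z 0 0).
split; [by []|exact: Cinfty_cst|exact: Cinfty_coord|exact: oner_neq0|].
by move=> x _; rewrite /tuple_map mxE.
Qed.

(** Representations of finitely many functions near [p] are merged by concatenating their generators
    and multiplying their cut-offs. Substituting one representation into another, hence idempotence,
    requires such a common representation. *)
Lemma smooth_closure_simul G p k (f : 'I_k -> X -> R) :
  (forall i, smooth_closure G (f i)) ->
  exists K (g : 'I_K -> X -> R) (chi : 'rV[R]_K -> R) (omega : 'I_k -> 'rV[R]_K -> R),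
    [/\ forall i, G (g i), Cinfty chi, forall i, Cinfty (omega i),
        chi (tuple_map g p) != 0 &
        forall x, chi (tuple_map g x) != 0 -> forall i, f i x = omega i (tuple_map g x)].
Proof.
elim: k f => [|k IH] f Gf.
  exists 0%N, (fun i x => 0), (fun=> 1), (fun i z => 0).
  split; [by case|exact: Cinfty_cst|by case|exact: oner_neq0|by move=> x _ []].
have [K1 [g1 [chi1 [om1 [G1 C1 O1 n1 E1]]]]] := IH _ (fun j => Gf (lift ord0 j)).
have [K0 [g0 [chi0 [om0 [G0 C0 O0 n0 E0]]]]] := Gf ord0 p.
pose l0 (z : 'rV[R]_(K0 + K1)%N) : 'rV[R]_K0 := \row_i z 0 (lshift K1 i).
pose l1 (z : 'rV[R]_(K0 + K1)%N) : 'rV[R]_K1 := \row_i z 0 (rshift K0 i).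
pose g (i : 'I_(K0 + K1)%N) : X -> R := match fintype.split i with inl j => g0 j | inr j => g1 j end.
have g0E x : l0 (tuple_map g x) = tuple_map g0 x.
  by apply/rowP => i; rewrite !mxE /g; rewrite (unsplitK (inl i)).
have g1E x : l1 (tuple_map g x) = tuple_map g1 x.
  by apply/rowP => i; rewrite !mxE /g; rewrite (unsplitK (inr i)).
have Cl0 F : Cinfty F -> Cinfty (F \o l0).
  by move=> CF; apply: (@Cinfty_comp R K0 _ F (fun i z => z 0 (lshift K1 i))) => // i; exact: Cinfty_coord.
have Cl1 F : Cinfty F -> Cinfty (F \o l1).
  by move=> CF; apply: (@Cinfty_comp R K1 _ F (fun i z => z 0 (rshift K0 i))) => // i; exact: Cinfty_coord.
exists (K0 + K1)%N, g, (fun z => (chi0 \o l0) z * (chi1 \o l1) z),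
  (fun i => if unlift ord0 i is Some j then om1 j \o l1 else om0 \o l0); split.
- by move=> i; rewrite /g; case: (fintype.split i).
- by apply: CinftyM; [exact: Cl0|exact: Cl1].
- by move=> i; case: unliftP => [j|] _; [exact: Cl1|exact: Cl0].
- by rewrite /= g0E g1E mulf_neq0.
- move=> x; rewrite /= g0E g1E mulf_eq0 negb_or => /andP[c0 c1] i.
  by case: unliftP => [j ->|->] /=; rewrite ?g0E ?g1E; [exact: E1|exact: E0].
Qed.

Lemma smooth_closure_idem G : smooth_closure (smooth_closure G) `<=` smooth_closure G.
Proof.
move=> f Gf p; have [k [g [chi [om [Gg Cc Co n E]]]]] := Gf p.
have [K [h [ch [w [Gh Ch Oh nh Eh]]]]] := smooth_closure_simul p Gg.
have hE x : ch (tuple_map h x) != 0 -> tuple_map g x = \row_i w i (tuple_map h x).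
  by move=> cx; apply/rowP => i; rewrite !mxE Eh.
exists K, h, (fun z => ch z * chi (\row_i w i z)), (fun z => om (\row_i w i z)); split => //.
- by apply: CinftyM => //; exact: Cinfty_comp.
- exact: Cinfty_comp.
- by rewrite mulf_neq0 // -hE.
- by move=> x; rewrite mulf_eq0 negb_or => /andP[c0]; rewrite -hE // => /E.
Qed.

End SmoothClosure.

Definition smooth_complete (R : realType) (X : dspace R) : Prop :=
  smooth_closure (smooth (d := X)) `<=` smooth (d := X).

Lemma generated_complete (R : realType) (X : dspace R) (G : set (X -> R)) :
  smooth (d := X) = smooth_closure G -> smooth_complete X.
Proof. by move=> XG; rewrite /smooth_complete XG; exact: smooth_closure_idem. Qed.

Section SmoothFunctions.
Variables (R : realType) (X : dspace R).
Hypothesis cX : smooth_complete X.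
Implicit Types (f g : X -> R).

Lemma smooth_comp k (F : 'rV[R]_k -> R) (f : 'I_k -> X -> R) :
  Cinfty F -> (forall i, smooth (f i)) -> smooth (fun x => F (tuple_map f x)).
Proof.
move=> CF sf; apply: cX => p; exists k, f, (fun=> 1), F.
split; [exact: sf|exact: Cinfty_cst|exact: CF|exact: oner_neq0|by []].
Qed.

Lemma smooth_comp1 (e : R -> R) f : Cinfty (fun z : 'rV[R]_1 => e (z 0 0)) -> smooth f ->
  smooth (fun x => e (f x)).
Proof.
move=> Ce sf; have := smooth_comp Ce (fun=> sf).
by congr smooth; apply/funext => x; rewrite /tuple_map mxE.
Qed.

Lemma smooth_cst c : smooth (fun _ : X => c).
Proof.
have := @smooth_comp 0 (fun=> c) (fun _ _ => 0) (@Cinfty_cst _ _ c).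
by apply => -[].
Qed.

Let pair2 f g (i : 'I_2) := if i == ord0 then f else g.

Lemma smoothD f g : smooth f -> smooth g -> smooth (fun x => f x + g x).
Proof.
move=> sf sg; have C2 : Cinfty (fun z : 'rV[R]_2 => z 0 0 + z 0 1).
  by apply: CinftyD; exact: Cinfty_coord.
have := @smooth_comp 2 _ (pair2 f g) C2 _.
under [X in smooth X]eq_fun do rewrite !mxE /pair2 /=.
by apply => i; rewrite /pair2; case: ifP.
Qed.

Lemma smoothM f g : smooth f -> smooth g -> smooth (fun x => f x * g x).
Proof.
move=> sf sg; have C2 : Cinfty (fun z : 'rV[R]_2 => z 0 0 * z 0 1).
  by apply: CinftyM; exact: Cinfty_coord.
have := @smooth_comp 2 _ (pair2 f g) C2 _.
under [X in smooth X]eq_fun do rewrite !mxE /pair2 /=.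
by apply => i; rewrite /pair2; case: ifP.
Qed.

Lemma smoothZ c f : smooth f -> smooth (fun x => c * f x).
Proof. by move=> sf; apply: smoothM => //; exact: smooth_cst. Qed.

Lemma smooth_lin c f g : smooth f -> smooth g -> smooth (fun x => c * f x + g x).
Proof. by move=> sf sg; apply: smoothD => //; exact: smoothZ. Qed.

Lemma smoothN f : smooth f -> smooth (fun x => - f x).
Proof.
by move=> sf; have := smoothZ (-1) sf; congr smooth; apply/funext => x; rewrite mulN1r.
Qed.

Lemma smoothB f g : smooth f -> smooth g -> smooth (fun x => f x - g x).
Proof. by move=> sf sg; apply: smoothD => //; exact: smoothN. Qed.

Lemma smooth_sum (I : Type) (r : seq I) (f : I -> X -> R) : (forall i, smooth (f i)) ->
  smooth (fun x => \sum_(i <- r) f i x).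
Proof.
move=> sf; elim: r => [|i r IH].
  by under [X in smooth X]eq_fun do rewrite big_nil; exact: smooth_cst.
by under [X in smooth X]eq_fun do rewrite big_cons; exact: smoothD.
Qed.

Lemma smooth_prod (I : Type) (r : seq I) (f : I -> X -> R) : (forall i, smooth (f i)) ->
  smooth (fun x => \prod_(i <- r) f i x).
Proof.
move=> sf; elim: r => [|i r IH].
  by under [X in smooth X]eq_fun do rewrite big_nil; exact: smooth_cst.
by under [X in smooth X]eq_fun do rewrite big_cons; exact: smoothM.
Qed.

Lemma smooth_local f : (forall p, exists g h, [/\ smooth g, smooth h, g p != 0 &
   forall x, g x != 0 -> f x = h x]) -> smooth f.
Proof.
move=> H; apply: cX => p; have [g [h [sg sh gp E]]] := H p.
exists 2, (pair2 g h), (fun z => z 0 0), (fun z => z 0 1); split.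
- by move=> i; rewrite /pair2; case: ifP.
- exact: Cinfty_coord.
- exact: Cinfty_coord.
- by rewrite mxE.
- by move=> x; rewrite !mxE; exact: E.
Qed.

(** * Calculus of derivations at a point *)

Section Derivation.
Variables (p : X) (d : (X -> R) -> R).
Hypothesis dd : derivation_at p d.

Lemma derivation_lin c f g : smooth f -> smooth g ->
  d (fun x => c * f x + g x) = c * d f + d g.
Proof. by case: dd => H _ _; exact: H. Qed.

Lemma derivationM f g : smooth f -> smooth g ->
  d (fun x => f x * g x) = f p * d g + g p * d f.
Proof. by case: dd => _ H _; exact: H. Qed.

Lemma derivationD f g : smooth f -> smooth g -> d (fun x => f x + g x) = d f + d g.
Proof.
move=> sf sg; rewrite -[d f]mul1r -derivation_lin //; congr d.
by apply/funext => x; rewrite mul1r.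
Qed.

Lemma derivation_cst c : d (fun=> c) = 0.
Proof.
have s1 := smooth_cst 1.
have d1 : d (fun=> 1) = 0.
  have := derivationM s1 s1; under [X in d X]eq_fun do rewrite mulr1.
  by rewrite !mul1r => /eqP; rewrite addrC -subr_eq subrr eq_sym => /eqP.
have d0 : d (fun=> 0) = 0.
  have -> : d (fun=> 0) = -1 * d (fun=> 1) + d (fun=> 1).
    rewrite -derivation_lin //; congr d.
    by apply/funext => x; rewrite mulN1r addNr.
  by rewrite d1 mulr0 addr0.
have -> : d (fun=> c) = c * d (fun=> 1) + d (fun=> 0).
  rewrite -derivation_lin //; last exact: smooth_cst.
  by congr d; apply/funext => x; rewrite mulr1 addr0.
by rewrite d1 d0 mulr0 addr0.
Qed.

Lemma derivationZ c f : smooth f -> d (fun x => c * f x) = c * d f.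
Proof.
move=> sf; have := derivation_lin c sf (smooth_cst 0); rewrite derivation_cst addr0 => <-.
by congr d; apply/funext => x; rewrite addr0.
Qed.

Lemma derivationN f : smooth f -> d (fun x => - f x) = - d f.
Proof.
move=> sf; rewrite -[RHS]mulN1r -derivationZ //; congr d.
by apply/funext => x; rewrite mulN1r.
Qed.

Lemma derivationB f g : smooth f -> smooth g -> d (fun x => f x - g x) = d f - d g.
Proof. by move=> sf sg; rewrite derivationD ?derivationN //; exact: smoothN. Qed.

Lemma derivation_sum (I : Type) (r : seq I) (f : I -> X -> R) : (forall i, smooth (f i)) ->
  d (fun x => \sum_(i <- r) f i x) = \sum_(i <- r) d (f i).
Proof.
move=> sf; elim: r => [|i r IH].
  by under [X in d X]eq_fun do rewrite big_nil; rewrite big_nil derivation_cst.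
under [X in d X]eq_fun do rewrite big_cons.
by rewrite big_cons derivationD ?IH //; exact: smooth_sum.
Qed.

(** [g * f1] and [g * f2] agree on all of [X]; the Leibniz rule at [p] then leaves an equality
    multiplied by [g p], which can be cancelled. *)
Lemma derivation_local g f1 f2 : smooth g -> g p != 0 -> smooth f1 -> smooth f2 ->
  (forall x, g x != 0 -> f1 x = f2 x) -> d f1 = d f2.
Proof.
move=> sg gp s1 s2 E; apply: (mulfI gp).
have E' : (fun x => g x * f1 x) = (fun x => g x * f2 x).
  by apply/funext => x; have [->|/E ->//] := eqVneq (g x) 0; rewrite !mul0r.
have := congr1 d E'; rewrite !derivationM // (E p gp).
by move/addIr.
Qed.

(** In Hadamard's expansion around the value at [p] every summand has a factor vanishing at [p], so
    the derivation only sees the values [h i] there, which are the partial derivatives. *)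
Lemma derivation_comp k (F : 'rV[R]_k -> R) (f : 'I_k -> X -> R) :
  Cinfty F -> (forall i, smooth (f i)) ->
  d (fun x => F (tuple_map f x)) = \sum_i d (f i) * 'D_(delta_mx 0 i) F (tuple_map f p).
Proof.
move=> CF sf; have [h [Ch h0 E]] := hadamard (tuple_map f p) CF.
have E' : (fun x => F (tuple_map f x)) =
    fun x => F (tuple_map f p) + \sum_i (f i x - f i p) * h i (tuple_map f x).
  by apply/funext => x; rewrite E; congr (_ + _); apply: eq_bigr => i _; rewrite !mxE.
have s1 i : smooth (fun x => f i x - f i p) by apply: smoothB => //; exact: smooth_cst.
have s2 i : smooth (fun x => h i (tuple_map f x)) by exact: smooth_comp.
have s3 i : smooth (fun x => (f i x - f i p) * h i (tuple_map f x)) by exact: smoothM.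
rewrite E' derivationD; [|exact: smooth_cst|exact: smooth_sum].
rewrite derivation_cst add0r derivation_sum //; apply: eq_bigr => i _.
rewrite derivationM // subrr mul0r add0r derivationB //; last exact: smooth_cst.
by rewrite derivation_cst subr0 -h0 mulrC.
Qed.

End Derivation.

Lemma derivation_ext (G : set (X -> R)) (p : X) (d1 d2 : (X -> R) -> R) :
  smooth (d := X) = smooth_closure G -> derivation_at p d1 -> derivation_at p d2 ->
  (forall g, G g -> d1 g = d2 g) -> d1 =1 d2.
Proof.
move=> XG D1 D2 E f; have [sf|nf] := pselect (smooth f); last first.
  by case: D1 D2 => _ _ N1 [_ _ N2]; rewrite N1 // N2.
have := sf; rewrite XG => /(_ p)[k [g [chi [om [Gg Cc Co n H]]]]].
have sg i : smooth (g i) by rewrite XG; exact: sub_smooth_closure.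
have sc := smooth_comp Cc sg; have so := smooth_comp Co sg.
rewrite (derivation_local D1 sc n sf so H) (derivation_local D2 sc n sf so H).
rewrite (derivation_comp D1 Co sg) (derivation_comp D2 Co sg); apply: eq_bigr => i _.
by rewrite E.
Qed.

Lemma tvec_ext (v w : tangent X) : base v = base w ->
  (forall f, smooth f -> der v f = der w f) -> v = w.
Proof.
case: v w => [p d hd] [q e he] /= pq E; subst q.
have dE : d = e.
  apply/funext => f; have [sf|nf] := pselect (smooth f); first exact: E.
  by case: (hd) (he) => _ _ N1 [_ _ N2]; rewrite N1 // N2.
by subst e; congr TVec; exact: Prop_irrelevance.
Qed.

Lemma base_mk_tvec (p : X) d : base (mk_tvec p d) = p.
Proof. by rewrite /mk_tvec; case: pselect. Qed.

(** The two conditions on [d] exclude the default of [mk_tvec]. They concern smooth functions only,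
    because [mk_tvec] replaces [d] by 0 elsewhere. *)
Lemma der_mk_tvec (p : X) d f :
  (forall c f g, smooth f -> smooth g -> d (fun x => c * f x + g x) = c * d f + d g) ->
  (forall f g, smooth f -> smooth g -> d (fun x => f x * g x) = f p * d g + g p * d f) ->
  smooth f -> der (mk_tvec p d) f = d f.
Proof.
move=> L M sf; rewrite /mk_tvec; case: pselect => [_|] /=; first by rewrite asboolT.
case; split.
- by move=> c a b sa sb; rewrite !asboolT ?L //; exact: smooth_lin.
- by move=> a b sa sb; rewrite !asboolT ?M //; exact: smoothM.
- by move=> a na; rewrite asboolF.
Qed.

Lemma smooth_der f : smooth f -> smooth (fun v : tangent X => der v f).
Proof. by move=> sf; apply: sub_smooth_closure; exists f => //; right. Qed.

Lemma base_vfield (A : X -> tangent X) x : vfield A -> base (A x) = x.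
Proof. by case=> _ /(_ x). Qed.

Lemma smooth_vfield (A : X -> tangent X) f : vfield A -> smooth f ->
  smooth (fun x => der (A x) f).
Proof. by case=> sA _ sf; exact: (sA _ (smooth_der sf)). Qed.

Lemma vfieldP (A : X -> tangent X) : (forall x, base (A x) = x) ->
  (forall f, smooth f -> smooth (fun x => der (A x) f)) -> vfield A.
Proof.
move=> bA sA; split => // F sF; apply: cX => p.
have [k [g [chi [om [Gg Cc Co n H]]]]] := sF (A p).
exists k, (fun i => g i \o A), chi, om; split => //; last by move=> x; exact: H.
move=> i; case: (Gg i) => f sf [->|->] /=; last exact: sA.
have -> // : (fun v : tangent X => f (base v)) \o A = f.
by apply/funext => x /=; rewrite bA.
Qed.

Lemma der_lie (A B : X -> tangent X) p f : vfield A -> vfield B -> smooth f ->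
  der (lie A B p) f = der (A p) (fun x => der (B x) f) - der (B p) (fun x => der (A x) f).
Proof.
move=> vA vB sf; have bA := base_vfield _ vA; have bB := base_vfield _ vB.
have dA x := der_derivation (A x); have dB x := der_derivation (B x).
rewrite /lie der_mk_tvec // => [c a b sa sb|a b sa sb].
- have E (C : X -> tangent X) : vfield C -> (fun x => der (C x) (fun y => c * a y + b y)) =
      fun x => c * der (C x) a + der (C x) b.
    by move=> vC; apply/funext => x; rewrite (derivation_lin (der_derivation _)).
  rewrite !E // !(derivation_lin (der_derivation _)) ?smooth_vfield //; try exact: smooth_vfield.
  by ring.
- have E (C : X -> tangent X) : vfield C -> (fun x => der (C x) (fun y => a y * b y)) =
      fun x => a x * der (C x) b + b x * der (C x) a.
    by move=> vC; apply/funext => x; rewrite (derivationM (der_derivation _)) // base_vfield.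
  have sAa := smooth_vfield vA sa; have sAb := smooth_vfield vA sb.
  have sBa := smooth_vfield vB sa; have sBb := smooth_vfield vB sb.
  rewrite !E // !(derivationD (der_derivation _)); try exact: smoothM.
  rewrite !(derivationM (der_derivation _)) // bA bB.
  by ring.
Qed.

Lemma base_lie (A B : X -> tangent X) p : base (lie A B p) = p.
Proof. exact: base_mk_tvec. Qed.

End SmoothFunctions.

Lemma base_push (R : realType) (X Y : dspace R) (phi : X -> Y) v :
  base (push phi v) = phi (base v).
Proof. exact: base_mk_tvec. Qed.

Lemma der_push (R : realType) (X Y : dspace R) (phi : X -> Y) v f :
  smooth_complete Y -> smooth_map phi -> smooth f -> der (push phi v) f = der v (f \o phi).
Proof.
move=> cY sphi sf; rewrite /push der_mk_tvec // => [c a b sa sb|a b sa sb].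
- exact: (derivation_lin (der_derivation v) c (sphi _ sa) (sphi _ sb)).
- exact: (derivationM (der_derivation v) (sphi _ sa) (sphi _ sb)).
Qed.

Lemma smooth_map_comp (R : realType) (X Y Z : dspace R) (phi : X -> Y) (psi : Y -> Z) :
  smooth_map phi -> smooth_map psi -> smooth_map (psi \o phi).
Proof. by move=> sphi spsi f sf; exact: (sphi _ (spsi _ sf)). Qed.

Lemma push_comp (R : realType) (X Y Z : dspace R) (phi : X -> Y) (psi : Y -> Z) v :
  smooth_complete Y -> smooth_complete Z -> smooth_map phi -> smooth_map psi ->
  push psi (push phi v) = push (psi \o phi) v.
Proof.
move=> cY cZ sphi spsi; apply: tvec_ext; first by rewrite !base_push.
move=> f sf; rewrite !der_push //; last exact: spsi.
exact: smooth_map_comp.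
Qed.

Lemma smooth_map_generated (R : realType) (X Y : dspace R) (G : set (Y -> R)) (phi : X -> Y) :
  smooth_complete X -> smooth (d := Y) = smooth_closure G ->
  (forall g, G g -> smooth (g \o phi)) -> smooth_map phi.
Proof.
move=> cX YG H f; rewrite YG => sf; apply: cX => p.
have [k [g [chi [om [Gg Cc Co n E]]]]] := sf (phi p).
exists k, (fun i => g i \o phi), chi, om; split => //.
- by move=> i; apply: H; exact: Gg.
- by move=> x; exact: E.
Qed.

(** * Coordinate vector fields *)

Section ManifoldFrame.
Variables (R : realType) (M : dspace R).
Hypothesis hM : is_manifold M.

Let cM : smooth_complete M := mfd_closed hM.

Lemma smooth_bump f : smooth f -> smooth (fun x : M => bumpf (f x)).
Proof. by move=> sf; apply: smooth_comp1 => //= k; exact: Ck_flat. Qed.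

Section Chart.
Variables (m : M) (n : nat) (V : set M) (phi : 'I_n -> M -> R) (g : M -> R).
Hypothesis chart : is_chart V phi.
Hypothesis sg : smooth g.
Hypothesis gV : forall x, g x != 0 -> V x.
Hypothesis gm : g m != 0.

Let Phi := tuple_map phi.
(** The inverse of the chart, with the junk value [m] off its image. Derivatives of [f \o psi] are
    taken only at points of the open image, where the junk is invisible. *)
Let psi (z : 'rV[R]_n) : M := epsilon_or m (fun x => V x /\ Phi x = z).

Let sphi i : smooth (phi i). Proof. by case: chart. Qed.

Let psiK x : V x -> psi (Phi x) = x.
Proof.
move=> Vx; rewrite /psi /epsilon_or; case: pselect => [h|]; last by case; exists x.
by case: (cid h) => y [Vy E] /=; case: chart => _ _ inj _ _; exact: inj.
Qed.

Let local_rep f p : smooth f -> V p -> exists2 F : 'rV[R]_n -> R, Cinfty F &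
  \forall z \near Phi p, forall x, V x -> Phi x = z -> f x = F z.
Proof. by case: chart => _ _ _ _ H sf Vp; exact: H. Qed.

Let rep_near f (F : 'rV[R]_n -> R) x : V x ->
  (\forall z \near Phi x, forall x, V x -> Phi x = z -> f x = F z) ->
  \forall z \near Phi x, F z = (f \o psi) z.
Proof.
move=> Vx nF; case: chart => _ _ _ oV _.
have nV : nbhs (Phi x) (Phi @` V) by apply: open_nbhs_nbhs; split => //; exists x.
apply: filterS2 nV nF => z [y Vy <-] H.
by rewrite /= psiK // -(H y).
Qed.

(** Normalised so that [h m = 1]. The threshold 1/2 in [gamma] keeps its support away from the zeros
    of [g]: around such a zero [h] stays below 1/2 and [gamma] vanishes, so the coordinate fields
    multiplied by [gamma] extend smoothly by 0. *)
Let h x := (g m) ^- 2 * (g x * g x).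
Let gamma x := bumpf (h x + - 2^-1).

Let sh : smooth h.
Proof. by apply: (smoothZ cM); exact: smoothM. Qed.

Let sgamma : smooth gamma.
Proof. by apply: smooth_bump; apply: (smoothD cM) => //; exact: (smooth_cst cM). Qed.

Let gamma_m : gamma m != 0.
Proof.
apply: bump_gt0; rewrite /h -expr2 mulVf ?expf_neq0 //.
by lra.
Qed.

Let gammaV x : gamma x != 0 -> V x.
Proof.
move=> /bump_neq0 hx; apply: gV; apply/eqP => g0; move: hx.
by rewrite /h g0 mul0r mulr0 add0r oppr_gt0 ltNge invr_ge0 ler0n.
Qed.

Let dX (k : 'I_n) x (f : M -> R) := gamma x * 'D_(delta_mx 0 k) (f \o psi) (Phi x).
Let X (k : 'I_n) x : tangent M := mk_tvec x (dX k x).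

Let derivable_psi f x v : smooth f -> V x -> derivable (f \o psi) (Phi x) v.
Proof.
move=> sf Vx; have [F CF nF] := local_rep sf Vx.
apply: near_eq_derivable (rep_near Vx nF) _.
exact: Ck_derivable (CF 1%N).
Qed.

Let der_X k x f : smooth f -> der (X k x) f = dX k x f.
Proof.
apply: (der_mk_tvec cM) => [c a b sa sb|a b sa sb]; rewrite /dX;
  have [->|/gammaV Vx] := eqVneq (gamma x) 0; rewrite ?mul0r ?mulr0 ?addr0 //.
- have da : derivable (a \o psi) (Phi x) (delta_mx 0 k) := derivable_psi sa Vx.
  have db : derivable (b \o psi) (Phi x) (delta_mx 0 k) := derivable_psi sb Vx.
  have E : 'D_(delta_mx 0 k) ((fun x => c * a x + b x) \o psi) (Phi x) = _ := derive_linE c da db.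
  by rewrite E; ring.
- have da : derivable (a \o psi) (Phi x) (delta_mx 0 k) := derivable_psi sa Vx.
  have db : derivable (b \o psi) (Phi x) (delta_mx 0 k) := derivable_psi sb Vx.
  have E : 'D_(delta_mx 0 k) ((fun x => a x * b x) \o psi) (Phi x) = _ := derive_mulE da db.
  by rewrite E /= psiK //; ring.
Qed.

Let vX k : vfield (X k).
Proof.
apply: (vfieldP cM) => [x|f sf]; first exact: base_mk_tvec.
under [Y in smooth Y]eq_fun do rewrite der_X //.
apply: (smooth_local cM) => p; have [gp|gp] := eqVneq (g p) 0.
  exists (fun x => bumpf (- h x + 2^-1)), (fun=> 0); split.
  - exact: (smooth_bump (smoothD cM (smoothN cM sh) (smooth_cst cM _))).
  - exact: (smooth_cst cM).
  - by apply: bump_gt0; rewrite /h gp mulr0 mulr0 oppr0 add0r invr_gt0 ltr0n.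
  - move=> x /bump_neq0 hx; rewrite /dX /gamma [bumpf _]flat_le0 ?mul0r //.
    by lra.
have Vp := gV gp; have [F CF nF] := local_rep sf Vp.
have [chi [Cchi chip chiO]] := Cinfty_cutoff (nbhs_interior nF).
exists (fun x => g x * chi (Phi x)), (fun x => gamma x * 'D_(delta_mx 0 k) F (Phi x)); split.
- exact: (smoothM cM sg (smooth_comp cM Cchi sphi)).
- exact: (smoothM cM sgamma (smooth_comp cM (Cinfty_derive _ CF) sphi)).
- exact: mulf_neq0.
- move=> x; rewrite mulf_eq0 negb_or => /andP[/gV Vx /chiO nx]; rewrite /dX.
  by rewrite (near_eq_derive _ (rep_near Vx nx)).
Qed.

Let frame_decomp (v : tangent M) f : smooth f ->
  gamma (base v) * der v f = \sum_k der v (phi k) * der (X k (base v)) f.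
Proof.
move=> sf; under eq_bigr do rewrite der_X // /dX mulrCA.
rewrite -mulr_sumr; have [->|/gammaV Vx] := eqVneq (gamma (base v)) 0.
  by rewrite !mul0r.
congr (_ * _); have [F CF nF] := local_rep sf Vx.
have [chi [Cchi chip chiO]] := Cinfty_cutoff nF.
have [w sw [w0 wV]] : exists2 w, smooth w & w (base v) != 0 /\ forall x, w x != 0 -> V x.
  by case: chart => + _ _ _ _; apply.
have sF : smooth (fun x => F (Phi x)) := smooth_comp cM CF sphi.
have swc : smooth (fun x => w x * chi (Phi x)) := smoothM cM sw (smooth_comp cM Cchi sphi).
rewrite (derivation_local (der_derivation v) (g := fun x => w x * chi (Phi x)) (f2 := fun x => F (Phi x))) //.
- rewrite (derivation_comp cM (der_derivation v)) //; apply: eq_bigr => k _.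
  by rewrite (near_eq_derive _ (rep_near Vx nF)).
- exact: mulf_neq0.
- by move=> x; rewrite mulf_eq0 negb_or => /andP[/wV Wx /chiO H]; exact: H.
Qed.

Lemma chart_frame : exists (gamma : M -> R) (X : 'I_n -> M -> tangent M),
  [/\ smooth gamma, gamma m != 0, forall k, vfield (X k) &
      forall v f, smooth f ->
        gamma (base v) * der v f = \sum_k der v (phi k) * der (X k (base v)) f].
Proof. by exists gamma, X; split. Qed.

End Chart.

(* The coordinate fields of a chart at [m], cut off by a bump function [gamma]
   so as to be defined on all of [M]. *)
Lemma manifold_frame (m : M) : exists n (phi : 'I_n -> M -> R) (gamma : M -> R)
    (X : 'I_n -> M -> tangent M),
  [/\ smooth gamma /\ gamma m != 0, forall k, smooth (phi k), forall k, vfield (X k) &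
      forall v f, smooth f ->
        gamma (base v) * der v f = \sum_k der v (phi k) * der (X k (base v)) f].
Proof.
have [n /(_ m) [V [phi [Vm ch]]]] := mfd_charts hM.
have [g sg [gm gV]] : exists2 g, smooth g & g m != 0 /\ forall x, g x != 0 -> V x.
  by case: ch => + _ _ _ _; apply.
have [gamma [X [sga gam vX D]]] := chart_frame ch sg gV gm.
by exists n, phi, gamma, X; split => //; case: ch.
Qed.

End ManifoldFrame.

(** * Sections of vector bundles *)

Section BundleTheory.
Variables (R : realType) (M E : dspace R) (B : vbundle M E).
Hypothesis cM : smooth_complete M.
Hypothesis hB : is_vbundle B.

Lemma total_complete : smooth_complete E.
Proof. exact: generated_complete (vb_smooth hB). Qed.
Let cE := total_complete.

Lemma smooth_map_proj : smooth_map (proj B).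
Proof. by move=> f sf; rewrite (vb_smooth hB); apply: sub_smooth_closure; left; exists f. Qed.

Lemma is_sectionP (s : M -> E) : (forall m, proj B (s m) = m) ->
  (forall xi, smooth xi -> fibre_linear B xi -> smooth (xi \o s)) -> is_section B s.
Proof.
move=> ps H; split => //; apply: (smooth_map_generated cM (vb_smooth hB)) => g [[f sf <-]|[sg lg]].
  by have -> // : (f \o proj B) \o s = f; apply/funext => x /=; rewrite ps.
exact: H.
Qed.

Definition fibre (m : M) : set E := [set x | proj B x = m].

Record subspace_at (m : M) (K : set E) : Prop := SubspaceAt {
  sub_fibre : forall x, K x -> proj B x = m;
  sub_zero : K (vzero B m);
  sub_lin : forall c x y, K x -> K y -> K (vadd B (vscale B c x) y) }.

Definition lin_on (K : set E) (zeta : E -> R) : Prop :=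
  forall c x y, K x -> K y -> zeta (vadd B (vscale B c x) y) = c * zeta x + zeta y.

Lemma vaddr0 m x : proj B x = m -> vadd B x (vzero B m) = x.
Proof. by move=> <-; rewrite (vb_addC hB) ?(vb_zero hB) // (vb_add0 hB). Qed.

Lemma vadd0r m x : proj B x = m -> vadd B (vzero B m) x = x.
Proof. by move=> <-; rewrite (vb_add0 hB). Qed.

Lemma vscale0 x : vscale B 0 x = vzero B (proj B x).
Proof.
by rewrite -(vb_addN hB x) -(addNr (1 : R)) (vb_scaleDl hB) (vb_scale1 hB).
Qed.

Lemma vscaler0 c m : vscale B c (vzero B m) = vzero B m.
Proof.
have <- : vscale B 0 (vzero B m) = vzero B m by rewrite vscale0 (vb_zero hB).
by rewrite (vb_scaleA hB) mulr0.
Qed.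

Lemma fibre_subspace m : subspace_at m (fibre m).
Proof.
split => [x //||c x y]; first exact: (vb_zero hB).
by rewrite /fibre /= => px py; rewrite (vb_add hB) (vb_scale hB) // py.
Qed.

Lemma fibre_linear_on m xi : fibre_linear B xi -> lin_on (fibre m) xi.
Proof. by move=> l c x y px py; apply: l; rewrite px py. Qed.

Section Subspace.
Variables (m : M) (K : set E).
Hypothesis hK : subspace_at m K.

Lemma sub_scale c x : K x -> K (vscale B c x).
Proof.
move=> Kx; rewrite -(@vaddr0 m (vscale B c x)) ?(vb_scale hB) ?(sub_fibre hK) //.
by apply: (sub_lin hK) => //; exact: sub_zero hK.
Qed.

Lemma sub_add x y : K x -> K y -> K (vadd B x y).
Proof. by move=> Kx Ky; rewrite -(vb_scale1 hB x); exact: (sub_lin hK). Qed.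

Lemma lin_on0 zeta : lin_on K zeta -> zeta (vzero B m) = 0.
Proof.
move=> l; have K0 := sub_zero hK; have := l (-1) _ _ K0 K0.
by rewrite (vb_addN hB) (vb_zero hB) mulN1r addNr.
Qed.

Lemma lin_onZ zeta c x : lin_on K zeta -> K x -> zeta (vscale B c x) = c * zeta x.
Proof.
move=> l Kx; rewrite -(@vaddr0 m (vscale B c x)) ?(vb_scale hB) ?(sub_fibre hK) //.
by rewrite l ?lin_on0 ?addr0 //; exact: sub_zero hK.
Qed.

Lemma lin_onD zeta x y : lin_on K zeta -> K x -> K y -> zeta (vadd B x y) = zeta x + zeta y.
Proof. by move=> l Kx Ky; rewrite -[in LHS](vb_scale1 hB x) l // mul1r. Qed.

Lemma sub_lincomb r (c : 'rV[R]_r) (e : 'I_r -> E) :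
  (forall i, K (e i)) -> K (lincomb B m c e).
Proof.
move=> Ke; rewrite /lincomb; elim/big_ind: _ => [|x y|i _]; first exact: sub_zero hK.
  exact: sub_add.
exact: sub_scale.
Qed.

Lemma lin_on_lincomb zeta r (c : 'rV[R]_r) (e : 'I_r -> E) : lin_on K zeta ->
  (forall i, K (e i)) -> zeta (lincomb B m c e) = \sum_i c 0 i * zeta (e i).
Proof.
move=> l Ke; rewrite /lincomb.
suff : K (\big[vadd B/vzero B m]_(i < r) vscale B (c 0 i) (e i)) /\
  zeta (\big[vadd B/vzero B m]_(i < r) vscale B (c 0 i) (e i)) = \sum_i c 0 i * zeta (e i) by case.
elim/big_ind2: _ => [|x1 x2 y1 y2 [K1 <-] [K2 <-]|i _].
- by split; [exact: sub_zero hK|exact: lin_on0].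
- by split; [exact: sub_add|exact: lin_onD].
- by split; [exact: sub_scale|exact: lin_onZ].
Qed.

End Subspace.

Lemma proj_lincomb m r (c : 'rV[R]_r) (e : 'I_r -> E) :
  (forall i, proj B (e i) = m) -> proj B (lincomb B m c e) = m.
Proof. by move=> pe; exact: (sub_lincomb (fibre_subspace m)). Qed.

Lemma section_proj s m : is_section B s -> proj B (s m) = m.
Proof. by case. Qed.

Lemma section_zero : is_section B (vzero B).
Proof.
apply: is_sectionP => [m|xi _ lxi]; first exact: (vb_zero hB).
have -> : xi \o vzero B = fun=> 0.
  by apply/funext => m /=; apply: (lin_on0 (fibre_subspace m)); exact: fibre_linear_on.
exact: smooth_cst.
Qed.

Lemma section_lincomb r (f : 'I_r -> M -> R) (s : 'I_r -> M -> E) :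
  (forall i, smooth (f i)) -> (forall i, is_section B (s i)) ->
  is_section B (fun m => lincomb B m (\row_i f i m) (fun i => s i m)).
Proof.
move=> sf ss; apply: is_sectionP => [m|xi sxi lxi].
  by apply: proj_lincomb => i; case: (ss i).
have -> : xi \o (fun m => lincomb B m (\row_i f i m) (fun i => s i m)) =
    fun m => \sum_i f i m * xi (s i m).
  apply/funext => m /=; rewrite (lin_on_lincomb (fibre_subspace m)).
  - by apply: eq_bigr => i _; rewrite mxE.
  - exact: fibre_linear_on.
  - by move=> i; exact: (section_proj m (ss i)).
apply: (smooth_sum cM) => i; apply: (smoothM cM) => //.
by case: (ss i) => + _; exact.
Qed.

Lemma section_scale f s : smooth f -> is_section B s -> is_section B (fun m => vscale B (f m) (s m)).
Proof.
move=> sf ss; apply: is_sectionP => [m|xi sxi lxi].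
  by rewrite (vb_scale hB); case: ss.
have -> : xi \o (fun m => vscale B (f m) (s m)) = fun m => f m * xi (s m).
  apply/funext => m /=; apply: (lin_onZ (fibre_subspace m)); first exact: fibre_linear_on.
  exact: (section_proj m ss).
by apply: (smoothM cM) => //; case: ss => + _; exact.
Qed.

Lemma section_lin f s t : smooth f -> is_section B s -> is_section B t ->
  is_section B (fun m => vadd B (vscale B (f m) (s m)) (t m)).
Proof.
move=> sf ss st; apply: is_sectionP => [m|xi sxi lxi].
  by apply: (sub_lin (fibre_subspace m)); rewrite /fibre /= section_proj.
have -> : xi \o (fun m => vadd B (vscale B (f m) (s m)) (t m)) = fun m => f m * xi (s m) + xi (t m).
  by apply/funext => m /=; rewrite lxi // !section_proj.
apply: (smoothD cM); last by case: st => + _; exact.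
by apply: (smoothM cM) => //; case: ss => + _; exact.
Qed.

Lemma local_frame (m : M) : exists (g : M -> R) r (e : 'I_r -> M -> E) (xi : 'I_r -> E -> R),
  [/\ smooth g /\ g m != 0, forall i, is_section B (e i),
      forall i, smooth (xi i) /\ fibre_linear B (xi i) &
      forall x, g (proj B x) != 0 ->
        x = lincomb B (proj B x) (\row_i xi i x) (fun i => e i (proj B x))].
Proof.
have [V [r [e [xi [[oV Vm] se lxi _ H]]]]] := vb_frame hB m.
have [g sg [gm gV]] := oV m Vm.
by exists g, r, e, xi; split => // x /gV; exact: H.
Qed.

(** A local frame already consists of global sections, so it is enough to freeze the coordinates of
    [x]. *)
Lemma extend_section (x : E) : exists2 s, is_section B s & s (proj B x) = x.
Proof.
have [g [r [e [xi [[sg gm] se lxi H]]]]] := local_frame (proj B x).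
exists (fun m => lincomb B m (\row_i (fun=> xi i x) m) (fun i => e i m)); last by rewrite -H.
by apply: section_lincomb => // i; exact: smooth_cst.
Qed.

Section Subbundle.
Variable U : set E.
Hypothesis hU : is_subbundle B setT U.

Definition Ufib m : set E := [set x | U x /\ proj B x = m].

Lemma Ufib_subspace m : subspace_at m (Ufib m).
Proof.
split => [x []//||c x y [Ux px] [Uy py]].
  by split; [exact: (sb_zero hU)|exact: (vb_zero hB)].
split; last by apply: (sub_lin (fibre_subspace m)).
by apply: (sb_add hU) => //; [exact: (sb_scale hU)|rewrite (vb_scale hB) px py].
Qed.

Lemma local_frame_in (m : M) : exists (g : M -> R) r (s : 'I_r -> M -> E),
  [/\ smooth g /\ g m != 0, forall i, is_section B (s i),
      forall p i, g p != 0 -> U (s i p) &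
      forall x, U x -> g (proj B x) != 0 ->
        exists! c : 'rV[R]_r, x = lincomb B (proj B x) c (fun i => s i (proj B x))].
Proof.
have [V [r [s [[oV Vm] ss Us H]]]] := sb_frame hU (I : setT m).
have [g sg [gm gV]] := oV m Vm.
exists g, r, s; split => // [p i /gV Vp|x Ux /gV Vx]; first exact: Us.
exact: H.
Qed.

Lemma section_in_cutoff g s : smooth g -> is_section B s -> (forall p, g p != 0 -> U (s p)) ->
  section_in B U (fun m => vscale B (g m) (s m)).
Proof.
move=> sg ss Us; split; first exact: section_scale.
move=> m; have [->|/Us gm] := eqVneq (g m) 0; last exact: (sb_scale hU).
by rewrite vscale0; apply: (sb_zero hU).
Qed.

(** As for [extend_section], but the frame lies in [U] only where [g] does not vanish; the factor
    [g], normalised to 1 at the point, brings the section into [U] everywhere. *)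
Lemma extend_section_in (x : E) : U x -> exists2 s, section_in B U s & s (proj B x) = x.
Proof.
move=> Ux; set m := proj B x; have [g [r [s [[sg gm] ss Us H]]]] := local_frame_in m.
have [c [xE _]] := H x Ux gm.
pose t p := lincomb B p (\row_i (fun=> c 0 i) p) (fun i => s i p).
have st : is_section B t by apply: section_lincomb => // i; exact: smooth_cst.
exists (fun p => vscale B ((g m)^-1 * g p) (t p)).
  apply: section_in_cutoff => // [|p].
    exact: (smoothZ cM).
  rewrite mulf_eq0 negb_or => /andP[_ gp].
  have tU : Ufib p (t p).
    apply: (sub_lincomb (Ufib_subspace p)) => i; split; first exact: Us.
    by case: (ss i).
  by case: tU.
rewrite mulVf // (vb_scale1 hB) [RHS]xE /t; congr lincomb.
by apply/rowP => i; rewrite mxE.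
Qed.

End Subbundle.
End BundleTheory.

(** * Linear algebra of the pairing *)

Section PairingTheory.
Variables (R : realType) (M E : dspace R) (B : vbundle M E) (C : courant B).
Hypothesis cM : smooth_complete M.
Hypothesis hC : is_courant C.

Let hB : is_vbundle B := ca_bundle hC.
Let cE := total_complete hB.
Local Notation "<| x , y |>" := (pairing C x y).

Lemma pairing_linl m z : proj B z = m -> lin_on B (fibre B m) (fun x => <|x, z|>).
Proof. by move=> pz c x y px py; apply: (ca_pair_lin hC); rewrite ?px ?py ?pz. Qed.

Lemma pairing_linr m z : proj B z = m -> lin_on B (fibre B m) (fun x => <|z, x|>).
Proof.
move=> pz c x y px py; have sym a : proj B a = m -> <|z, a|> = <|a, z|>.
  by move=> pa; apply: (ca_pair_sym hC); rewrite pa.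
rewrite !sym //; first exact: (pairing_linl pz).
exact: (sub_lin (fibre_subspace hB m)).
Qed.

Lemma lin_on_sub K K' (zeta : E -> R) : K' `<=` K -> lin_on B K zeta -> lin_on B K' zeta.
Proof. by move=> KK' l c x y /KK' Kx /KK' Ky; exact: l. Qed.

Lemma Ufib_fibre U m : Ufib B U m `<=` fibre B m.
Proof. by move=> x []. Qed.

Lemma smooth_pairing s t : is_section B s -> is_section B t -> smooth (fun m => <|s m, t m|>).
Proof. exact: (ca_pair_smooth hC). Qed.

Definition pair_with (w : M -> E) (x : E) : R := <|x, w (proj B x)|>.

Lemma fibre_linear_pair_with w : is_section B w -> fibre_linear B (pair_with w).
Proof.
move=> sw c x y pxy; rewrite /pair_with.
have -> : proj B (vadd B (vscale B c x) y) = proj B y.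
  by apply: (sub_lin (fibre_subspace hB (proj B y))).
rewrite pxy; apply: (pairing_linl (m := proj B y)) => //.
exact: section_proj.
Qed.

Lemma smooth_pair_with w : is_section B w -> smooth (pair_with w).
Proof.
move=> sw; apply: (smooth_local cE) => p.
have [g [r [e [xi [[sg gm] se lxi H]]]]] := local_frame hB (proj B p).
exists (g \o proj B), (fun x => \sum_i xi i x * <|e i (proj B x), w (proj B x)|>); split => //.
- exact: (smooth_map_proj hB).
- apply: (smooth_sum cE) => i; apply: (smoothM cE); first by case: (lxi i).
  exact: (smooth_map_proj hB (smooth_pairing (se i) sw)).
- move=> x /= gx; rewrite /pair_with {1}(H x gx).
  rewrite (lin_on_lincomb hB (fibre_subspace hB (proj B x)) _ (pairing_linl (section_proj _ sw))).
    by apply: eq_bigr => i _; rewrite mxE.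
  by move=> i; exact: section_proj.
Qed.

(** * Dual frames, functionals on a subbundle and its orthogonal *)

Section Dual.
Variable U : set E.
Hypothesis hU : is_subbundle B setT U.

(* With [Q x i j = <s_i, e_j>] of full row rank at [m] and [Z] a right inverse
   of [Q m], the matrix [Q x *m Z] is invertible near [m] and its adjugate gives
   global sections [a_i] dual to the [s_i] up to the factor [det (Q x *m Z)]. *)
Lemma dual_frame (m : M) : exists (g delta : M -> R) r (s a : 'I_r -> M -> E),
  [/\ [/\ smooth g, g m != 0, smooth delta & delta m != 0],
      forall i, is_section B (s i) /\ is_section B (a i),
      forall p i, g p != 0 -> U (s i p),
      forall x, U x -> g (proj B x) != 0 ->
        exists c : 'rV[R]_r, x = lincomb B (proj B x) c (fun i => s i (proj B x)) &
      forall p i j, <|a i p, s j p|> = delta p * (i == j)%:R].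
Proof.
have [g [r [s [[sg gm] ss Us H]]]] := local_frame_in hU m.
have [g' [n [e [xi [[sg' gm'] se lxi He]]]]] := local_frame hB m.
pose Q p : 'M[R]_(r, n) := \matrix_(i, j) <|s i p, e j p|>.
have fs i p : fibre B p (s i p) by exact: section_proj.
have fe i p : fibre B p (e i p) by exact: section_proj.
(* A combination of the [s i m] orthogonal to all [e j m] is zero because the pairing is
   nondegenerate; its coefficients are then zero by uniqueness of coordinates in [U]. *)
have rfQ : row_free (Q m).
  apply: inj_row_free => c cQ.
  pose x := lincomb B m c (fun i => s i m).
  have px : proj B x = m by apply: (proj_lincomb hB) => i; exact: fs.
  have x0 : x = vzero B m.
    rewrite -px; apply: (ca_pair_nondeg hC) => y; rewrite px => py.
    rewrite (He y) py //.
    rewrite (lin_on_lincomb hB (fibre_subspace hB m) _ (pairing_linr px)) //.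
    apply: big1 => j _.
    have -> : <|x, e j m|> = (c *m Q m) 0 j.
      rewrite (lin_on_lincomb hB (fibre_subspace hB m) _ (pairing_linl (fe j m))) //.
      by rewrite mxE; apply: eq_bigr => i _; rewrite mxE.
    by rewrite cQ !mxE mulr0.
  have [|c0 [c0E c0U]] := H (vzero B m) (sb_zero hU (I : setT m)); first by rewrite (vb_zero hB).
  rewrite (vb_zero hB) in c0E c0U.
  have E1 := c0U c (esym x0).
  rewrite -E1; apply: c0U; apply: esym.
  have Z i : vscale B ((0 : 'rV[R]_r) 0 i) (s i m) = vzero B m.
    by rewrite mxE (vscale0 hB) (fs i m).
  rewrite /lincomb (eq_bigr (fun=> vzero B m)) => [|i _]; last exact: Z.
  elim/big_ind: _ => // x1 x2 -> ->.
  by rewrite (vaddr0 hB) // (vb_zero hB).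
have /row_freeP [Z QZ] := rfQ.
pose W p := Q p *m Z.
pose coef i (j : 'I_n) p : R := \sum_k Z j k * (\adj (W p)) k i.
pose a i p := lincomb B p (\row_j coef i j p) (fun j => e j p).
have sQ i j : smooth (fun p => Q p i j).
  by under [X in smooth X]eq_fun do rewrite mxE; exact: smooth_pairing.
have sW i j : smooth (fun p => W p i j).
  under [X in smooth X]eq_fun do rewrite mxE.
  by apply: (smooth_sum cM) => k; apply: (smoothM cM) => //; exact: (smooth_cst cM).
have sdet q (A : M -> 'M[R]_q) : (forall i j, smooth (fun p => A p i j)) -> smooth (fun p => \det (A p)).
  move=> sA; rewrite /determinant; apply: (smooth_sum cM) => tau.
  by apply: (smoothM cM); [exact: (smooth_cst cM)|exact: (smooth_prod cM)].
have sadj i j : smooth (fun p => (\adj (W p)) i j).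
  under [X in smooth X]eq_fun do rewrite mxE /cofactor.
  apply: (smoothM cM); first exact: (smooth_cst cM).
  apply: sdet => k l; under [X in smooth X]eq_fun do rewrite mxE mxE.
  exact: sW.
have sa i : is_section B (a i).
  apply: (section_lincomb cM hB) => // j; apply: (smooth_sum cM) => k.
  by apply: (smoothM cM) => //; exact: (smooth_cst cM).
exists g, (fun p => \det (W p)), r, s, a; split => //.
- split => //; first exact: sdet.
  by rewrite /W QZ det1 oner_neq0.
- by move=> x Ux gx; have [c [cE' _]] := H x Ux gx; exists c.
- move=> p i j; rewrite /a.
  rewrite (lin_on_lincomb hB (fibre_subspace hB p) _ (pairing_linl (fs j p))) //.
  have -> : \sum_k (\row_j0 coef i j0 p) 0 k * <|e k p, s j p|> = (W p *m \adj (W p)) j i.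
    rewrite /W -mulmxA mxE; apply: eq_bigr => k _.
    rewrite mxE /coef mulrC; congr (_ * _); first by rewrite mxE (ca_pair_sym hC) // fe fs.
    by rewrite [RHS]mxE.
  by rewrite mul_mx_adj mxE eq_sym mulr_natr.
Qed.

Lemma dual_frame_pair p r (s a : 'I_r -> M -> E) (delta : M -> R) (f : 'I_r -> M -> R) j :
  (forall i, is_section B (s i) /\ is_section B (a i)) ->
  (forall p i j, <|a i p, s j p|> = delta p * (i == j)%:R) ->
  <|lincomb B p (\row_i f i p) (fun i => a i p), s j p|> = delta p * f j p.
Proof.
move=> sa D; rewrite (lin_on_lincomb hB (fibre_subspace hB p) _ (pairing_linl _)).
- rewrite (bigD1 j) //= big1 => [|i ij]; rewrite mxE D; first by rewrite eqxx mulr1 addr0 mulrC.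
  by rewrite (negPf ij) !mulr0.
- by case: (sa j) => + _ => h; exact: section_proj.
- by move=> i; case: (sa i) => _ h; exact: section_proj.
Qed.

Lemma eq_on_frame p r (s : 'I_r -> M -> E) (z1 z2 : E -> R) x :
  (forall i, is_section B (s i)) -> (forall i, U (s i p)) ->
  lin_on B (Ufib B U p) z1 -> lin_on B (Ufib B U p) z2 ->
  (exists c : 'rV[R]_r, x = lincomb B p c (fun i => s i p)) ->
  (forall i, z1 (s i p) = z2 (s i p)) -> z1 x = z2 x.
Proof.
move=> ss Us l1 l2 [c ->] Es.
have fs i : Ufib B U p (s i p) by split; [exact: Us|exact: section_proj].
have hK := Ufib_subspace hB hU p.
rewrite (lin_on_lincomb hB hK _ l1 fs) (lin_on_lincomb hB hK _ l2 fs).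
by apply: eq_bigr => i _; rewrite Es.
Qed.

Lemma represent_at (m : M) (zeta : E -> R) : lin_on B (Ufib B U m) zeta ->
  exists2 a, proj B a = m & forall y, U y -> proj B y = m -> zeta y = <|a, y|>.
Proof.
move=> lz; have [g [delta [r [s [a [[sg gm sd dm] sa Us gen D]]]]]] := dual_frame m.
have ss i : is_section B (s i) by case: (sa i).
have sas i : is_section B (a i) by case: (sa i).
pose b := lincomb B m (\row_i (fun i p => (delta m)^-1 * zeta (s i m)) i m) (fun i => a i m).
have pb : proj B b = m by apply: (proj_lincomb hB) => i; exact: section_proj.
exists b => // y Uy py; apply: (@eq_on_frame m r s zeta (fun y => <|b, y|>)) => //.
- by move=> i; exact: Us.
- exact: (lin_on_sub (@Ufib_fibre U m) (pairing_linr pb)).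
- by have := gen y Uy; rewrite py; exact.
- move=> i; rewrite /b.
  by rewrite (@dual_frame_pair m r s a delta (fun i p => (delta m)^-1 * zeta (s i m)) i sa D) mulVKf.
Qed.

(* [eta] clears the denominators of the dual frame; it depends on [m] only, not on [Z]. *)
Lemma represent_functional (m : M) : exists eta : M -> R,
  [/\ smooth eta, eta m != 0 & forall Z : E -> R,
    (forall p, lin_on B (Ufib B U p) Z) ->
    (forall s, section_in B U s -> smooth (Z \o s)) ->
    exists2 sigma, is_section B sigma &
      forall y, U y -> <|sigma (proj B y), y|> = eta (proj B y) * Z y].
Proof.
have [g [delta [r [s [a [[sg gm sd dm] sa Us gen D]]]]]] := dual_frame m.
exists (fun p => g p ^+ 2 * delta p); split.
- apply: (smoothM cM) => //; under [X in smooth X]eq_fun do rewrite expr2.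
  exact: (smoothM cM).
- by rewrite mulf_neq0 // expf_neq0.
move=> Z lZ sZ; have ss i : is_section B (s i) by case: (sa i).
have sas i : is_section B (a i) by case: (sa i).
(* [s i] lies in [U] only where [g] is nonzero, so [Z] is applied to [g * s i]. With the outer
   factor this accounts for the square of [g] in [eta]. *)
pose f i p := g p * Z (vscale B (g p) (s i p)).
have sf i : smooth (f i).
  apply: (smoothM cM) => //; apply: (sZ (fun p => vscale B (g p) (s i p))).
  by apply: (section_in_cutoff cM hB hU) => // p; exact: Us.
exists (fun p => lincomb B p (\row_i f i p) (fun i => a i p)).
  exact: (section_lincomb cM hB).
move=> y Uy; set p := proj B y; have Ky : Ufib B U p y by [].
have [gp|gp] := eqVneq (g p) 0.
  rewrite gp expr0n /= !mul0r.
  rewrite (lin_on_lincomb hB (fibre_subspace hB p) _ (pairing_linl _)) //.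
    by apply: big1 => i _; rewrite mxE /f gp !mul0r.
  by move=> i; exact: section_proj.
have pl : proj B (lincomb B p (\row_i f i p) (fun i => a i p)) = p.
  by apply: (proj_lincomb hB) => i; exact: section_proj.
apply: (@eq_on_frame p r s (fun y => <|lincomb B p (\row_i f i p) (fun i => a i p), y|>)
   (fun y => g p ^+ 2 * delta p * Z y)) => //.
- by move=> i; exact: Us.
- exact: (lin_on_sub (@Ufib_fibre U p) (pairing_linr pl)).
- by move=> c x1 x2 k1 k2; rewrite (lZ p) //; ring.
- exact: gen.
- move=> i; rewrite (dual_frame_pair _ _ _ sa D) /f.
  rewrite (lin_onZ hB (Ufib_subspace hB hU p) _ (lZ p)); first by ring.
  by split; [exact: Us|exact: section_proj].
Qed.

(** Any extension [e] of [y] is corrected by its components along the dual frame: [t] is [delta e]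
    minus the sum of the [<e, s i> a i], which is orthogonal to the [s i]. The correction vanishes
    at the given point, where [e] is [y]. *)
Lemma extend_orth (y : E) : orth C U y ->
  exists2 tau, section_in B (orth C U) tau & tau (proj B y) = y.
Proof.
move=> Oy; set m := proj B y.
have [g [delta [r [s [a [[sg gm sd dm] sa Us gen D]]]]]] := dual_frame m.
have ss i : is_section B (s i) by case: (sa i).
have sas i : is_section B (a i) by case: (sa i).
have [e se em] := extend_section cM hB y.
pose f i p := - <|e p, s i p|>.
have sf i : smooth (f i) by apply: (smoothN cM); exact: smooth_pairing.
pose t p := vadd B (vscale B (delta p) (e p)) (lincomb B p (\row_i f i p) (fun i => a i p)).
have st : is_section B t by apply: (section_lin cM hB) => //; exact: (section_lincomb cM hB).
have pt p : proj B (t p) = p by exact: section_proj.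
have pl p : proj B (lincomb B p (\row_i f i p) (fun i => a i p)) = p.
  by apply: (proj_lincomb hB) => i; exact: section_proj.
exists (fun p => vscale B ((delta m * g m)^-1 * g p) (t p)).
  split; first by apply: (section_scale cM hB) => //; exact: (smoothZ cM).
  move=> p w Uw; rewrite (vb_scale hB) pt => pw.
  rewrite (lin_onZ hB (fibre_subspace hB p) _ (pairing_linl pw)); last exact: pt.
  have [->|gp] := eqVneq (g p) 0; first by rewrite mulr0 mul0r.
  suff -> : <|t p, w|> = 0 by rewrite mulr0.
  apply: (@eq_on_frame p r s (fun y => <|t p, y|>) (fun=> 0)) => //.
  - by move=> i; exact: Us.
  - exact: (lin_on_sub (@Ufib_fibre U p) (pairing_linr (pt p))).
  - by move=> c x1 x2 _ _; rewrite mulr0 addr0.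
  - by have := gen w Uw; rewrite pw; exact.
  - move=> i; rewrite /t (pairing_linl (section_proj p (ss i))) //; last exact: section_proj.
    by rewrite (dual_frame_pair _ _ _ sa D) /f mulrN subrr.
have -> : t m = vscale B (delta m) y.
  rewrite /t em -/m; have -> : lincomb B m (\row_i f i m) (fun i => a i m) = vzero B m.
    rewrite /lincomb (eq_bigr (fun=> vzero B m)) => [|i _].
      by elim/big_ind: _ => // x1 x2 -> ->; rewrite (vaddr0 hB) // (vb_zero hB).
    rewrite mxE /f em -/m Oy ?oppr0 ?(vscale0 hB) ?section_proj //.
    exact: Us.
  by apply: (vaddr0 hB); rewrite (vb_scale hB).
rewrite (vb_scaleA hB); have -> : (delta m * g m)^-1 * g m * delta m = 1.
  by field; rewrite dm gm.
exact: (vb_scale1 hB).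
Qed.

(** The candidate [x'] in [U] has the coordinates of [x] read off by the dual frame. To compare [x]
    and [x'] against an arbitrary [e], the dual-frame part of [e] is split off; the remainder [y] is
    orthogonal to [U], hence to both. *)
Lemma orth_orth (x : E) : (forall y, orth C U y -> proj B y = proj B x -> <|x, y|> = 0) -> U x.
Proof.
move=> xO; set m := proj B x.
have [g [delta [r [s [a [[sg gm sd dm] sa Us gen D]]]]]] := dual_frame m.
have ss i : is_section B (s i) by case: (sa i).
have sas i : is_section B (a i) by case: (sa i).
have fx : fibre B m x by [].
have fs i : fibre B m (s i m) by exact: section_proj.
have fa i : fibre B m (a i m) by exact: section_proj.
have hK := fibre_subspace hB m.
pose x' := lincomb B m (\row_i ((delta m)^-1 * <|x, a i m|>)) (fun i => s i m).
have Ux' : Ufib B U m x'.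
  by apply: (sub_lincomb hB (Ufib_subspace hB hU m)) => i; split; [exact: Us|exact: fs].
suff -> : x = x' by case: Ux'.
suff : vadd B (vscale B (-1) x') x = vzero B m.
  move=> E1; have := congr1 (vadd B x') E1.
  have fx' : fibre B m x' by case: Ux'.
  have e1 : vadd B x' (vscale B (-1) x') = vzero B m.
    by rewrite (vb_addC hB) ?(vb_scale hB) // (vb_addN hB) fx'.
  rewrite (vb_addA hB) ?(vb_scale hB) ?fx' // e1.
  by rewrite (vadd0r hB fx) (vaddr0 hB fx').
have fd : fibre B m (vadd B (vscale B (-1) x') x) by apply: (sub_lin hK) => //; case: Ux'.
have fx' : fibre B m x' by case: Ux'.
rewrite -fd; apply: (ca_pair_nondeg hC) => e; rewrite fd => fe.
rewrite (pairing_linl fe) //.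
pose y := vadd B (vscale B (-1) (lincomb B m (\row_i (fun p => (delta m)^-1 * <|e, s i m|>) m) (fun i => a i m))) e.
have fl : fibre B m (lincomb B m (\row_i (fun p => (delta m)^-1 * <|e, s i m|>) m) (fun i => a i m)).
  exact: (sub_lincomb hB hK).
have fy : fibre B m y by exact: (sub_lin hK).
have Oy : orth C U y.
  move=> w Uw; rewrite fy => pw.
  apply: (@eq_on_frame m r s (fun w => <|y, w|>) (fun=> 0)) => //.
  - by move=> i; exact: Us.
  - exact: (lin_on_sub (@Ufib_fibre U m) (pairing_linr fy)).
  - by move=> c x1 x2 _ _; rewrite mulr0 addr0.
  - by have := gen w Uw; rewrite pw; exact.
  - move=> i; rewrite (pairing_linl (fs i)) //.
    rewrite (@dual_frame_pair m r s a delta (fun i p => (delta m)^-1 * <|e, s i m|>) i sa D).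
    by rewrite mulVKf // mulN1r addNr.
have := xO y Oy fy; rewrite (pairing_linr fx) // => H.
rewrite -H; congr (_ * _ + _).
rewrite (lin_on_lincomb hB hK _ (pairing_linl fe)) // (lin_on_lincomb hB hK _ (pairing_linr fx)) //.
apply: eq_bigr => i _; rewrite !mxE (ca_pair_sym hC (x := s i m)) ?fs ?fe //.
by ring.
Qed.

End Dual.
End PairingTheory.

(** * The prolongation TE -> TM *)

Section TangentBundle.
Variables (R : realType) (X : dspace R).
Hypothesis cX : smooth_complete X.

Lemma base_tadd (v w : tangent X) : base (vadd (tbundle X) v w) = base v.
Proof. exact: base_mk_tvec. Qed.

Lemma base_tscale c (v : tangent X) : base (vscale (tbundle X) c v) = base v.
Proof. exact: base_mk_tvec. Qed.

Lemma base_tzero (p : X) : base (vzero (tbundle X) p) = p.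
Proof. exact: base_mk_tvec. Qed.

Lemma der_tadd (v w : tangent X) f : base v = base w -> smooth f ->
  der (vadd (tbundle X) v w) f = der v f + der w f.
Proof.
move=> vw sf; apply: (der_mk_tvec cX (d := fun f => der v f + der w f)) => // [c a b sa sb|a b sa sb].
- by rewrite !(derivation_lin (der_derivation _)) //; ring.
- by rewrite !(derivationM (der_derivation _)) // vw; ring.
Qed.

Lemma der_tscale c (v : tangent X) f : smooth f ->
  der (vscale (tbundle X) c v) f = c * der v f.
Proof.
move=> sf; apply: (der_mk_tvec cX (d := fun f => c * der v f)) => // [k a b sa sb|a b sa sb].
- by rewrite !(derivation_lin (der_derivation _)) //; ring.
- by rewrite !(derivationM (der_derivation _)) //; ring.
Qed.

Lemma der_tzero (p : X) f : smooth f -> der (vzero (tbundle X) p) f = 0.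
Proof.
move=> sf; apply: (der_mk_tvec cX (d := fun=> 0)) => // [k a b sa sb|a b sa sb].
- by rewrite mulr0 addr0.
- by rewrite !mulr0 addr0.
Qed.

Lemma der_tlincomb p r (c : 'rV[R]_r) (v : 'I_r -> tangent X) f :
  (forall i, base (v i) = p) -> smooth f ->
  base (lincomb (tbundle X) p c v) = p /\
  der (lincomb (tbundle X) p c v) f = \sum_i c 0 i * der (v i) f.
Proof.
move=> bv sf; rewrite /lincomb; elim/big_ind2: _ => [|x1 x2 y1 y2 [b1 <-] [b2 <-]|i _].
- by rewrite base_tzero der_tzero.
- by rewrite base_tadd der_tadd // b1 b2.
- by rewrite base_tscale der_tscale // bv.
Qed.

(** The curve is affine in [t] on the generators, so a smooth function along it is, near 0, a smooth
    function along a straight line in the space of generator values. Hence it is derivable at 0, and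
    the velocity is a genuine derivation. *)
Lemma der_curve (G : set (X -> R)) (p : X) (c : R -> X) f :
  smooth (d := X) = smooth_closure G -> c 0 = p ->
  (forall g, G g -> exists k, forall t, g (c t) = g p + t * k) ->
  smooth f -> der (mk_tvec p (fun f => derive1 (fun t => f (c t)) 0)) f = derive1 (fun t => f (c t)) 0.
Proof.
move=> XG c0 aff; have dc h : smooth h -> derivable (fun t => h (c t)) 0 1.
  rewrite XG => /(_ p)[k [g [chi [om [Gg Cc Co n H]]]]].
  have /choice[K KE] : forall i, exists k, forall t, g i (c t) = g i p + t * k.
    by move=> i; exact: aff.
  have tE t : tuple_map g (c t) = t *: (\row_i K i) + tuple_map g p.
    by apply/rowP => i; rewrite !mxE KE addrC.
  have nE : \forall t \near (0 : R), om (t *: (\row_i K i) + tuple_map g p) = h (c t).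
    have cl : continuous (fun t : R => chi (t *: (\row_i K i) + tuple_map g p)).
      have cr : continuous (fun t : R => t *: (\row_i K i) + tuple_map g p).
        by move=> t; apply: cvgD; [exact: scalel_continuous|exact: cvg_cst].
      move=> t; apply: (@continuous_comp _ _ _ (fun t : R => t *: (\row_i K i) + tuple_map g p) chi).
        exact: cr.
      exact: (Ck_continuous (Cc 0%N)).
    have : \forall t \near (0 : R), chi (t *: (\row_i K i) + tuple_map g p) != 0.
      apply: (cl 0 [set y | y != 0]); rewrite scale0r add0r.
      exact: (open_nbhs_nbhs (conj (@open_neq R 0) n)).
    by apply: filterS => t; rewrite -tE => /H ->; rewrite tE.
  apply: near_eq_derivable nE _.
  exact: (@ex_derive _ _ _ _ _ _ _ (is_derive_line0 (Ck_derivable (Co 1%N)))).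
move=> sf; apply: (der_mk_tvec cX (d := fun f => derive1 (fun t => f (c t)) 0)) => // [k a b sa sb|a b sa sb].
- by rewrite !derive1E derive_linE //; exact: dc.
- by rewrite !derive1E derive_mulE ?c0 //; exact: dc.
Qed.

End TangentBundle.

Lemma derive1_affine (R : realType) (a k : R) : derive1 (fun t => a + t * k) 0 = k.
Proof.
have -> : (fun t => a + t * k) = cst a + k \*: id.
  by apply/funext => t; rewrite [t * k]mulrC.
have D : is_derive (0 : R) (1 : R) (cst a + k \*: id) (0 + k *: 1) by exact: is_deriveD.
by rewrite derive1E (@derive_val _ _ _ _ _ _ _ D) add0r [k *: 1]mulr1.
Qed.

Section Prolongation.
Variables (R : realType) (M E : dspace R) (B : vbundle M E).
Hypothesis cM : smooth_complete M.
Hypothesis hB : is_vbundle B.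
Hypothesis hT : is_vbundle (tprol B).
Let cE := total_complete hB.
Let sproj : smooth_map (proj B) := smooth_map_proj hB.

Lemma tangent_total_ext (x y : tangent E) : base x = base y ->
  (forall f, smooth f -> der x (f \o proj B) = der y (f \o proj B)) ->
  (forall xi, smooth xi -> fibre_linear B xi -> der x xi = der y xi) -> x = y.
Proof.
move=> bxy Ef Exi; apply: tvec_ext => // f _.
have dy : derivation_at (base x) (der y) by rewrite bxy; exact: der_derivation.
apply: (derivation_ext cE (vb_smooth hB) (der_derivation x) dy) => g [[h sh <-]|[sg lg]].
  exact: Ef.
exact: Exi.
Qed.

Let W := whitney B.

Let cW : smooth_complete W.
Proof. exact: (@generated_complete R W _ erefl). Qed.

Let smooth_fst : smooth_map (@whitney_fst R M E B).
Proof. by move=> f sf; apply: sub_smooth_closure; exists f => //; left. Qed.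

Let smooth_snd : smooth_map (@whitney_snd R M E B).
Proof. by move=> f sf; apply: sub_smooth_closure; exists f => //; right. Qed.

Let smooth_add : smooth_map (@whitney_add R M E B).
Proof.
apply: (smooth_map_generated cW (vb_smooth hB)) => g [[f sf <-]|[sg lg]].
  have -> : (f \o proj B) \o @whitney_add R M E B = (f \o proj B) \o @whitney_fst R M E B.
    by apply/funext => -[p hp] /=; rewrite /whitney_add /= (vb_add hB).
  exact: (smooth_fst (sproj sf)).
have -> : g \o @whitney_add R M E B = fun p => (g \o @whitney_fst R M E B) p + (g \o @whitney_snd R M E B) p.
  apply/funext => -[[p q] /= hp]; rewrite /whitney_add /= -{1}(vb_scale1 hB p).
  by rewrite lg // mul1r.
by apply: (smoothD cW); [exact: smooth_fst|exact: smooth_snd].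
Qed.

Let whitney_map (Y : dspace R) (a b : Y -> E) (h : forall y, proj B (a y) = proj B (b y)) (y : Y) : W :=
  exist _ (a y, b y) (h y).

Let smooth_whitney_map (Y : dspace R) (a b : Y -> E) h : smooth_complete Y ->
  smooth_map a -> smooth_map b -> smooth_map (@whitney_map Y a b h).
Proof.
move=> cY sa sb; apply: (@smooth_map_generated _ Y W _ _ cY erefl) => g [f sf [->|->]].
  exact: sa.
exact: sb.
Qed.

Let tsum (x y z : tangent E) := exists w : tangent W,
  [/\ push (@whitney_fst R M E B) w = x, push (@whitney_snd R M E B) w = y &
      push (@whitney_add R M E B) w = z].

Let vaddE x y : vadd (tprol B) x y = epsilon_or x (tsum x y).
Proof. by []. Qed.

(* If no [w] projected to [(x, y)], the default value would give
   [x + y = x] and [y + x = y], hence [x = y = 0] by the group laws of [tprol B],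
   but [(0, 0)] does come from the zero section. *)
Let tsum_exists (x y : tangent E) : push (proj B) x = push (proj B) y ->
  exists z, tsum x y z.
Proof.
move=> pxy; apply: contrapT => N.
have N' : ~ exists z, tsum y x z.
  move=> [z [w [w1 w2 _]]]; apply: N.
  have sw := @smooth_whitney_map W (@whitney_snd R M E B) (@whitney_fst R M E B)
    (fun p => esym (svalP p)) cW smooth_snd smooth_fst.
  set sw' := whitney_map _ in sw.
  exists (push (@whitney_add R M E B) (push sw' w)), (push sw' w); split => //.
    by rewrite (push_comp _ cW cE sw smooth_fst).
  by rewrite (push_comp _ cW cE sw smooth_snd).
have E1 : vadd (tprol B) x y = x.
  by rewrite vaddE /epsilon_or; case: pselect.
have E2 : vadd (tprol B) y x = y.
  by rewrite vaddE /epsilon_or; case: pselect.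
have xy : x = y by rewrite -[LHS]E1 -[RHS]E2; exact: (vb_addC hT pxy).
subst y; have x0 : x = push (vzero B) (push (proj B) x).
  rewrite -[RHS](vb_addN hT x) -{3}E1 (vb_addA hT) ?(vb_scale hT) //.
  by rewrite (vb_addN hT) (vb_add0 hT).
apply: N; set v := push (proj B) x in x0 *.
have sz : smooth_map (vzero B) by case: (section_zero cM hB).
have sd := @smooth_whitney_map M (vzero B) (vzero B) (fun=> erefl) cM sz sz.
set d := whitney_map _ in sd.
exists (push (@whitney_add R M E B) (push d v)), (push d v); split => //.
  by rewrite (push_comp _ cW cE sd smooth_fst).
by rewrite (push_comp _ cW cE sd smooth_snd).
Qed.

(** These three clauses characterise the sum, by [tangent_total_ext]; later arguments use them in
    place of the choice in [tprol]. *)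
Lemma tprol_add (x y : tangent E) : push (proj B) x = push (proj B) y ->
  [/\ base (vadd (tprol B) x y) = vadd B (base x) (base y),
      forall f, smooth f -> der (vadd (tprol B) x y) (f \o proj B) = der x (f \o proj B) &
      forall xi, smooth xi -> fibre_linear B xi ->
        der (vadd (tprol B) x y) xi = der x xi + der y xi].
Proof.
move=> /tsum_exists Ex; rewrite vaddE.
have : tsum x y (epsilon_or x (tsum x y)).
  by rewrite /epsilon_or; case: pselect => // h; case: (cid h).
set z := epsilon_or _ _ => -[w [<- <- <-]]; rewrite !base_push; split => //.
- move=> f sf; have sfp := sproj sf; rewrite !(der_push _ cE) //.
  congr (der w _); apply/funext => -[[p q] /= hp].
  by rewrite /whitney_add /= (vb_add hB).
- move=> xi sxi lxi; rewrite !(der_push _ cE) //.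
  rewrite -(derivationD (der_derivation w)); [|exact: smooth_fst|exact: smooth_snd].
  congr (der w _); apply/funext => -[[p q] /= hp].
  by rewrite /whitney_add /= -{1}(vb_scale1 hB p) lxi // mul1r.
Qed.

Let smooth_scale c : smooth_map (vscale B c).
Proof.
apply: (smooth_map_generated cE (vb_smooth hB)) => g [[f sf <-]|[sg lg]].
  have -> : (f \o proj B) \o vscale B c = f \o proj B.
    by apply/funext => x /=; rewrite (vb_scale hB).
  exact: sproj.
have -> : g \o vscale B c = fun x => c * g x.
  apply/funext => x /=.
  exact: (lin_onZ hB (fibre_subspace hB (proj B x)) _ (fibre_linear_on lg)).
exact: (smoothZ cE).
Qed.

Lemma tprol_scale c (x : tangent E) :
  [/\ base (vscale (tprol B) c x) = vscale B c (base x),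
      forall f, smooth f -> der (vscale (tprol B) c x) (f \o proj B) = der x (f \o proj B) &
      forall xi, smooth xi -> fibre_linear B xi -> der (vscale (tprol B) c x) xi = c * der x xi].
Proof.
rewrite /= base_push; split => // [f sf|xi sxi lxi].
  rewrite (der_push _ cE) //; last exact: sproj.
  by congr (der x _); apply/funext => y /=; rewrite (vb_scale hB).
rewrite (der_push _ cE) // -(derivationZ cE (der_derivation x)) //.
congr (der x _); apply/funext => y /=.
exact: (lin_onZ hB (fibre_subspace hB (proj B y)) _ (fibre_linear_on lxi)).
Qed.

Lemma vertical0P (a : E) :
  [/\ base (vertical0 B a) = vzero B (proj B a),
      forall f, smooth f -> der (vertical0 B a) (f \o proj B) = 0 &
      forall xi, smooth xi -> fibre_linear B xi -> der (vertical0 B a) xi = xi a].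
Proof.
have c0 : vscale B 0 a = vzero B (proj B a) by exact: (vscale0 hB).
have xiE xi t : fibre_linear B xi -> xi (vscale B t a) = xi (vzero B (proj B a)) + t * xi a.
  move=> lxi; have l := fibre_linear_on (m := proj B a) lxi.
  by rewrite (lin_onZ hB (fibre_subspace hB _) _ l) // (lin_on0 hB (fibre_subspace hB _) l) add0r.
have aff g : ([set f \o proj B | f in smooth (d := M)] `|` [set xi | smooth xi /\ fibre_linear B xi]) g ->
    exists k, forall t, g (vscale B t a) = g (vzero B (proj B a)) + t * k.
  case=> [[f sf <-]|[_ lg]]; last by exists (g a) => t; exact: xiE.
  by exists 0 => t /=; rewrite (vb_scale hB) (vb_zero hB) mulr0 addr0.
have D := der_curve cE (vb_smooth hB) c0 aff.
split; first exact: base_mk_tvec.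
- move=> f sf; rewrite D; last exact: sproj.
  rewrite -[RHS](derive1_affine (f (proj B a)) 0); congr (derive1 _ 0).
  by apply/funext => t /=; rewrite (vb_scale hB) mulr0 addr0.
- move=> xi sxi lxi; rewrite D // -[RHS](derive1_affine (xi (vzero B (proj B a))) (xi a)).
  by congr (derive1 _ 0); apply/funext => t; exact: xiE.
Qed.

Lemma core_liftP (v : tangent M) (a : E) : proj B a = base v ->
  [/\ base (core_lift B v a) = vzero B (base v),
      forall f, smooth f -> der (core_lift B v a) (f \o proj B) = der v f &
      forall xi, smooth xi -> fibre_linear B xi -> der (core_lift B v a) xi = xi a].
Proof.
move=> pa; have [bv vf vxi] := vertical0P a.
have sz : smooth_map (vzero B) by case: (section_zero cM hB).
have bb : base (push (vzero B) v) = base (vertical0 B a) by rewrite base_push bv pa.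
rewrite /core_lift base_tadd base_push; split => // [f sf|xi sxi lxi].
  rewrite (der_tadd cE bb (sproj sf)) vf // addr0 (der_push _ cE sz (sproj sf)).
  by congr (der v _); apply/funext => m /=; rewrite (vb_zero hB).
rewrite (der_tadd cE bb) // vxi // (der_push _ cE sz) //.
have -> : xi \o vzero B = fun=> 0.
  by apply/funext => m /=; apply: (lin_on0 hB (fibre_subspace hB m)); exact: fibre_linear_on.
by rewrite (derivation_cst cM (der_derivation v)) add0r.
Qed.

Lemma der_push_proj (x : tangent E) f : smooth f -> der (push (proj B) x) f = der x (f \o proj B).
Proof. by move=> sf; rewrite (der_push _ cM). Qed.

Lemma push_proj_section u (v : tangent M) : is_section B u -> push (proj B) (push u v) = v.
Proof.
case=> su pu; rewrite (push_comp _ cE cM su sproj).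
apply: tvec_ext; first by rewrite base_push /= pu.
move=> f sf; rewrite (der_push _ cM) //; last exact: smooth_map_comp.
by congr (der v _); apply/funext => m /=; rewrite pu.
Qed.

Lemma push_proj_ext (x y : tangent E) : base x = base y ->
  (forall f, smooth f -> der x (f \o proj B) = der y (f \o proj B)) ->
  push (proj B) x = push (proj B) y.
Proof.
move=> bxy E1; apply: tvec_ext; first by rewrite !base_push bxy.
by move=> f sf; rewrite !der_push_proj // E1.
Qed.

(** Subtracting a core element changes a tangent vector only on fibrewise linear functions. It turns
    membership in [total_quotient] into equations between values of functionals. *)
Lemma sub_core (x : tangent E) (a : E) : proj B a = proj B (base x) ->
  let z := vadd (tprol B) x (vscale (tprol B) (-1) (core_lift B (push (proj B) x) a)) in
  [/\ base z = base x, forall f, smooth f -> der z (f \o proj B) = der x (f \o proj B) &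
      forall xi, smooth xi -> fibre_linear B xi -> der z xi = der x xi - xi a].
Proof.
move=> pa z; have pa' : proj B a = base (push (proj B) x) by rewrite base_push.
have [cb cf cx] := core_liftP pa'.
have [sb sf sx] := tprol_scale (-1) (core_lift B (push (proj B) x) a).
have pp : push (proj B) x = push (proj B) (vscale (tprol B) (-1) (core_lift B (push (proj B) x) a)).
  apply: tvec_ext; first by rewrite [LHS]base_push [RHS]base_push sb (vb_scale hB) cb (vb_zero hB) base_push.
  by move=> f sff; rewrite [RHS]der_push_proj // sf // cf.
have [zb zf zx] := tprol_add pp; split.
- rewrite zb sb cb (vscaler0 hB) base_push (vaddr0 hB) //.
- by move=> f sff; rewrite zf.
- by move=> xi sxi lxi; rewrite zx // sx // cx // mulN1r.
Qed.

(** [x] and [T u v] have the same base point and the same projection to [TM], so they differ by a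
    core element; [a] is defined by its coordinates in a local frame. *)
Lemma tangent_total_decomp (x : tangent E) u : is_section B u -> u (proj B (base x)) = base x ->
  exists2 a, proj B a = proj B (base x) &
    (forall xi, smooth xi -> fibre_linear B xi ->
       xi a = der (push (proj B) x) (xi \o u) - der x xi) /\
    x = vadd (tprol B) (push u (push (proj B) x))
         (vscale (tprol B) (-1) (core_lift B (push (proj B) (push u (push (proj B) x))) a)).
Proof.
move=> su ux; set m := proj B (base x) in ux *; set v := push (proj B) x.
have bv : base v = m by rewrite /v base_push.
have [g [r [e [xi [[sg gm] se lxi H]]]]] := local_frame hB m.
pose c i := der v (xi i \o u) - der x (xi i).
pose a := lincomb B m (\row_i c i) (fun i => e i m).
have pa : proj B a = m by apply: (proj_lincomb hB) => i; exact: section_proj.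
have sxi i : smooth (xi i) by case: (lxi i).
have ssu f : smooth f -> smooth (f \o u) by case: su => + _; exact.
have sse f i : smooth f -> smooth (f \o e i) by case: (se i) => + _; exact.
(* From the frame coordinates to every fibrewise linear [zeta]: both derivatives are expanded in the
   frame, and the terms [der v (zeta \o e i)] cancel because [u] passes through [base x]. *)
have aE zeta : smooth zeta -> fibre_linear B zeta -> zeta a = der v (zeta \o u) - der x zeta.
  move=> sz lz.
  have zE y : g (proj B y) != 0 -> zeta y = \sum_i xi i y * zeta (e i (proj B y)).
    move=> gy; rewrite {1}(H y gy).
    rewrite (lin_on_lincomb hB (fibre_subspace hB (proj B y)) _ (fibre_linear_on lz)).
      by apply: eq_bigr => i _; rewrite mxE.
    by move=> i; exact: section_proj.
  have szp i : smooth (fun y => zeta (e i (proj B y))) by exact: (sproj (sse _ i sz)).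
  have D1 : der x zeta = \sum_i (xi i (base x) * der v (zeta \o e i) + zeta (e i m) * der x (xi i)).
    have s2 : smooth (fun y => \sum_i xi i y * zeta (e i (proj B y))).
      by apply: (smooth_sum cE) => i; exact: (smoothM cE).
    rewrite (derivation_local (der_derivation x) (sproj sg) gm sz s2 zE).
    rewrite (derivation_sum cE (der_derivation x)); last by move=> i; exact: (smoothM cE).
    apply: eq_bigr => i _; rewrite (derivationM (der_derivation x)) //.
    by rewrite /v der_push_proj //; exact: sse.
  have D2 : der v (zeta \o u) = \sum_i (xi i (base x) * der v (zeta \o e i) + zeta (e i m) * der v (xi i \o u)).
    have gv : g (base v) != 0 by rewrite bv.
    have s2 : smooth (fun p => \sum_i (xi i \o u) p * (zeta \o e i) p).
      by apply: (smooth_sum cM) => i; apply: (smoothM cM); [exact: ssu|exact: sse].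
    have zuE p : g p != 0 -> (zeta \o u) p = \sum_i (xi i \o u) p * (zeta \o e i) p.
      by move=> gp /=; rewrite zE ?(section_proj _ su).
    rewrite (derivation_local (der_derivation v) sg gv (ssu _ sz) s2 zuE).
    rewrite (derivation_sum cM (der_derivation v)); last first.
      by move=> i; apply: (smoothM cM); [exact: ssu|exact: sse].
    apply: eq_bigr => i _; rewrite (derivationM (der_derivation v)); [|exact: ssu|exact: sse].
    by rewrite /= bv ux.
  rewrite D1 D2 -sumrB /a.
  rewrite (lin_on_lincomb hB (fibre_subspace hB m) _ (fibre_linear_on lz)); last first.
    by move=> i; exact: section_proj.
  by apply: eq_bigr => i _; rewrite mxE /c; ring.
exists a => //; split => //.
have bu : base (push u v) = base x by rewrite base_push bv ux.
have pa' : proj B a = proj B (base (push u v)) by rewrite bu.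
have [zb zf zx] := sub_core pa'.
have su' : smooth_map u by case: su.
apply: tangent_total_ext; first by rewrite zb bu.
- move=> f sf; rewrite zf // -!der_push_proj // push_proj_section //.
- by move=> zeta sz lz; rewrite zx // (der_push _ cE) // aE //; ring.
Qed.

End Prolongation.

(** * Linear Dirac structures and pseudo-Dirac structures *)

Section Correspondence.
Variables (R : realType) (M E : dspace R) (B : vbundle M E) (C : courant B)
  (CT : courant (tprol B)).
Hypothesis hM : is_manifold M.
Hypothesis hC : is_courant C.
Hypothesis hCT : is_tangent_courant C CT.

Let cM : smooth_complete M := mfd_closed hM.
Let hB : is_vbundle B := ca_bundle hC.
Let hT : is_vbundle (tprol B) := ca_bundle (tc_courant hCT).
Let cE : smooth_complete E := total_complete hB.
Let sproj : smooth_map (proj B) := smooth_map_proj hB.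
Local Notation "<| x , y |>" := (pairing C x y).

Variables (U : set E) (D : set (tangent E)) (nab : conn M E).
Hypothesis hD : linear_dirac CT U D.
Hypothesis hP : is_pseudo_dirac C U nab.
Hypothesis hA : associated C U D nab.

Let hU : is_subbundle B setT U := pd_subbundle hP.

Lemma nab_lin_arg u v : section_in B U u -> lin_on B (Ufib B U (base v)) (nab u v).
Proof. by move=> su c x y [Ux px] [Uy py]; exact: (pd_lin_arg hP). Qed.

Lemma nab_zero_vec u w : section_in B U u -> U w -> nab u (vzero (tbundle M) (proj B w)) w = 0.
Proof.
move=> su Uw; set z := vzero _ _.
have bz : base z = proj B w by exact: base_tzero.
have E1 : vadd (tbundle M) (vscale (tbundle M) 1 z) z = z.
  apply: tvec_ext; first by rewrite base_tadd base_tscale.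
  by move=> f sf; rewrite der_tadd ?base_tscale // der_tscale // !der_tzero // mulr0 addr0.
by have := pd_lin_vec hP 1 su Uw bz bz; rewrite E1 mul1r => /eqP; rewrite addrC -subr_eq subrr eq_sym => /eqP.
Qed.

Lemma nab_zero_arg u v : section_in B U u -> nab u v (vzero B (base v)) = 0.
Proof. by move=> su; exact: (lin_on0 hB (Ufib_subspace hB hU (base v)) (nab_lin_arg su)). Qed.

Lemma nab_scale u w c v : section_in B U u -> U w -> base v = proj B w ->
  nab u (vscale (tbundle M) c v) w = c * nab u v w.
Proof.
move=> su Uw bv; have bz : base (vzero (tbundle M) (proj B w)) = proj B w by exact: base_tzero.
rewrite -[RHS]addr0 -[X in _ + X](nab_zero_vec su Uw) -(pd_lin_vec hP) //.
congr (nab u _ w); apply: tvec_ext; first by rewrite base_tadd.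
by move=> f sf; rewrite der_tadd ?base_tscale ?bz // der_tzero // addr0.
Qed.

(** Relations between tangent vectors are only available on test functions and up to a factor [c].
    They are carried over to [nab u] by realising the right-hand side as an actual tangent vector
    [S]. *)
Lemma nab_comb (J : Type) (r : seq J) (k : J -> R) (V : J -> tangent M) (c : R) (v : tangent M) u w :
  section_in B U u -> U w -> base v = proj B w -> (forall j, base (V j) = proj B w) ->
  (forall f, smooth f -> c * der v f = \sum_(j <- r) k j * der (V j) f) ->
  c * nab u v w = \sum_(j <- r) k j * nab u (V j) w.
Proof.
move=> su Uw bv bV E1; set m := proj B w in bv bV *.
have [S [bS dS nS]] : exists S : tangent M, [/\ base S = m,
    forall f, smooth f -> der S f = \sum_(j <- r) k j * der (V j) f &
    nab u S w = \sum_(j <- r) k j * nab u (V j) w].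
  elim: r {E1} => [|j r [S [bS dS nS]]].
    exists (vzero (tbundle M) m); split; first exact: base_tzero.
      by move=> f sf; rewrite big_nil der_tzero.
    by rewrite big_nil nab_zero_vec.
  exists (vadd (tbundle M) (vscale (tbundle M) (k j) (V j)) S); split.
  - by rewrite base_tadd base_tscale.
  - by move=> f sf; rewrite der_tadd ?base_tscale ?bV ?bS // der_tscale // big_cons dS.
  - by rewrite (pd_lin_vec hP) // big_cons nS.
rewrite -nS -nab_scale //; congr (nab u _ w).
apply: tvec_ext; first by rewrite base_tscale bv bS.
by move=> f sf; rewrite der_tscale // E1 // dS.
Qed.

Lemma pair_withE w u m : is_section B u -> pair_with C w (u m) = <|u m, w m|>.
Proof. by move=> su; rewrite /pair_with section_proj. Qed.

Lemma nab_metric u w v : section_in B U u -> section_in B U w ->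
  der v (pair_with C w \o u) = nab u v (w (base v)) + nab w v (u (base v)).
Proof.
move=> su sw; rewrite -(pd_metric hP v su sw); congr (der v _).
by apply/funext => m /=; apply: pair_withE; case: su.
Qed.

(** Write [x] as [T u v] minus a core element [a]. Then [x] is in [D] iff [a] represents [nab u v],
    while [<a, w> = v<u, w> - x(l_w)]. The metric property turns [v<u, w> - nab u v w] into
    [nab w v u], so that only the value [base x] of the auxiliary section [u] remains in the
    condition. *)
Lemma dirac_mem x : D x <-> U (base x) /\ forall w, section_in B U w ->
  der x (pair_with C w) = nab w (push (proj B) x) (base x).
Proof.
suff key : U (base x) -> (D x <-> forall w, section_in B U w ->
    der x (pair_with C w) = nab w (push (proj B) x) (base x)).
  split => [Dx|[Ux]]; last by move/(key Ux).
  have Ux := sb_base (ld_over_E hD) Dx.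
  by split => //; apply/(key Ux).
move=> Ux; have [u su ux] := extend_section_in cM hB hU Ux.
have su' : is_section B u by case: su.
have [a pa [aE xE]] := tangent_total_decomp cM hB hT su' ux.
set v := push (proj B) x in aE xE *.
have bv : base v = proj B (base x) by rewrite /v base_push.
have ubv : u (base v) = base x by rewrite bv.
have pav : proj B a = base v by rewrite bv.
have Tq : total_quotient B U D (push u v) a <-> D x.
  rewrite /total_quotient base_push ubv -xE; split => [[]//|Dx]; split => //.
rewrite -Tq (hA su pav).
have aw w : section_in B U w -> <|a, w (base v)|> = der v (pair_with C w \o u) - der x (pair_with C w).
  move=> [sw _]; rewrite -aE; first by rewrite /pair_with pav.
    exact: (smooth_pair_with hC).
  exact: (fibre_linear_pair_with hC).
split => [H w sw|H w0 Uw0 pw0].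
- have Uw : U (w (base v)) by case: sw.
  have pw : proj B (w (base v)) = base v by apply: section_proj; case: sw.
  have := aw w sw; rewrite -(H _ Uw pw) (nab_metric v su sw) ubv.
  move=> E1; apply/eqP; rewrite -subr_eq0; apply/eqP.
  by move/eqP: E1; rewrite -subr_eq0 => /eqP E1; rewrite -[RHS]E1; ring.
- have [w sw ww] := extend_section_in cM hB hU Uw0.
  have wE : w (base v) = w0 by rewrite -pw0.
  rewrite -wE aw // (nab_metric v su sw) H // ubv.
  by rewrite addrK.
Qed.

(** Subtract from [T u v] the core element that represents [nab u v]. *)
Lemma dirac_lift (y : E) (v : tangent M) : U y -> base v = proj B y ->
  exists x, [/\ D x, base x = y & push (proj B) x = v].
Proof.
move=> Uy bv; have [u su uy] := extend_section_in cM hB hU Uy.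
have su' : is_section B u by case: su.
have [a pa aE] := represent_at cM hC hU (nab_lin_arg (v := v) su).
have /(hA su pa) [_ _ Dx] : forall w, U w -> proj B w = base v -> nab u v w = <|a, w|> by exact: aE.
have pa' : proj B a = proj B (base (push u v)) by rewrite base_push section_proj.
have [zb zf zx] := sub_core cM hB hT pa'.
eexists; split; [exact: Dx|by rewrite zb base_push bv|].
rewrite (push_proj_ext cM hB zb zf).
exact: (push_proj_section cM hB).
Qed.

Lemma vfield_scale f X : smooth f -> vfield X -> vfield (fun m : M => vscale (tbundle M) (f m) (X m)).
Proof.
move=> sf vX; apply: (vfieldP cM) => [m|h sh]; first by rewrite base_tscale base_vfield.
under [Y in smooth Y]eq_fun do rewrite (der_tscale cM) //.
by apply: (smoothM cM) => //; exact: (smooth_vfield vX).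
Qed.

(** * Representatives of the induced connection *)

Section Isotropy.
Hypothesis orthU : orth C U `<=` U.
Hypothesis nab_orth : forall u v w, section_in B (orth C U) u -> U w -> proj B w = base v ->
  nab u v w = 0.

Lemma section_orth tau : section_in B (orth C U) tau -> section_in B U tau.
Proof. by move=> [st Ot]; split => // m; exact: orthU. Qed.

Lemma pair_with_orth tau x : section_in B (orth C U) tau -> U x -> pair_with C tau x = 0.
Proof.
move=> [st Ot] Ux; rewrite /pair_with (ca_pair_sym hC) ?section_proj //.
by apply: Ot => //; rewrite section_proj.
Qed.

(** For [tau] in the orthogonal of [U] the function [<u, tau>] is zero, so the metric property
    exchanges [nab u v tau] for minus [nab tau v u]. This is what places the derivatives in
    [U/U^perp]. *)
Lemma nab_orth_arg u v y : section_in B U u -> orth C U y -> proj B y = base v -> nab u v y = 0.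
Proof.
move=> su Oy py; have [tau st ty] := extend_orth cM hC hU Oy.
have st' := section_orth st.
have := nab_metric v su st'.
have -> : pair_with C tau \o u = fun=> 0.
  by apply/funext => m /=; apply: pair_with_orth => //; case: su.
rewrite (derivation_cst cM (der_derivation v)) -{1}py ty (nab_orth st) ?addr0 //.
- by case: su.
- by apply: section_proj; case: su.
Qed.

(** The representative is first found as a section of [E]; it lies in [U] because [nab w] kills the
    orthogonal of [U], whose own orthogonal is contained in [U]. One [eta] serves all [X] and [w],
    so a whole frame can be rescaled at once. *)
Lemma represent_conn (m : M) : exists eta : M -> R, [/\ smooth eta, eta m != 0 &
  forall X w, vfield X -> section_in B U w -> exists sigma,
    induced_conn C U nab (fun p => vscale (tbundle M) (eta p) (X p)) w sigma].
Proof.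
have [eta [se em H]] := represent_functional cM hC hU m.
exists eta; split => // X w vX sw.
have [|s ss|sigma ssig sE] := H (fun y => nab w (X (proj B y)) y).
- move=> p c x y [Ux px] [Uy py].
  have pxy : proj B (vadd B (vscale B c x) y) = p by apply: (sub_lin (fibre_subspace hB p)).
  by rewrite pxy px py (nab_lin_arg sw) //; split; rewrite ?base_vfield.
- have := pd_smooth hP sw vX ss.
  by congr smooth; apply/funext => p /=; rewrite section_proj //; case: ss.
have sE' y : U y -> nab w (vscale (tbundle M) (eta (proj B y)) (X (proj B y))) y = <|sigma (proj B y), y|>.
  by move=> Uy; rewrite sE // nab_scale // base_vfield.
exists sigma; split => //; split => // p.
apply: (orth_orth cM hC hU) => y Oy; rewrite section_proj // => py.
have := sE' y (orthU Oy); rewrite py => <-.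
by apply: nab_orth_arg => //; rewrite base_tscale base_vfield.
Qed.

End Isotropy.

(** The pairing of [R(X, Y) w] with [s], when [sX] and [sY] represent the derivatives of [w] along
    [X] and [Y]. *)
Definition curvature X Y w sX sY (s : E) : R :=
  nab sY (X (proj B s)) s - nab sX (Y (proj B s)) s - nab w (lie X Y (proj B s)) s.

(** * Commutators of sections of [D] evaluated on fibrewise linear functions *)

Section Master.
Hypothesis tangent_U : forall x, D x -> forall f, smooth f -> (forall s, U s -> f s = 0) -> der x f = 0.
Variables (J : finType) (X : J -> M -> tangent M) (sigma : J -> M -> E) (w : M -> E) (gamma : M -> R).
Hypothesis vX : forall j, vfield (X j).
Hypothesis sw : section_in B U w.
Hypothesis sgamma : smooth gamma.
Hypothesis hsigma : forall j, induced_conn C U nab (X j) w (sigma j).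

(** The projection of [A e] to [M] may vary within a fibre, so the coefficients [alpha] live on [E].
    The factor [gamma] replaces division by a function that is nonzero only near the point of
    interest. *)
Definition expands (A : E -> tangent E) (alpha : J -> E -> R) : Prop :=
  [/\ vfield A, forall s, U s -> D (A s), forall j, smooth (alpha j) &
      forall e f, U e -> smooth f -> gamma (proj B e) * der (A e) (f \o proj B) =
        \sum_j alpha j e * der (X j (proj B e)) f].

Let nab_X j e : U e -> nab w (X j (proj B e)) e = pair_with C (sigma j) e.
Proof.
move=> Ue; case: (hsigma j) => [[ss _]] ->//; rewrite /pair_with.
by rewrite (ca_pair_sym hC) // section_proj.
Qed.

Let nab_expand u A alpha e : section_in B U u -> expands A alpha -> U e ->
  gamma (proj B e) * nab u (push (proj B) (A e)) e = \sum_j alpha j e * nab u (X j (proj B e)) e.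
Proof.
move=> su [vA _ _ EA] Ue; apply: nab_comb => //.
- by rewrite base_push base_vfield.
- by move=> j; rewrite base_vfield.
- by move=> f sf; rewrite der_push_proj // EA.
Qed.

(** The Leibniz rule for an identity that holds on [U] only: the difference of the two sides
    vanishes on [U] and is therefore killed by [x]. *)
Let der_expand x G (alpha H : J -> E -> R) : D x -> smooth G ->
  (forall j, smooth (alpha j)) -> (forall j, smooth (H j)) ->
  (forall e, U e -> gamma (proj B e) * G e = \sum_j alpha j e * H j e) ->
  gamma (proj B (base x)) * der x G + G (base x) * der x (gamma \o proj B) =
  \sum_j (alpha j (base x) * der x (H j) + H j (base x) * der x (alpha j)).
Proof.
move=> Dx sG sa sH EG; have sgp := sproj sgamma; have dx := der_derivation x.
have s1 : smooth (fun e => gamma (proj B e) * G e) by exact: (smoothM cE).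
have s2 j : smooth (fun e => alpha j e * H j e) by exact: (smoothM cE).
have s3 : smooth (fun e => \sum_j alpha j e * H j e) by exact: (smooth_sum cE).
have := tangent_U Dx (smoothB cE s1 s3).
rewrite (derivationB cE dx) // (derivationM dx) // (derivation_sum cE dx) //.
move=> H0; apply/eqP; rewrite -subr_eq0; apply/eqP; rewrite -[RHS]H0; last first.
  by move=> e Ue; rewrite EG // subrr.
by congr (_ - _); apply: eq_bigr => j _; rewrite (derivationM dx).
Qed.

(** [der x (H j)] is itself known only after multiplication by [gamma], whence the square. The lemma
    is used for [H j] equal to [l_(sigma j)], with [N i j] given by [nab (sigma j)] along [X i], and
    for [H j] equal to [X j f], with [N i j] equal to [X i (X j f)]. *)
Let second_order x G (a : J -> R) (alpha H : J -> E -> R) (N : J -> J -> R) :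
  D x -> smooth G -> (forall j, smooth (alpha j)) -> (forall j, smooth (H j)) ->
  (forall e, U e -> gamma (proj B e) * G e = \sum_j alpha j e * H j e) ->
  (forall j, gamma (proj B (base x)) * der x (H j) = \sum_i a i * N i j) ->
  gamma (proj B (base x)) ^+ 2 * der x G =
    gamma (proj B (base x)) * (\sum_j H j (base x) * der x (alpha j)
      - G (base x) * der x (gamma \o proj B))
    + \sum_i \sum_j a i * alpha j (base x) * N i j.
Proof.
move=> Dx sG sa sH EG EN; have E1 := der_expand Dx sG sa sH EG.
set c := gamma (proj B (base x)) in E1 EN *.
have -> : \sum_i \sum_j a i * alpha j (base x) * N i j = c * \sum_j alpha j (base x) * der x (H j).
  rewrite exchange_big mulr_sumr; apply: eq_bigr => j _.
  rewrite mulrCA EN mulr_sumr; apply: eq_bigr => i _; ring.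
rewrite big_split /= in E1.
rewrite expr2 -mulrA -[c * der x G](addrK (G (base x) * der x (gamma \o proj B))) E1.
by ring.
Qed.

Let pair_second_order A alpha A' alpha' s : expands A alpha -> expands A' alpha' -> U s ->
  gamma (proj B s) ^+ 2 * der (A s) (fun e => der (A' e) (pair_with C w)) =
    gamma (proj B s) * (\sum_j pair_with C (sigma j) s * der (A s) (alpha' j)
      - der (A' s) (pair_with C w) * der (A s) (gamma \o proj B))
    + \sum_i \sum_j alpha i s * alpha' j s * nab (sigma j) (X i (proj B s)) s.
Proof.
move=> eA eA' Us; have [vA DA sa EA] := eA; have [vA' DA' sa' EA'] := eA'.
have bA : base (A s) = s by exact: base_vfield.
have sw' : is_section B w by case: sw.
have ssig j : section_in B U (sigma j) by case: (hsigma j).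
have spw := smooth_pair_with hC sw'.
have sps j : smooth (pair_with C (sigma j)) by apply: (smooth_pair_with hC); case: (ssig j).
have EG e : U e -> gamma (proj B e) * der (A' e) (pair_with C w) = \sum_j alpha' j e * pair_with C (sigma j) e.
  move=> Ue; have [_ /(_ w sw) ->] := (dirac_mem (A' e)).1 (DA' e Ue).
  rewrite base_vfield // (nab_expand sw eA' Ue).
  by apply: eq_bigr => j _; rewrite nab_X.
have := @second_order _ _ (alpha^~ s) _ _ (fun i j => nab (sigma j) (X i (proj B s)) s)
  (DA s Us) (smooth_vfield vA' spw) sa' sps EG.
rewrite bA; apply => j.
have [_ /(_ _ (ssig j)) ->] := (dirac_mem (A s)).1 (DA s Us).
by rewrite bA (nab_expand (ssig j) eA Us).
Qed.

Let base_second_order A alpha A' alpha' s f : expands A alpha -> expands A' alpha' -> U s -> smooth f ->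
  gamma (proj B s) ^+ 2 * der (A s) (fun e => der (A' e) (f \o proj B)) =
    gamma (proj B s) * (\sum_j der (X j (proj B s)) f * der (A s) (alpha' j)
      - der (A' s) (f \o proj B) * der (A s) (gamma \o proj B))
    + \sum_i \sum_j alpha i s * alpha' j s * der (X i (proj B s)) (fun m => der (X j m) f).
Proof.
move=> eA eA' Us sf; have [vA DA sa EA] := eA; have [vA' DA' sa' EA'] := eA'.
have bA : base (A s) = s by exact: base_vfield.
have sX j : smooth (fun m => der (X j m) f) by exact: smooth_vfield.
have := @second_order _ _ (alpha^~ s) _ _ (fun i j => der (X i (proj B s)) (fun m => der (X j m) f))
  (DA s Us) (smooth_vfield vA' (sproj sf)) sa' (fun j => sproj (sX j)) (fun e Ue => EA' e f Ue sf).
by rewrite bA; apply => j; exact: EA.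
Qed.

(** The second-order expansions of [l_w] and of basic functions have the same shape. Terms with
    derivatives of [alpha] match since [nab w] along [X j] is [l_(sigma j)] on [U]; terms with
    derivatives of [gamma] match since [A] and [A'] take values in [D]. What is left is
    antisymmetrised second derivatives against [nab w] of the brackets [[X i, X j]]. *)
Lemma master_identity A alpha A' alpha' s : expands A alpha -> expands A' alpha' -> U s ->
  gamma (proj B s) ^+ 2 * (der (lie A A' s) (pair_with C w) - nab w (push (proj B) (lie A A' s)) s) =
  \sum_i \sum_j alpha i s * alpha' j s * curvature (X i) (X j) w (sigma i) (sigma j) s.
Proof.
move=> eA eA' Us; have [vA DA sa EA] := eA; have [vA' DA' sa' EA'] := eA'.
set m := proj B s; set c := gamma m.
have bA : base (A s) = s by exact: base_vfield.
have bA' : base (A' s) = s by exact: base_vfield.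
have sw' : is_section B w by case: sw.
have spw := smooth_pair_with hC sw'.
have pA : nab w (push (proj B) (A s)) s = der (A s) (pair_with C w).
  by have [_ /(_ w sw) ->] := (dirac_mem (A s)).1 (DA s Us); rewrite bA.
have pA' : nab w (push (proj B) (A' s)) s = der (A' s) (pair_with C w).
  by have [_ /(_ w sw) ->] := (dirac_mem (A' s)).1 (DA' s Us); rewrite bA'.
pose dg := der (A s) (gamma \o proj B); pose dg' := der (A' s) (gamma \o proj B).
pose da j := der (A s) (alpha' j) - der (A' s) (alpha j).
(* the vectors occurring in the projection of [A, A'] to M *)
pose I := (J + (bool + J * J))%type.
pose k (i : I) : R := match i with
  | inl j => c * da j
  | inr (inl b) => if b then - (c * dg) else c * dg'
  | inr (inr ij) => alpha ij.1 s * alpha' ij.2 s end.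
pose V (i : I) : tangent M := match i with
  | inl j => X j m
  | inr (inl b) => if b then push (proj B) (A' s) else push (proj B) (A s)
  | inr (inr ij) => lie (X ij.1) (X ij.2) m end.
have sumE (F : tangent M -> R) : \sum_i k i * F (V i) =
    c * (\sum_j F (X j m) * da j) - c * (F (push (proj B) (A' s)) * dg - F (push (proj B) (A s)) * dg')
    + \sum_i \sum_j alpha i s * alpha' j s * F (lie (X i) (X j) m).
  rewrite big_sumType /= big_sumType /= big_bool /= -(pair_bigA _ (fun i j => alpha i s * alpha' j s * F (lie (X i) (X j) m))) /=.
  rewrite addrA; congr (_ + _).
  rewrite mulr_sumr (eq_bigr (fun j => c * (F (X j m) * da j))) => [|j _]; last by ring.
  by ring.
(* Tested on basic functions, [c ^+ 2] times the projected bracket is the combination of the [V i]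
   with weights [k i]; [nab_comb] transfers this to [nab w]. *)
have NL : c ^+ 2 * nab w (push (proj B) (lie A A' s)) s = \sum_(i : I) k i * nab w (V i) s.
  apply: nab_comb => //.
  - by rewrite base_push base_lie.
  - case=> [j|[b|ij]] /=; first by rewrite base_vfield.
    + by case: b; rewrite base_push ?bA ?bA'.
    + by rewrite base_lie.
  move=> f sf; rewrite (sumE (fun v => der v f)) !der_push_proj // (der_lie cE s vA vA' (sproj sf)) mulrBr.
  rewrite (base_second_order eA eA' Us sf) (base_second_order eA' eA Us sf) -/m -/c -/dg -/dg'.
  rewrite [X in _ - (_ + X)]exchange_big /=.
  have -> : \sum_i \sum_j alpha i s * alpha' j s * der (lie (X i) (X j) m) f =
     \sum_i \sum_j alpha i s * alpha' j s * der (X i m) (fun m => der (X j m) f) -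
     \sum_i \sum_j alpha' j s * alpha i s * der (X j m) (fun m => der (X i m) f).
    rewrite -sumrB; apply: eq_bigr => i _; rewrite -sumrB; apply: eq_bigr => j _.
    by rewrite (der_lie cM) //; ring.
  have -> : \sum_j der (X j m) f * da j = \sum_j der (X j m) f * der (A s) (alpha' j) -
     \sum_j der (X j m) f * der (A' s) (alpha j).
    by rewrite -sumrB; apply: eq_bigr => j _; rewrite mulrBr.
  by ring.
rewrite mulrBr NL (sumE (fun v => nab w v s)) pA pA' (der_lie cE s vA vA' spw) mulrBr.
rewrite (pair_second_order eA eA' Us) (pair_second_order eA' eA Us) -/m -/c -/dg -/dg'.
rewrite [X in _ - (_ + X) - _]exchange_big /=.
have -> : \sum_i \sum_j alpha i s * alpha' j s * curvature (X i) (X j) w (sigma i) (sigma j) s =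
   \sum_i \sum_j alpha i s * alpha' j s * nab (sigma j) (X i m) s -
   \sum_i \sum_j alpha' j s * alpha i s * nab (sigma i) (X j m) s -
   \sum_i \sum_j alpha i s * alpha' j s * nab w (lie (X i) (X j) m) s.
  rewrite -!sumrB; apply: eq_bigr => i _; rewrite -!sumrB; apply: eq_bigr => j _.
  by rewrite /curvature -/m; ring.
have -> : \sum_j nab w (X j m) s * da j = \sum_j pair_with C (sigma j) s * der (A s) (alpha' j) -
   \sum_j pair_with C (sigma j) s * der (A' s) (alpha j).
  by rewrite -sumrB; apply: eq_bigr => j _; rewrite nab_X // mulrBr.
by ring.
Qed.

End Master.
Lemma extend_dirac x : D x -> exists A : E -> tangent E,
  [/\ vfield A, forall s, U s -> D (A s) & A (base x) = x].
Proof.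
move=> Dx; have hDE := ld_over_E hD; have Ux := sb_base hDE Dx.
have [V [r [s [[oV Vx] ss Ds H]]]] := sb_frame hDE Ux.
have [g sg [gx gV]] := oV _ Vx.
have [c [xE _]] := H x Dx Vx.
have bs i e : base (s i e) = e by case: (ss i) => _; exact.
pose L e := lincomb (tbundle E) e c (fun i => s i e).
have bL e : base (L e) = e by case: (der_tlincomb cE c (fun i => bs i e) (smooth_cst cE 0)).
exists (fun e => vscale (tbundle E) ((g (base x))^-1 * g e) (L e)); split.
- apply: (vfieldP cE) => [e|f sf]; first by rewrite base_tscale bL.
  have -> : (fun e => der (vscale (tbundle E) ((g (base x))^-1 * g e) (L e)) f) =
      fun e => (g (base x))^-1 * g e * \sum_i c 0 i * der (s i e) f.
    apply/funext => e; rewrite (der_tscale cE) //; congr (_ * _).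
    by case: (der_tlincomb cE c (fun i => bs i e) sf).
  apply: (smoothM cE); first exact: (smoothZ cE).
  apply: (smooth_sum cE) => i; apply: (smoothZ cE).
  exact: (smooth_vfield (ss i) sf).
- move=> e Ue; have [g0|ge] := eqVneq (g e) 0.
    rewrite g0 mulr0; have -> : vscale (tbundle E) 0 (L e) = vzero (tbundle E) e.
      apply: tvec_ext; first by rewrite base_tscale base_tzero.
      by move=> f sf; rewrite (der_tscale cE) // mul0r (der_tzero cE).
    exact: (sb_zero hDE).
  apply: (sb_scale hDE); suff : D (L e) /\ base (L e) = e by case.
  rewrite /L /lincomb; elim/big_ind: _ => [|y z [Dy by_] [Dz bz]|i _].
  + by split; [exact: (sb_zero hDE)|exact: base_tzero].
  + split; last by rewrite base_tadd.
    by apply: (sb_add hDE) => //; rewrite /= by_ bz.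
  + split; last by rewrite base_tscale.
    by apply: (sb_scale hDE); apply: Ds => //; exact: gV.
- rewrite mulVf // [RHS]xE; apply: tvec_ext; first by rewrite base_tscale.
  by move=> f sf; rewrite (der_tscale cE) // mul1r.
Qed.

(** * From Lie subalgebroids to flat pseudo-Dirac structures *)

Section LieSubalgebroid.
Hypothesis hL : lie_subalgebroid U D.

(** For [a] orthogonal to [U], the vertical vector at zero in direction [a] belongs to [D], so it is
    tangent to [U]. Tested on [l_tau], which vanishes on [U], this gives [<a, tau> = 0], and [a] is
    in the double orthogonal of [U]. *)
Lemma la_orth : orth C U `<=` U.
Proof.
move=> a Oa; apply: (orth_orth cM hC hU) => y Oy pya.
have [bv vf vxi] := vertical0P hB a.
have Dv : D (vertical0 B a).
  apply/dirac_mem; rewrite bv; split; first exact: (sb_zero hU).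
  move=> w sw; have sw' : is_section B w by case: sw.
  rewrite vxi; [|exact: (smooth_pair_with hC)|exact: (fibre_linear_pair_with hC)].
  rewrite /pair_with Oa; [|by case: sw|exact: section_proj].
  have -> : vzero B (proj B a) = vzero B (base (push (proj B) (vertical0 B a))).
    by rewrite base_push bv (vb_zero hB).
  by rewrite nab_zero_arg.
have [tau st ty] := extend_orth cM hC hU Oy.
have st' : is_section B tau by case: st.
have := lsa_anchor hL Dv (smooth_pair_with hC st') (fun x Ux => pair_with_orth st Ux).
rewrite vxi; [|exact: (smooth_pair_with hC)|exact: (fibre_linear_pair_with hC)].
by rewrite /pair_with -pya ty.
Qed.

(** [nab u v w] is the derivative of [l_u] along a lift of [v] to [D] at [w]; the lift is tangent to
    [U], on which [l_u] vanishes. *)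
Lemma la_nab_orth u v w : section_in B (orth C U) u -> U w -> proj B w = base v -> nab u v w = 0.
Proof.
move=> su Uw pw; have [x [Dx bx px]] := dirac_lift Uw (esym pw).
have su' : is_section B u by case: su.
have [_ /(_ u (section_orth la_orth su))] := (dirac_mem x).1 Dx.
rewrite px bx => <-.
exact: (lsa_anchor hL Dx (smooth_pair_with hC su') (fun x Ux => pair_with_orth su Ux)).
Qed.

Lemma la_induced_flat : induced_flat C U nab.
Proof.
move=> X Y u sX sY vX vY su iX iY s Us; set m := proj B s.
have [n [phi [g0 [F [[sg0 g0m] sphi vF EF]]]]] := manifold_frame hM m.
have [eta [se em rep]] := represent_conn la_orth la_nab_orth m.
have /choice[sF iF] : forall k, exists t, induced_conn C U nab
    (fun p => vscale (tbundle M) (eta p) (F k p)) u t by move=> k; exact: rep.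
pose gamma p := eta p * g0 p.
have sgamma : smooth gamma by exact: (smoothM cM).
(* [X] and [Y] are added to the rescaled frame because their lifts [A] and [A'] project to them at
   [s] only; elsewhere the frame absorbs the discrepancy. *)
pose X' (j : bool + 'I_n) : M -> tangent M := match j with
  | inl b => if b then X else Y
  | inr k => fun p => vscale (tbundle M) (eta p) (F k p) end.
pose sigma (j : bool + 'I_n) := match j with inl b => if b then sX else sY | inr k => sF k end.
have vX' j : vfield (X' j) by case: j => [[]|k] //; exact: vfield_scale.
have hsigma j : induced_conn C U nab (X' j) u (sigma j) by case: j => [[]|k] //; exact: iF.
(* The defect of [A] from projecting to [Z], in coordinates. It vanishes at [s], so of the double
   sum of curvatures only the term of [X] and [Y] survives there. *)
pose coef (Z : M -> tangent M) (A : E -> tangent E) k e :=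
  der (A e) (phi k \o proj B) - der (Z (proj B e)) (phi k).
have scoef Z A k : vfield Z -> vfield A -> smooth (coef Z A k).
  move=> vZ vA; apply: (smoothB cE); first exact: (smooth_vfield vA (sproj (sphi k))).
  exact: (sproj (smooth_vfield vZ (sphi k))).
have decomp Z A e f : vfield Z -> vfield A -> smooth f ->
    gamma (proj B e) * der (A e) (f \o proj B) = gamma (proj B e) * der (Z (proj B e)) f +
    \sum_k coef Z A k e * der (vscale (tbundle M) (eta (proj B e)) (F k (proj B e))) f.
  move=> vZ vA sf.
  have EA := EF (push (proj B) (A e)) f sf.
  have EZ := EF (Z (proj B e)) f sf.
  rewrite base_push base_vfield // in EA; rewrite base_vfield // in EZ.
  rewrite /gamma -!mulrA EZ -(der_push_proj cM hB) // EA !mulr_sumr -big_split /=.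
  apply: eq_bigr => k _; rewrite (der_tscale cM) // /coef (der_push_proj cM hB) //.
  by ring.
have [x [Dx bx px]] := dirac_lift Us (base_vfield m vX).
have [y [Dy by_ py]] := dirac_lift Us (base_vfield m vY).
have [A [vA DA Ax]] := extend_dirac Dx; have [A' [vA' DA' Ay]] := extend_dirac Dy.
rewrite bx in Ax; rewrite by_ in Ay.
pose alpha (j : bool + 'I_n) : E -> R := match j with
  | inl b => if b then gamma \o proj B else fun=> 0 | inr k => coef X A k end.
pose alpha' (j : bool + 'I_n) : E -> R := match j with
  | inl b => if b then fun=> 0 else gamma \o proj B | inr k => coef Y A' k end.
have eA : expands X' gamma A alpha.
  split => // [j|e f Ue sf].
    by case: j => [[]|k]; [exact: (sproj sgamma)|exact: (smooth_cst cE)|exact: scoef].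
  by rewrite big_sumType big_bool /= mul0r addr0 (decomp X).
have eA' : expands X' gamma A' alpha'.
  split => // [j|e f Ue sf].
    by case: j => [[]|k]; [exact: (smooth_cst cE)|exact: (sproj sgamma)|exact: scoef].
  by rewrite big_sumType big_bool /= mul0r add0r (decomp Y).
have coef0 k : coef X A k s = 0.
  by rewrite /coef Ax -(der_push_proj cM hB) // px subrr.
have coef0' k : coef Y A' k s = 0.
  by rewrite /coef Ay -(der_push_proj cM hB) // py subrr.
have DL : D (lie A A' s) by exact: (lsa_bracket hL).
have := master_identity (lsa_anchor hL) vX' su sgamma hsigma eA eA' Us.
have [_ /(_ u su) ->] := (dirac_mem (lie A A' s)).1 DL.
rewrite base_lie subrr mulr0 big_sumType big_bool /=.
rewrite [X in _ + X]big1 => [|k _]; last first.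
  by apply: big1 => j _; rewrite coef0 !mul0r.
rewrite [X in _ + X + _]big1 => [|j _]; last by rewrite !mul0r.
rewrite big_sumType big_bool /= mulr0 mul0r add0r.
rewrite big1 => [|k _]; last by rewrite coef0' mulr0 mul0r.
by rewrite !addr0 -/m => /esym/eqP; rewrite !mulf_eq0 (negPf em) (negPf g0m) /= => /eqP.
Qed.

Lemma la_flat : flat_pseudo_dirac C U nab.
Proof. by split; [exact: la_orth|exact: la_nab_orth|exact: la_induced_flat]. Qed.

End LieSubalgebroid.

(** * From flat pseudo-Dirac structures to Lie subalgebroids *)

Section Flat.
Hypothesis hF : flat_pseudo_dirac C U nab.

Let orthU : orth C U `<=` U. Proof. by case: hF. Qed.

Let nab_orth u v w : section_in B (orth C U) u -> U w -> proj B w = base v -> nab u v w = 0.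
Proof. by case: hF => _ H _; exact: H. Qed.

(* [x] is the sum of [T u v] and of a vertical vector in the direction of [U]. *)
Lemma flat_anchor x : D x -> forall f, smooth f -> (forall s, U s -> f s = 0) -> der x f = 0.
Proof.
move=> Dx f sf f0; have [Ux Hx] := (dirac_mem x).1 Dx.
have [u su ux] := extend_section_in cM hB hU Ux.
have su' : is_section B u by case: su.
have [a pa [aE _]] := tangent_total_decomp cM hB hT su' ux.
set v := push (proj B) x in aE Hx.
have bv : base v = proj B (base x) by rewrite /v base_push.
(* Against [tau] orthogonal to [U], [a] pairs to [v(l_tau \o u) - x(l_tau)]: the first term vanishes
   since [l_tau] is zero on [U], the second equals [nab tau] and vanishes by hypothesis. So [a] is
   in the double orthogonal of [U]. *)
have Ua : U a.
  apply: (orth_orth cM hC hU) => y Oy py; have [tau st ty] := extend_orth cM hC hU Oy.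
  have st' : is_section B tau by case: st.
  have -> : <|a, y|> = pair_with C tau a by rewrite /pair_with -py ty.
  rewrite aE; [|exact: (smooth_pair_with hC)|exact: (fibre_linear_pair_with hC)].
  rewrite (Hx _ (section_orth orthU st)) nab_orth // ?subr0 //.
  have -> : pair_with C tau \o u = fun=> 0.
    by apply/funext => m /=; apply: (pair_with_orth st); case: su.
  exact: (derivation_cst cM (der_derivation v)).
have pc t : proj B (vadd B (vscale B t a) (base x)) = proj B (base x).
  by rewrite (vb_add hB) (vb_scale hB).
have c0 : vadd B (vscale B 0 a) (base x) = base x by rewrite (vscale0 hB) pa (vadd0r hB).
have aff g : ([set f \o proj B | f in smooth (d := M)] `|` [set xi | smooth xi /\ fibre_linear B xi]) g ->
    exists k, forall t, g (vadd B (vscale B t a) (base x)) = g (base x) + t * k.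
  case=> [[h sh <-]|[_ lg]].
    by exists 0 => t /=; rewrite pc mulr0 addr0.
  by exists (g a) => t; rewrite lg // addrC.
have dC := der_curve cE (vb_smooth hB) c0 aff.
(* [c] is the velocity at 0 of the line [t a + base x], which stays in the fibre of [U]. As
   [x + c = T u v], and both [c] and [T u v] kill functions vanishing on [U], so does [x]. *)
set c := mk_tvec (base x) _ in dC.
have bc : base c = base x by exact: base_mk_tvec.
have xc : vadd (tbundle E) x c = push u v.
  apply: (tangent_total_ext hB).
  - by rewrite base_tadd base_push bv ux.
  - move=> h sh; rewrite (der_tadd cE) ?bc //; last exact: sproj.
    rewrite dC; last exact: sproj.
    rewrite -[X in der x _ + X](_ : 0 = _); last first.
      rewrite -[LHS](derive1_affine (h (proj B (base x))) 0); congr (derive1 _ 0).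
      by apply/funext => t /=; rewrite pc mulr0 addr0.
    by rewrite addr0 -!der_push_proj // push_proj_section.
  - move=> xi sxi lxi; rewrite (der_tadd cE) ?bc // dC //.
    rewrite -[X in der x _ + X](_ : xi a = _); last first.
      rewrite -[LHS](derive1_affine (xi (base x)) (xi a)); congr (derive1 _ 0).
      by apply/funext => t; rewrite lxi // addrC.
    rewrite (der_push _ cE) //; last by case: su'.
    by rewrite aE // addrC subrK.
have : der (push u v) f = der x f + der c f by rewrite -xc (der_tadd cE) ?bc.
rewrite dC // (der_push _ cE) //; last by case: su'.
have -> : f \o u = fun=> 0 by apply/funext => m /=; apply: f0; case: su.
rewrite (derivation_cst cM (der_derivation v)).
rewrite -[X in _ + X](_ : 0 = _) ?addr0 //.
rewrite -[LHS](derive1_affine (0 : R) 0); congr (derive1 _ 0).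
apply/funext => t; rewrite mulr0 addr0 f0 //.
have [] // : Ufib B U (proj B (base x)) (vadd B (vscale B t a) (base x)).
exact: (sub_lin (Ufib_subspace hB hU (proj B (base x)))).
Qed.

(** Here [A] and [A'] are arbitrary, so no field on [M] is distinguished: they are expanded in the
    rescaled coordinate frame, and flatness annihilates every curvature term of [master_identity].
    The remaining equation is the membership criterion [dirac_mem], multiplied by [gamma m ^+ 2]. *)
Lemma flat_bracket A A' : vfield A -> vfield A' -> (forall s, U s -> D (A s)) ->
  (forall s, U s -> D (A' s)) -> forall s, U s -> D (lie A A' s).
Proof.
move=> vA vA' DA DA' s Us; set m := proj B s.
have [n [phi [g0 [F [[sg0 g0m] sphi vF EF]]]]] := manifold_frame hM m.
have [eta [se em rep]] := represent_conn orthU nab_orth m.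
apply/dirac_mem; rewrite base_lie; split => // w sw.
pose X k p := vscale (tbundle M) (eta p) (F k p).
have /choice[sigma hsigma] : forall k, exists t, induced_conn C U nab (X k) w t.
  by move=> k; exact: rep.
have vX k : vfield (X k) by exact: vfield_scale.
pose gamma p := eta p * g0 p.
have sgamma : smooth gamma by exact: (smoothM cM).
have ex Z : vfield Z -> (forall s, U s -> D (Z s)) ->
    expands X gamma Z (fun k e => der (Z e) (phi k \o proj B)).
  move=> vZ DZ; split => // [k|e f Ue sf]; first exact: (smooth_vfield vZ (sproj (sphi k))).
  have EZ := EF (push (proj B) (Z e)) f sf.
  rewrite base_push base_vfield // in EZ.
  rewrite /gamma -mulrA -(der_push_proj cM hB) // EZ mulr_sumr.
  apply: eq_bigr => k _; rewrite (der_tscale cM) // (der_push_proj cM hB) //.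
  by ring.
have := master_identity flat_anchor vX sw sgamma hsigma (ex _ vA DA) (ex _ vA' DA') Us.
rewrite big1 => [|i _]; last first.
  apply: big1 => j _; rewrite /curvature.
  by case: hF => _ _ /(_ (X i) (X j) w (sigma i) (sigma j)) -> //; rewrite mulr0.
have gm : gamma m != 0 by exact: mulf_neq0.
by rewrite -/m => /eqP; rewrite mulf_eq0 sqrf_eq0 (negPf gm) /= subr_eq0 => /eqP.
Qed.

Lemma flat_lie_subalgebroid : lie_subalgebroid U D.
Proof.
split; [exact: (ld_over_E hD)|exact: flat_anchor|exact: flat_bracket].
Qed.

End Flat.

End Correspondence.

(** * The equivalence and the restricted bijection *)

Theorem theorem8p14 (R : realType) (M E : dspace R) (B : vbundle M E)
    (C : courant B) (CT : courant (tprol B))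
    (hM : is_manifold M) (hC : is_courant C)
    (hCT : is_tangent_courant C CT) :
  (forall (U : set E) (D : set (tangent E)) (nab : conn M E),
     linear_dirac CT U D -> is_pseudo_dirac C U nab ->
     associated C U D nab ->
     (la_dirac CT U D <-> flat_pseudo_dirac C U nab)) /\
  (corresponds_bijectively C (linear_dirac CT) (is_pseudo_dirac C) ->
   corresponds_bijectively C (la_dirac CT)
     (fun U nab => is_pseudo_dirac C U nab /\ flat_pseudo_dirac C U nab)).
Proof.
have la_iff_flat (U : set E) (D : set (tangent E)) (nab : conn M E) :
    linear_dirac CT U D -> is_pseudo_dirac C U nab -> associated C U D nab ->
    (la_dirac CT U D <-> flat_pseudo_dirac C U nab).
  move=> hD hP hA; split => [[_ hL]|hF]; first exact: (la_flat hM hC hCT hD hP hA hL).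
  by split => //; exact: (flat_lie_subalgebroid hM hC hCT hD hP hA hF).
split => // -[exists_nab exists_D]; split.
- move=> U D LD; have [hD _] := LD; have [[nab [hP hA]] uniq] := exists_nab U D hD.
  split; last by move=> nab1 nab2 a1 a2 [P1 _] [P2 _]; exact: uniq.
  by exists nab; split => //; split => //; apply/(la_iff_flat U D nab).
- move=> U nab [hP hF]; have [D [[hD hA] uniq]] := exists_D U nab hP.
  exists D; split; first by split => //; apply/(la_iff_flat U D nab).
  by move=> D' [[hD' _] hA']; exact: uniq.
Qed.
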